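(* Let $D\ge2$ be an integer and let $p>1$, $c>0$ and $0<a<b$ be real numbers. Assume that $b<(c/v_D)^{1/D}$, where $v_D:=|B_1^D|$, and let $$\gamma_{D,p}:=\left[\frac{T(p;B_1^D)}{T(p;B_1^1)}\right]^{-1/p}.$$ If $\gamma_{D,p}\,b\ge a$, then $$T_p(\Omega_a)\le T_p(\Omega_b)\qquad\text{for all }\Omega_a\in\mathbb{P}^D_c\cap\mathbb{P}^D(a)\text{ and all }\Omega_b\in\mathbb{P}^D_c\cap\mathbb{P}^D(b),$$ with strict inequality (for all such $\Omega_a,\Omega_b$) whenever $\gamma_{D,p}\,b>a$.
   Context: For an integer $D\ge1$, $\mathbb{P}^D$ is the family of (nonempty) open, bounded, convex subsets of $\mathbb{R}^D$. For $\Omega\in\mathbb{P}^D$, $R_\Omega$ denotes its inradius (the radius of the largest ball inscribed in $\Omega$), and for $r>0$, $\mathbb{P}^D(r):=\{\Omega\in\mathbb{P}^D : R_\Omega=r\}$. $|\Omega|$ is Lebesgue measure, and for $c>0$, $\mathbb{P}^D_c:=\{\Omega\in\mathbb{P}^D : |\Omega|=c\}$. $B_r^D$ is the open ball of radius $r$ in $\mathbb{R}^D$ (so $B_1^1$ is an open interval of length $2$). For $p>1$ and $\Omega\in\mathbb{P}^D$, let $u_p\in W_0^{1,p}(\Omega)$ be the unique (weak) solution of $-\Delta_p u=1$ in $\Omega$, $u=0$ on $\partial\Omega$, where $\Delta_p u=\operatorname{div}(|\nabla u|^{p-2}\nabla u)$. The $p$-torsional rigidity is $T_p(\Omega):=\int_\Omega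 u_p\,dx$, and the normalized $p$-torsional rigidity is $T(p;\Omega):=|\Omega|^{p-1}T_p(\Omega)^{1-p}$. *)

(* Defs.v *)
From HB Require Import structures.
From mathcomp Require Import all_boot all_order all_algebra.
From mathcomp Require Import all_classical all_reals all_analysis.

Set Implicit Arguments.
Unset Strict Implicit.
Unset Printing Implicit Defensive.

Import Order.TTheory GRing.Theory Num.Theory.
Import numFieldNormedType.Exports.

Local Open Scope classical_set_scope.
Local Open Scope ring_scope.

(* Product sigma-algebra on matrices, generated by the coordinates, like the
   library's one on tuples. For real row vectors it is the Borel one. *)
Definition measure_matrix_display : measure_display -> measure_display.
Proof. exact. Qed.

Section measurable_matrix.
Context {d} {T : measurableType d}.
Variables m n : nat.

Definition matrix_cylinders : set (set 'M[T]_(m, n)) :=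
  [set A | exists i j, preimage_set_system setT (fun M : 'M[T]_(m, n) => M i j)
    measurable A].

Let matrix_set0 : <<s matrix_cylinders >> set0.
Proof. exact: sigma_algebra0. Qed.

Let matrix_setC A : <<s matrix_cylinders >> A -> <<s matrix_cylinders >> (~` A).
Proof. exact: sigma_algebraC. Qed.

Let matrix_bigcup (F : (set 'M[T]_(m, n))^nat) :
  (forall i, <<s matrix_cylinders >> (F i)) ->
  <<s matrix_cylinders >> (\bigcup_i (F i)).
Proof. exact: sigma_algebra_bigcup. Qed.

HB.instance Definition _ := @isMeasurable.Build (measure_matrix_display d)
  'M[T]_(m, n) <<s matrix_cylinders >> matrix_set0 matrix_setC matrix_bigcup.

End measurable_matrix.

Lemma measurable_coord d (T : measurableType d) m n i j :
  measurable_fun [set: 'M[T]_(m, n)] (fun M : 'M[T]_(m, n) => M i j).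
Proof.
move=> _ Y mY; apply: sub_sigma_algebra; exists i, j.
by exists Y => //; rewrite setTI.
Qed.

Lemma measurable_fun_matrix d1 d2 (T1 : measurableType d1)
    (T2 : measurableType d2) m n (f : T1 -> 'M[T2]_(m, n)) :
  (forall i j, measurable_fun [set: T1] (fun x => f x i j)) ->
  measurable_fun [set: T1] f.
Proof.
move=> mf; apply: (measurability (@matrix_cylinders _ T2 m n)) => //.
move=> _ [_ [i [j [Y mY <-]]] <-].
by rewrite [X in setT `&` (f @^-1` X)]setTI; exact: (mf i j measurableT Y mY).
Qed.

Section lebesgue_rV.
Context {R : realType}.
Local Open Scope ereal_scope.

Section lebesgue_cons.
Variables (n : nat) (mu : {sigma_finite_measure set 'rV[R]_n -> \bar R}).

Definition cons_rV (z : measurableTypeR R * 'rV[R]_n) : 'rV[R]_n.+1 :=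
  row_mx z.1%:M z.2.

Let uncons_rV (x : 'rV[R]_(1 + n)) : measurableTypeR R * 'rV[R]_n :=
  (x ord0 ord0, rsubmx x).

Let uncons_rVK x : cons_rV (uncons_rV x) = x.
Proof.
have lx : (x ord0 ord0)%:M = lsubmx x.
  by rewrite [RHS]mx11_scalar !mxE; congr (x _ _)%:M; exact/val_inj.
by rewrite /cons_rV /uncons_rV/= lx hsubmxK.
Qed.

Let cons_rVK z : uncons_rV (cons_rV z) = z.
Proof.
case: z => a v; rewrite /cons_rV /uncons_rV/= row_mxKr; congr pair.
have -> : @ord0 n = @lshift 1 n ord0 by exact/val_inj.
by rewrite (@row_mxEl _ 1 1 n) mxE eqxx mulr1n.
Qed.

Lemma measurable_cons_rV : measurable_fun setT cons_rV.
Proof.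
apply: measurable_fun_matrix => i j; rewrite (ord1 i).
rewrite -(@fintype.splitK 1%N n j); case: (@fintype.split 1%N n j) => k.
- rewrite [X in measurable_fun _ X](_ : _ = fst); last first.
    by apply/funext => z; rewrite /cons_rV /= (@row_mxEl _ 1%N 1%N n) mxE (ord1 k) eqxx mulr1n.
  exact: measurable_fst.
- rewrite [X in measurable_fun _ X](_ : _ =
    (fun x : 'rV[R]_n => x ord0 k) \o snd); last first.
    by apply/funext => z; rewrite /cons_rV /= (@row_mxEr _ 1%N 1%N n).
  by apply: measurableT_comp; [exact: measurable_coord|exact: measurable_snd].
Qed.

Let measurable_uncons_rV : measurable_fun [set: 'rV[R]_n.+1] uncons_rV.
Proof.
apply/measurable_fun_pairP; split; first exact: measurable_coord.
apply: measurable_fun_matrix => i j /=.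
rewrite [X in measurable_fun _ X](_ : _ =
  (fun x : 'rV[R]_n.+1 => x i (@rshift 1 n j))); last first.
  by apply/funext => x; rewrite /= mxE.
exact: measurable_coord.
Qed.

Definition lebesgue_cons : set 'rV[R]_n.+1 -> \bar R :=
  pushforward (lebesgue_measure \x mu) cons_rV.

Let lebesgue_cons0 : lebesgue_cons set0 = 0.
Proof. by rewrite /lebesgue_cons /pushforward preimage_set0 measure0. Qed.

Let lebesgue_cons_ge0 A : 0 <= lebesgue_cons A.
Proof. by rewrite /lebesgue_cons /pushforward; exact: measure_ge0. Qed.

Let lebesgue_cons_sigma_additive : semi_sigma_additive lebesgue_cons.
Proof.
move=> F mF tF mUF; rewrite /lebesgue_cons /pushforward preimage_bigcup.
apply: measure_semi_sigma_additive.
- by move=> k; rewrite -[X in measurable X]setTI; exact: measurable_cons_rV.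
- apply/trivIsetP => /= i j _ _ ij; rewrite -preimage_setI.
  by move/trivIsetP : tF => /(_ _ _ _ _ ij) ->//; rewrite preimage_set0.
- rewrite -preimage_bigcup -[X in measurable X]setTI.
  exact: measurable_cons_rV.
Qed.

HB.instance Definition _ := isMeasure.Build _ _ _ lebesgue_cons
  lebesgue_cons0 lebesgue_cons_ge0 lebesgue_cons_sigma_additive.

Let lebesgue_cons_sigma_finite : sigma_finite setT lebesgue_cons.
Proof.
have /sigma_finiteP[F [TF ndF Foo]] := sigma_finiteT (@lebesgue_measure R).
have /sigma_finiteP[G [TG ndG Goo]] := sigma_finiteT mu.
have mFG k : measurable (F k `*` G k).
  by apply: measurableX; [exact: (Foo k).1|exact: (Goo k).1].
exists (fun k => uncons_rV @^-1` (F k `*` G k)).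
  rewrite -preimage_bigcup (_ : \bigcup_i _ = setT) ?preimage_setT//.
  apply/seteqP; split => // -[x y] _.
  have [k _ Fx] : (\bigcup_i F i) x by rewrite -TF.
  have [l _ Gy] : (\bigcup_i G i) y by rewrite -TG.
  exists (maxn k l) => //; split => /=.
  - by move: x Fx; exact/subsetPset/ndF/leq_maxl.
  - by move: y Gy; exact/subsetPset/ndG/leq_maxr.
move=> k; have [mFk Fk] := Foo k; have [mGk Gk] := Goo k; split.
  by rewrite -[X in measurable X]setTI; exact: measurable_uncons_rV.
rewrite /lebesgue_cons /pushforward -comp_preimage.
rewrite (_ : uncons_rV \o cons_rV = idfun); last first.
  by apply/funext => z; exact: cons_rVK.
by rewrite preimage_id product_measure1E// lte_mul_pinfty// ge0_fin_numE.
Qed.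

HB.instance Definition _ := @Measure_isSigmaFinite.Build _ _ _ lebesgue_cons
  lebesgue_cons_sigma_finite.

End lebesgue_cons.

(* n-dimensional Lebesgue measure, as an iterated product measure. *)
Fixpoint lebesgue_rV n : {sigma_finite_measure set 'rV[R]_n -> \bar R} :=
  match n with
  | 0 => \d_(0%R : 'rV[R]_0)
  | m.+1 => lebesgue_cons (lebesgue_rV m)
  end.

Lemma lebesgue_rV_box n (A : 'I_n -> set (measurableTypeR R)) :
  (forall i, measurable (A i)) ->
  lebesgue_rV n [set x | forall i, A i (x ord0 i)] =
  \prod_(i < n) lebesgue_measure (A i).
Proof.
elim: n A => [|n ih] A mA.
  by rewrite big_ord0/= diracE mem_set// => -[].
rewrite big_ord_recl -ih//= -product_measure1E//; last first.
  rewrite [X in measurable X](_ : _ =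
      \bigcap_(i in [set: 'I_n]) ((fun x : 'rV[R]_n => x ord0 i) @^-1`
        (A (lift ord0 i)))); last first.
    by apply/seteqP; split => x /= h i; [move=> _|]; exact: h.
  apply: fin_bigcap_measurable => // i _.
  rewrite -[X in measurable X]setTI.
  exact: (measurable_coord ord0 i measurableT (mA _)).
apply: (congr1 (lebesgue_measure \x lebesgue_rV n)).
have E0 : @ord0 n = @lshift 1 n ord0 by exact/val_inj.
have El i : lift ord0 i = @rshift 1 n i by exact/val_inj.
apply/seteqP; split => -[a v]/=; rewrite /cons_rV/=.
- move=> h; split => [|i].
    by have := h ord0; rewrite {2}E0 (@row_mxEl _ 1 1 n) mxE eqxx mulr1n.
  by have := h (lift ord0 i); rewrite {2}El (@row_mxEr _ 1 1 n).
- move=> [h0 h] i; case: (unliftP ord0 i) => [j|] ->.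
    by rewrite {2}El (@row_mxEr _ 1 1 n).
  by rewrite {2}E0 (@row_mxEl _ 1 1 n) mxE eqxx mulr1n.
Qed.

End lebesgue_rV.

Section convex_domains.
Context {R : realType} {n : nat}.
Implicit Types (x y : 'rV[R]_n) (Om : set 'rV[R]_n).

Definition dotrV x y : R := \sum_i x ord0 i * y ord0 i.

(* The norm `|x| of the library on row vectors is the sup norm; it is used here
   only for topological notions (open, bounded, compact, derivatives). *)
Definition euclid_norm x : R := Num.sqrt (dotrV x x).

Definition euclid_ball x (r : R) : set 'rV[R]_n :=
  [set y | euclid_norm (y - x) < r].

Definition convex_domain Om : Prop :=
  [/\ Om !=set0, open Om, bounded_set Om & convex_set Om].

Definition inradius Om : R :=
  sup [set r | 0 < r /\ exists x, euclid_ball x r `<=` Om].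

Definition domains_of_inradius (r : R) : set (set 'rV[R]_n) :=
  [set Om | convex_domain Om /\ inradius Om = r].

Definition volume Om : R := fine (lebesgue_rV n Om).

Definition domains_of_volume (c : R) : set (set 'rV[R]_n) :=
  [set Om | convex_domain Om /\ lebesgue_rV n Om = c%:E].

End convex_domains.

Section test_functions.
Context {R : realType} {n : nat}.
Implicit Types (phi : 'rV[R]_n -> R) (Om : set 'rV[R]_n).

Definition partial (i : 'I_n) phi : 'rV[R]_n -> R :=
  fun x => 'D_(delta_mx ord0 i) phi x.

Definition grad phi x : 'rV[R]_n := \row_i partial i phi x.

(* C^oo: all iterated partial derivatives exist and are continuous. *)
Definition smooth phi : Prop := forall s : seq 'I_n,
  let psi := foldr partial phi s in
  continuous psi /\ forall i x, derivable psi x (delta_mx ord0 i).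

(* C_c^oo(Om) *)
Definition test_function Om phi : Prop :=
  [/\ smooth phi, compact (closure [set x | phi x != 0]) &
      closure [set x | phi x != 0] `<=` Om].

End test_functions.

Section sobolev.
Context {R : realType} {n : nat}.
Variables (p : R) (Om : set 'rV[R]_n).
Local Notation mu := (lebesgue_rV n).

Definition in_Lp (u : 'rV[R]_n -> R) : Prop := u \_ Om \in Lfun mu p%:E.

Definition Lp_cvg (u_ : nat -> 'rV[R]_n -> R) (u : 'rV[R]_n -> R) : Prop :=
  'N[mu]_p%:E[EFin \o ((u_ k \- u)%R \_ Om)]%E @[k --> \oo] --> 0%E.

Definition weak_gradient (u : 'rV[R]_n -> R) (g : 'rV[R]_n -> 'rV[R]_n) :=
  forall phi, test_function Om phi -> forall i,
    \int[mu]_(x in Om) (u x * partial i phi x) =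
    - \int[mu]_(x in Om) (g x ord0 i * phi x).

(* u \in W^{1,p}(Om), with gradient g *)
Definition W1p (u : 'rV[R]_n -> R) (g : 'rV[R]_n -> 'rV[R]_n) : Prop :=
  [/\ in_Lp u, forall i, in_Lp (fun x => g x ord0 i) & weak_gradient u g].

(* u \in W_0^{1,p}(Om), the closure of C_c^oo(Om) in W^{1,p}(Om),
   with gradient g *)
Definition W01p (u : 'rV[R]_n -> R) (g : 'rV[R]_n -> 'rV[R]_n) : Prop :=
  W1p u g /\
  exists phi_ : nat -> 'rV[R]_n -> R,
    [/\ forall k, test_function Om (phi_ k), Lp_cvg phi_ u &
        forall i, Lp_cvg (fun k => partial i (phi_ k))
                         (fun x => g x ord0 i)].

(* Weak form of - div (|grad u|^(p-2) grad u) = 1. When p < 2 the flux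
   |g|^(p-2) g is 0 where g is 0, as usual. *)
Definition torsion_solution (u : 'rV[R]_n -> R) : Prop :=
  exists2 g, W01p u g &
  forall phi, test_function Om phi ->
    \int[mu]_(x in Om)
      (euclid_norm (g x) `^ (p - 2) * dotrV (g x) (grad phi x)) =
    \int[mu]_(x in Om) phi x.

(* The solution is unique up to a null set, so the integral below does not
   depend on the choice made here. *)
Definition torsion_function : 'rV[R]_n -> R :=
  xget (cst 0) [set u | torsion_solution u].

Definition torsional_rigidity : R := \int[mu]_(x in Om) torsion_function x.

Definition normalized_rigidity : R :=
  volume Om `^ (p - 1) * torsional_rigidity `^ (1 - p).

End sobolev.

Definition unit_ball {R : realType} n : set 'rV[R]_n := euclid_ball 0 1.
Arguments unit_ball {R} n.

Definition gamma {R : realType} (n : nat) (p : R) : R :=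
  (normalized_rigidity p (unit_ball n) /
   normalized_rigidity p (unit_ball 1)) `^ (- p^-1).

(* Main.v *)
(* Put q = p / (p - 1) and let T be the torsional rigidity. Testing the equation
   with the solution and using Hoelder's inequality, T is the least C such that
   int phi <= C^(1/q) (int |grad phi|^p)^(1/p) for all test functions phi. For
   a convex Om of inradius r in dimension n,

     r^q |Om| / (n^(q-1) (n + q)) <= T <= r^q |Om| / (q + 1).

   Upper bound: the support of phi lies in a polytope contained in Om. Cut the
   polytope into the cells of points nearest to a given facet. On the segment
   of a cell orthogonal to its facet, of length at most r, phi vanishes at the
   facet, so that int phi = int m (d phi / d nu), where m is the distance to the
   other end; and the integral of m^q over a segment of length l is
   l^(q+1) / (q+1).
   Lower bound: mollify 1 - j^q, where j is the gauge of Om centred at the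
   incentre: j is 1/r-Lipschitz, and homogeneity gives int j^q <= n |Om| / (n+q).
   For the unit ball, integrating by parts against x shows that the lower bound
   is attained. Hence gamma^q = (q + 1) / (n^(q-1) (n + q)), since in dimension
   one |B| = 2 and T(B) = |B| / (q + 1); only "<=" is needed, and it remains to
   compare the two bounds. The solution itself exists by the direct method: the
   uniform convexity of |z|^p makes minimizing sequences Cauchy. *)

Require Import Defs.
From HB Require Import structures.
From mathcomp Require Import all_boot all_order all_algebra.
From mathcomp Require Import all_classical all_reals all_analysis.
From mathcomp Require Import measurable_realfun ring lra.

Set Implicit Arguments.
Unset Strict Implicit.
Unset Printing Implicit Defensive.

Import Order.TTheory GRing.Theory Num.Theory.
Import numFieldNormedType.Exports.

Local Open Scope classical_set_scope.
Local Open Scope ring_scope.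

(** * Lebesgue measure on row vectors *)

(** Nothing is integrated along segments or in polar coordinates. Fubini on the segments of a cell
    would need coordinates rotated to each facet; the proof uses instead that Lebesgue measure is
    invariant under translations and scales under dilations. An integral is compared with that of a
    shifted or dilated copy, and the step tends to 0. This yields int d_i phi = 0, the Poincare
    inequality, both estimates on cells and the bound on int j^q. Regularity of the torsion function
    is avoided too: T is used only as the least C, so an upper bound is an inequality for all test
    functions and a lower bound asks for one good test function. The constant of the lower bound is
    (int phi)^q / (int |grad phi|^p)^(q-1) at phi = 1 - j^q, which for a ball is the torsion
    function up to a factor. Here int phi >= q |Om| / (n+q), and since (q-1) p = q, int |grad phi|^p
    <= (q/r)^p n |Om| / (n+q); the quotient of the two bounds is r^q |Om| / (n^(q-1) (n+q)). *)

Lemma coord_le_norm {R : realType} m n (x : 'M[R]_(m, n)) i j : `|x i j| <= `|x|.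
Proof.
rewrite [leRHS]/Num.norm /= mx_normrE.
exact: (le_bigmax _ (fun ij : 'I_m * 'I_n => `|x ij.1 ij.2|) (i, j)).
Qed.

Lemma norm_le_coord {R : realType} m n (x : 'M[R]_(m, n)) M :
  0 <= M -> (forall i j, `|x i j| <= M) -> `|x| <= M.
Proof.
move=> M0 xM; rewrite [leLHS]/Num.norm /= mx_normrE.
by apply/bigmax_leP; split => // -[i j] _; exact: xM.
Qed.

Section boxes.
Context {R : realType} {n : nat}.
Local Notation mu := (@lebesgue_rV R n).

Definition box (A : 'I_n -> set (measurableTypeR R)) : set 'rV[R]_n :=
  [set x | forall i, A i (x ord0 i)].

Definition boxes : set (set 'rV[R]_n) :=
  [set B | exists2 A, (forall i, measurable (A i)) & B = box A].

Lemma measurable_box A : (forall i, measurable (A i)) -> measurable (box A).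
Proof.
move=> mA; rewrite [X in measurable X](_ : _ =
  \bigcap_(i in [set: 'I_n]) ((fun x : 'rV[R]_n => x ord0 i) @^-1` (A i))); last first.
  by apply/seteqP; split => x /= h i; [move=> _|]; exact: h.
apply: fin_bigcap_measurable => // i _.
rewrite -[X in measurable X]setTI.
exact: (measurable_coord ord0 i measurableT (mA _)).
Qed.

Lemma measurable_boxes : measurable = <<s boxes >>.
Proof.
apply/seteqP; split; apply: smallest_sub; try exact: smallest_sigma_algebra.
  move=> _ [i [j [Y mY <-]]]; apply: sub_sigma_algebra; rewrite (ord1 i) {i}.
  exists (fun k => if k == j then Y else setT).
    by move=> k; case: ifP => // _; exact: measurableT.
  apply/seteqP; split => x /=.
    by move=> [_ Yx] k; case: eqP => // ->.
  by move/(_ j); rewrite eqxx.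
by move=> _ [A mA ->]; exact: measurable_box.
Qed.

(** Boxes form a pi-system generating the sigma-algebra, and the cubes [[-k, k]^n] exhaust the space
    with finite measure. Translation invariance and scaling in dimension n thus reduce to the same
    facts on the line. *)
Lemma lebesgue_rV_unique (m : {measure set 'rV[R]_n -> \bar R}) :
  (forall A, (forall i, measurable (A i)) ->
    m (box A) = \prod_(i < n) lebesgue_measure (A i))%E ->
  forall B, measurable B -> m B = mu B.
Proof.
move=> mE B mB; apply/esym.
pose g (k : nat) : set 'rV[R]_n := box (fun=> `[- k%:R, k%:R]%classic).
have gm k : boxes (g k) by exists (fun=> `[- k%:R, k%:R]%classic).
apply: (measure_unique boxes g) => //.
- exact: measurable_boxes.
- move=> _ _ [A mA ->] [A' mA' ->]; exists (fun i => A i `&` A' i).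
    by move=> i; exact: measurableI.
  apply/seteqP; split => x /=; first by move=> [h1 h2] i; split.
  by move=> h; split => i; have [] := h i.
- apply/seteqP; split => // x _.
  have [k xk] : exists k : nat, `|x| <= k%:R.
    exists (Num.truncn `|x|).+1.
    by rewrite ltW// truncnS_gt.
  exists k => // i /=; rewrite in_itv/= -ler_norml.
  apply: le_trans xk.
  exact: coord_le_norm.
- by move=> _ [A mA ->]; rewrite mE// -lebesgue_rV_box.
- move=> k; rewrite [ltLHS](_ : _ =
    \prod_(i < n) lebesgue_measure (`[(- k%:R)%R, k%:R%R]%classic : set R))%E; last first.
    exact: (lebesgue_rV_box (A := fun=> `[- k%:R, k%:R]%classic)).
  rewrite (eq_bigr (fun=> (k%:R *+ 2)%:E)); last first.
    move=> i _; rewrite /= lebesgue_measure_itv/= lte_fin.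
    case: ifPn => [_|]; first by rewrite -EFinB opprK mulr2n.
    rewrite -leNgt => h; have k0 : k%:R = 0 :> R.
      by apply/eqP; rewrite eq_le ler0n andbT -(@ler_pMn2r _ 2)// mul0rn mulr2n; rewrite -lerBrDr sub0r.
    by rewrite k0 mul0rn.
  by rewrite prodEFin ltry.
Qed.

End boxes.

Definition image_measure d1 d2 (T1 : measurableType d1) (T2 : measurableType d2)
    (R : realType) (m : {measure set T1 -> \bar R}) (f : T1 -> T2)
    (mf : measurable_fun setT f) : {measure set T2 -> \bar R} :=
  @measure_function_pushforward__canonical__measure_function_Measure
    _ _ _ _ _ m f mf.

Lemma lebesgue_measure_shift {R : realType} (t : R) (A : set (measurableTypeR R)) :
  measurable A -> lebesgue_measure ((fun x => x + t) @^-1` A) = lebesgue_measure A.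
Proof.
move=> mA; apply/esym.
have ms : measurable_fun [set: measurableTypeR R] (fun x : measurableTypeR R => x + t : measurableTypeR R).
  exact: measurable_funD.
rewrite -[RHS]/(image_measure (@lebesgue_measure R) ms A).
apply: (lebesgue_measure_unique (mu := image_measure (@lebesgue_measure R) ms)) => // _ [[a b]] _ <-.
rewrite /image_measure /= /pushforward.
rewrite (_ : _ @^-1` _ = `]a - t, b - t]%classic); last first.
  by apply/seteqP; split => x /=; rewrite !in_itv/= ltrBlDr lerBrDr.
rewrite !lebesgue_measure_itv/= !lte_fin ltrD2r.
by case: ifPn => // _; rewrite -!EFinB opprB addrA subrK.
Qed.

Lemma lebesgue_measure_dilate {R : realType} (t : R) (A : set (measurableTypeR R)) :
  0 < t -> measurable A ->
  (t%:E * lebesgue_measure (( *%R t) @^-1` A) = lebesgue_measure A)%E.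
Proof.
move=> t0 mA; apply/esym.
have ms : measurable_fun [set: measurableTypeR R] (fun x : measurableTypeR R => t * x : measurableTypeR R).
  exact: measurable_funM.
pose m := mscale (NngNum (ltW t0))
  (image_measure (@lebesgue_measure R) ms).
rewrite -[RHS]/(m A).
apply: (lebesgue_measure_unique (mu := m)) => // _ [[a b]] _ <-.
rewrite [RHS](_ : _ = (t%:E * lebesgue_measure (`](t^-1 * a)%R, (t^-1 * b)%R]%classic : set R))%E); last first.
  rewrite /m /mscale /= /image_measure; congr (_ * lebesgue_measure _)%E.
  by apply/seteqP; split => x /=; rewrite !in_itv/= ltr_pdivrMl// ler_pdivlMl.
rewrite !lebesgue_measure_itv/= !lte_fin ltr_pM2l ?invr_gt0//.
case: ifPn => // _; last by rewrite mule0.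
by rewrite -!EFinB -EFinM -mulrBr mulVKf ?gt_eqF.
Qed.

Section open_measurable.
Context {R : realType} {n : nat}.

(** The sigma-algebra is generated by coordinates, so an open set has to be written as a countable
    union of boxes: those with rational centre and half-width [1/(k+1)] that it contains. *)
Lemma open_measurable_rV (U : set 'rV[R]_n) : open U -> measurable U.
Proof.
move=> oU.
pose B (qk : 'rV[rat]_n * nat) : set 'rV[R]_n :=
  box (fun i => `]ratr (qk.1 ord0 i) - qk.2.+1%:R^-1, ratr (qk.1 ord0 i) + qk.2.+1%:R^-1[%classic).
rewrite (_ : U = \bigcup_(qk : 'rV[rat]_n * nat) (if `[< B qk `<=` U >] then B qk else set0)).
  apply: countable_bigcupT_measurable => // qk; case: ifPn => // _.
  by apply: measurable_box => i; exact: measurable_itv.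
apply/seteqP; split => [x Ux|x [qk _]]; last by case: asboolP => // h; exact: h.
have /nbhs_ballP [e /= e0 eU] : nbhs x U by exact: open_nbhs_nbhs.
(* The rational centre may be one half-width away from [x], so a point of the box may be two
   half-widths away; hence the factor 2. *)
pose k := Num.truncn (e^-1 *+ 2).
have ke : k.+1%:R^-1 *+ 2 < e.
  have := truncnS_gt (e^-1 *+ 2); rewrite -/k => h.
  by rewrite -[ltLHS]mulr_natl ltr_pdivrMr// -ltr_pdivrMl// [ltLHS]mulr_natr.
have q (i : 'I_n) : exists r : rat, x ord0 i - k.+1%:R^-1 < ratr r < x ord0 i + k.+1%:R^-1.
  have /rat_in_itvoo[r] : x ord0 i - k.+1%:R^-1 < x ord0 i + k.+1%:R^-1.
    by rewrite ltrD2l gtrN.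
  by rewrite in_itv/=; exists r.
have [f fP] := choice q.
exists (\row_i f i, k) => //=; case: asboolP => [_ i|[]] /=.
  rewrite mxE in_itv/=; have /andP[h1 h2] := fP i.
  by rewrite ltrBlDr h2/= -ltrBlDr.
move=> y By; apply: eU; split => // i j; have -> : i = ord0 by exact: ord1.
rewrite /ball/= (le_lt_trans _ ke)//.
have /= := By j; rewrite !mxE in_itv/=.
have /andP[h1 h2] := fP j => /andP[h3 h4].
move: h1 h2 h3 h4; move: (x ord0 j) (y ord0 j) (ratr (f j)) (k.+1%:R^-1) => c d e' r h1 h2 h3 h4.
rewrite ler_norml mulr2n; apply/andP; split; lra.
Qed.

Lemma continuous_measurable_rV (f : 'rV[R]_n -> R) :
  continuous f -> measurable_fun [set: 'rV[R]_n] f.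
Proof.
move=> /continuousP cf.
apply: (measurability _ (RGenOpens.measurableE R)) => //.
move=> _ [_ [a [b ->] <-]]; rewrite setTI.
by apply: open_measurable_rV; apply: cf; exact: interval_open.
Qed.

End open_measurable.

Section integration.
Context {R : realType} {n : nat}.
Local Notation mu := (@lebesgue_rV R n).
Implicit Types (f : 'rV[R]_n -> R) (A B : set 'rV[R]_n) (v : 'rV[R]_n).

Lemma measurable_shift v : measurable_fun setT (fun x : 'rV[R]_n => x + v).
Proof.
apply: measurable_fun_matrix => i j.
rewrite (_ : (fun _ => _) = (fun x : 'rV[R]_n => x i j + v i j)); last first.
  by apply/funext => x; rewrite mxE.
by apply: measurable_funD => //; exact: measurable_coord.
Qed.

Lemma measurable_dilate (t : R) : measurable_fun setT (fun x : 'rV[R]_n => t *: x).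
Proof.
apply: measurable_fun_matrix => i j.
rewrite (_ : (fun _ => _) = (fun x : 'rV[R]_n => t * x i j)); last first.
  by apply/funext => x; rewrite mxE.
by apply: measurable_funM => //; exact: measurable_coord.
Qed.

Lemma lebesgue_rV_shift v B : measurable B ->
  mu ((fun x => x + v) @^-1` B) = mu B.
Proof.
move=> mB; rewrite -[LHS]/(image_measure mu (measurable_shift v) B).
apply: lebesgue_rV_unique => // A mA.
rewrite [LHS](_ : _ = mu (box (fun i => (fun x => x + v ord0 i) @^-1` A i))); last first.
  congr (mu _); apply/seteqP.
  by split => x /= h i; move: (h i); rewrite mxE.
rewrite lebesgue_rV_box; last first.
  move=> i; rewrite -[X in measurable X]setTI.
  by apply: (measurable_funD _ _ measurableT (mA i)).
by apply: eq_bigr => i _; exact: lebesgue_measure_shift.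
Qed.

Lemma lebesgue_rV_dilate (t : R) B : 0 < t -> measurable B ->
  ((t ^+ n)%:E * mu ((fun x => t *: x) @^-1` B) = mu B)%E.
Proof.
move=> t0 mB.
have tn : 0 <= t ^+ n by rewrite exprn_ge0// ltW.
pose m := mscale (NngNum tn) (image_measure mu (measurable_dilate t)).
rewrite -[LHS]/(m B).
apply: lebesgue_rV_unique => // A mA.
rewrite [LHS](_ : _ = (t ^+ n)%:E * mu (box (fun i => ( *%R t) @^-1` A i)))%E; last first.
  rewrite /m /mscale/=; congr (_ * mu _)%E; apply/seteqP.
  by split => x /= h i; move: (h i); rewrite mxE.
rewrite lebesgue_rV_box; last first.
  move=> i; rewrite -[X in measurable X]setTI.
  by apply: (measurable_funM _ _ measurableT (mA i)).
rewrite (_ : t ^+ n = \prod_(i < n) t); last by rewrite prodr_const card_ord.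
rewrite -prodEFin -big_split/=.
by apply: eq_bigr => i _; exact: lebesgue_measure_dilate.
Qed.

Lemma integral_shift (f : 'rV[R]_n -> \bar R) v : measurable_fun setT f ->
  (\int[mu]_x f (x + v)%R = \int[mu]_x f x)%E.
Proof.
move=> mf.
have E (g : 'rV[R]_n -> \bar R) : measurable_fun setT g -> (forall x, 0 <= g x)%E ->
    (\int[mu]_x g (x + v)%R = \int[mu]_x g x)%E.
  move=> mg g0.
  rewrite -[LHS](ge0_integral_pushforward (measurable_shift v) mu measurableT mg)//.
  apply: (@eq_measure_integral _ _ _ setT mu (image_measure mu (measurable_shift v))) => B mB _.
  exact: lebesgue_rV_shift.
rewrite -[LHS]/(\int[mu]_x (f \o (fun y => y + v)%R) x)%E integralE [RHS]integralE.
under [X in (X - _)%E]eq_integral do rewrite funepos_comp/=.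
under [X in (_ - X)%E]eq_integral do rewrite funeneg_comp/=.
by congr (_ - _)%E; apply: E => //; [exact: measurable_funepos|exact: measurable_funeneg].
Qed.

Lemma Rintegral_shift f v : measurable_fun setT f ->
  \int[mu]_x f (x + v) = \int[mu]_x f x.
Proof.
move=> mf; congr fine.
by have /= := integral_shift v ((measurable_EFinP _ _).2 mf).
Qed.

Lemma integrable_shift f v : mu.-integrable setT (EFin \o f) ->
  mu.-integrable setT (fun x => (f (x + v))%:E).
Proof.
move=> /integrableP[mf fi]; apply/integrableP; split.
  exact: (measurableT_comp mf (measurable_shift v)).
rewrite (le_lt_trans _ fi)//.
have ma : measurable_fun setT (fun x => `|(EFin \o f) x|%E) by exact: measurableT_comp.
by have /= -> := integral_shift v ma.
Qed.

Lemma ge0_Rintegral_dilate f (t : R) : 0 < t -> measurable_fun setT f ->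
  (forall x, 0 <= f x) ->
  t ^+ n * \int[mu]_x f (t *: x) = \int[mu]_x f x.
Proof.
move=> t0 mf f0.
have tn : 0 <= t ^+ n by rewrite exprn_ge0// ltW.
(* The integral may be infinite: [fine] then sends both sides to 0. *)
rewrite /Rintegral; transitivity (fine ((t ^+ n)%:E * \int[mu]_x (f (t *: x)%R)%:E)).
  case: (integral mu _ _) => //=.
    rewrite mulr0; have [->|h] := eqVneq (t ^+ n) 0; first by rewrite mul0e.
    by rewrite gt0_muley// lte_fin lt_neqAle eq_sym h.
  rewrite mulr0; have [->|h] := eqVneq (t ^+ n) 0; first by rewrite mul0e.
  by rewrite gt0_muleNy// lte_fin lt_neqAle eq_sym h.
congr fine.
rewrite -[X in (_ * X)%E](ge0_integral_pushforward (measurable_dilate t) mu measurableT (f := EFin \o f)); last 2 first.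
- exact/measurable_EFinP.
- by move=> y _; rewrite lee_fin.
pose m := mscale (NngNum tn) (image_measure mu (measurable_dilate t)).
transitivity (\int[m]_x (f x)%:E)%E.
  rewrite ge0_integral_mscale//; first exact/measurable_EFinP.
  by move=> x _; rewrite lee_fin.
apply: (@eq_measure_integral _ _ _ setT mu m) => B mB _.
exact: lebesgue_rV_dilate.
Qed.

Lemma bounded_lebesgue_rV_lty A : measurable A -> bounded_set A -> (mu A < +oo)%E.
Proof.
move=> mA [M [Mr AM]].
have M1 : M < `|M| + 1 by rewrite (le_lt_trans (ler_norm M))// ltrDl.
apply: (@le_lt_trans _ _ (mu (box (fun=> `[- (`|M| + 1), `|M| + 1]%classic)))).
  apply: le_measure; rewrite ?inE//; first by apply: measurable_box.
  move=> x Ax i /=; rewrite in_itv/= -ler_norml.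
  exact: (le_trans (coord_le_norm _ _ _)) (AM _ M1 _ Ax).
rewrite lebesgue_rV_box//.
rewrite (eq_bigr (fun=> ((`|M| + 1) *+ 2)%:E)); last first.
  move=> i _; rewrite /= lebesgue_measure_itv/= lte_fin.
  by rewrite gtrN// -EFinB opprK mulr2n.
by rewrite prodEFin ltry.
Qed.

Lemma bounded_integrable A f (M : R) : measurable A -> bounded_set A ->
  measurable_fun A f -> (forall x, A x -> `|f x| <= M) ->
  mu.-integrable A (EFin \o f).
Proof.
move=> mA bA mf fM; apply: measurable_bounded_integrable => //.
  exact: bounded_lebesgue_rV_lty.
exists M; split; first exact: num_real.
by move=> y My x Ax; exact: (le_trans (fM _ Ax) (ltW My)).
Qed.

End integration.

Lemma Rintegral_dct d (T : measurableType d) (R : realType)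
    (mu : {measure set T -> \bar R}) (A : set T) (f_ : nat -> T -> R) (f g : T -> R) :
  measurable A -> (forall k, measurable_fun A (f_ k)) ->
  (forall x, A x -> f_ ^~ x @ \oo --> f x) ->
  mu.-integrable A (EFin \o g) ->
  (forall k x, A x -> `|f_ k x| <= g x) ->
  mu.-integrable A (EFin \o f) /\
  (fun k => \int[mu]_(x in A) f_ k x) @ \oo --> \int[mu]_(x in A) f x.
Proof.
move=> mA mf_ ff ig fg.
have mf : measurable_fun A f by exact: measurable_fun_cvg ff.
have [||||fi _ h] := @dominated_convergence _ _ _ mu A mA
  (fun k => EFin \o f_ k) (EFin \o f) (EFin \o g) _ _ _ ig.
- by move=> k; exact/measurable_EFinP.
- exact/measurable_EFinP.
- by apply: aeW => x Ax; apply: cvg_EFin; [exact: nearW|exact: ff].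
- by apply: aeW => x k Ax; rewrite lee_fin; exact: fg.
split => //; apply: fine_cvg.
rewrite fineK; first exact: h.
exact: integrable_fin_num.
Qed.

Section real_integrable.
Context d (T : measurableType d) (R : realType) (mu : {measure set T -> \bar R}).
Variables (A : set T) (mA : measurable A).
Implicit Types f g : T -> R.

Lemma integrable_addr f g : mu.-integrable A (EFin \o f) ->
  mu.-integrable A (EFin \o g) -> mu.-integrable A (EFin \o (fun x => f x + g x)).
Proof. by move=> fi gi; exact: (integrableD mA fi gi). Qed.

Lemma integrable_subr f g : mu.-integrable A (EFin \o f) ->
  mu.-integrable A (EFin \o g) -> mu.-integrable A (EFin \o (fun x => f x - g x)).
Proof. by move=> fi gi; exact: (integrableB mA fi gi). Qed.

Lemma integrable_scaler (a : R) f : mu.-integrable A (EFin \o f) ->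
  mu.-integrable A (EFin \o (fun x => a * f x)).
Proof. by move=> fi; exact: (integrableZl mA a fi). Qed.

Lemma integrable_dominated f g : measurable_fun A f ->
  mu.-integrable A (EFin \o g) -> (forall x, A x -> `|f x| <= g x) ->
  mu.-integrable A (EFin \o f).
Proof.
move=> mf gi fg; apply: le_integrable gi => //; first exact/measurable_EFinP.
by move=> x Ax; rewrite lee_fin (le_trans (fg x Ax))// ler_norm.
Qed.

Lemma integrable_measurable f : mu.-integrable A (EFin \o f) -> measurable_fun A f.
Proof. by move=> /integrableP[/measurable_EFinP]. Qed.

Lemma integrable_sumr (I : finType) (F : I -> T -> R) :
  (forall i, mu.-integrable A (EFin \o F i)) ->
  mu.-integrable A (EFin \o (fun x => \sum_i F i x)).
Proof.
move=> Fi; rewrite (_ : _ \o _ = (fun x => \sum_i (F i x)%:E)%E).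
  by apply: integrable_sum => // i _; exact: Fi.
by apply/funext => x /=; rewrite sumEFin.
Qed.

Lemma Rintegral_sumr (I : finType) (F : I -> T -> R) :
  (forall i, mu.-integrable A (EFin \o F i)) ->
  \int[mu]_(x in A) (\sum_i F i x) = \sum_i \int[mu]_(x in A) F i x.
Proof.
move=> Fi; rewrite -big_enum/=.
under eq_Rintegral do rewrite -big_enum/=.
elim: (enum I) => [|i s ih].
  by rewrite big_nil; under eq_Rintegral do rewrite big_nil; rewrite Rintegral_cst// mul0r.
rewrite big_cons -ih; under eq_Rintegral do rewrite big_cons.
rewrite RintegralD//; rewrite (_ : _ \o _ = (fun x => \sum_(j <- s) (F j x)%:E)%E).
  by apply: integrable_sum => // j _; exact: Fi.
by apply/funext => x /=; rewrite sumEFin.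
Qed.

End real_integrable.

(** * Test functions *)

Section euclid.
Context {R : realType} {n : nat}.
Implicit Types x y z : 'rV[R]_n.

Lemma dotrVC x y : dotrV x y = dotrV y x.
Proof. by apply: eq_bigr => i _; rewrite mulrC. Qed.

Lemma dotrVDl x y z : dotrV (x + y) z = dotrV x z + dotrV y z.
Proof. by rewrite /dotrV -big_split/=; apply: eq_bigr => i _; rewrite mxE mulrDl. Qed.

Lemma dotrVZl (a : R) x y : dotrV (a *: x) y = a * dotrV x y.
Proof. by rewrite /dotrV mulr_sumr; apply: eq_bigr => i _; rewrite mxE mulrA. Qed.

Lemma dotrVNl x y : dotrV (- x) y = - dotrV x y.
Proof. by rewrite -scaleN1r dotrVZl mulN1r. Qed.

Lemma dotrVDr x y z : dotrV x (y + z) = dotrV x y + dotrV x z.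
Proof. by rewrite dotrVC dotrVDl !(dotrVC x). Qed.

Lemma dotrVZr (a : R) x y : dotrV x (a *: y) = a * dotrV x y.
Proof. by rewrite dotrVC dotrVZl (dotrVC x). Qed.

Lemma dotrVNr x y : dotrV x (- y) = - dotrV x y.
Proof. by rewrite dotrVC dotrVNl (dotrVC x). Qed.

Lemma dotrV0l x : dotrV 0 x = 0.
Proof. by rewrite -(scale0r 0) dotrVZl mul0r. Qed.

Lemma dotrV_ge0 x : 0 <= dotrV x x.
Proof. by apply: sumr_ge0 => i _; rewrite -expr2 sqr_ge0. Qed.

Lemma euclid_norm_ge0 x : 0 <= euclid_norm x.
Proof. exact: sqrtr_ge0. Qed.

Lemma sqr_euclid_norm x : euclid_norm x ^+ 2 = dotrV x x.
Proof. by rewrite sqr_sqrtr// dotrV_ge0. Qed.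

Lemma euclid_norm0 : euclid_norm (0 : 'rV[R]_n) = 0.
Proof. by rewrite /euclid_norm dotrV0l sqrtr0. Qed.

Lemma euclid_normZ (a : R) x : euclid_norm (a *: x) = `|a| * euclid_norm x.
Proof.
by rewrite /euclid_norm dotrVZl dotrVZr mulrA -expr2 sqrtrM ?sqr_ge0// sqrtr_sqr.
Qed.

Lemma euclid_normN x : euclid_norm (- x) = euclid_norm x.
Proof. by rewrite -scaleN1r euclid_normZ normrN1 mul1r. Qed.

Lemma coord_le_euclid x i : `|x ord0 i| <= euclid_norm x.
Proof.
rewrite -sqrtr_sqr ler_wsqrtr// /dotrV (bigD1 i)//= -expr2 lerDl.
by apply: sumr_ge0 => j _; rewrite -expr2 sqr_ge0.
Qed.

Lemma norm_le_euclid x : `|x| <= euclid_norm x.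
Proof.
apply: norm_le_coord; first exact: euclid_norm_ge0.
move=> i j; have -> : i = ord0 by exact: ord1.
exact: coord_le_euclid.
Qed.

Lemma euclid_le_norm x : euclid_norm x <= n%:R * `|x|.
Proof.
rewrite -[leRHS]ger0_norm ?mulr_ge0// -sqrtr_sqr ler_wsqrtr//.
apply: (@le_trans _ _ (\sum_(i < n) `|x| ^+ 2)).
  apply: ler_sum => i _; rewrite -expr2 -[leLHS]real_normK ?num_real//.
  by rewrite lerXn2r ?nnegrE// coord_le_norm.
rewrite sumr_const card_ord -[leLHS]mulr_natl exprMn ler_wpM2r ?sqr_ge0//.
by rewrite -natrX ler_nat; case: (n) => // k; rewrite -[leqLHS]muln1 leq_mul.
Qed.

Lemma euclid_norm_eq0 x : (euclid_norm x == 0) = (x == 0).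
Proof.
apply/eqP/eqP => [x0|->]; last exact: euclid_norm0.
apply/eqP; rewrite -normr_eq0 eq_le normr_ge0 andbT.
by rewrite -x0 norm_le_euclid.
Qed.

Lemma cauchy_schwarz x y : dotrV x y <= euclid_norm x * euclid_norm y.
Proof.
have [->|y0] := eqVneq y 0; first by rewrite dotrVC dotrV0l euclid_norm0 mulr0.
have ny : 0 < euclid_norm y by rewrite lt_neqAle eq_sym euclid_norm_eq0 y0 euclid_norm_ge0.
have [d0|d0] := leP (dotrV x y) 0; first by rewrite (le_trans d0)// mulr_ge0 ?euclid_norm_ge0.
rewrite -ler_sqr ?nnegrE ?mulr_ge0 ?euclid_norm_ge0 ?(ltW d0)//.
have := dotrV_ge0 (dotrV y y *: x - dotrV x y *: y).
rewrite !(dotrVDl, dotrVDr, dotrVNl, dotrVNr, dotrVZl, dotrVZr) (dotrVC y x).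
rewrite exprMn !sqr_euclid_norm.
have : 0 < dotrV y y by rewrite -sqr_euclid_norm exprn_gt0.
move: (dotrV y y) (dotrV x x) (dotrV x y) => b a c b0 h.
have : 0 <= b * (a * b - c ^+ 2) by lra.
by rewrite pmulr_rge0// subr_ge0.
Qed.

Lemma cauchy_schwarz_norm x y : `|dotrV x y| <= euclid_norm x * euclid_norm y.
Proof.
rewrite ler_norml cauchy_schwarz andbT lerNl -dotrVNl -(euclid_normN x).
exact: cauchy_schwarz.
Qed.

Lemma euclid_normD x y : euclid_norm (x + y) <= euclid_norm x + euclid_norm y.
Proof.
rewrite -ler_sqr ?nnegrE ?addr_ge0 ?euclid_norm_ge0//.
rewrite sqrrD !sqr_euclid_norm dotrVDl !dotrVDr (dotrVC y x).
have := cauchy_schwarz x y; rewrite mulr2n; lra.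
Qed.

Lemma euclid_normB x y : euclid_norm (x - y) <= euclid_norm x + euclid_norm y.
Proof. by rewrite (le_trans (euclid_normD _ _))// euclid_normN. Qed.

Lemma euclid_norm_distC x y : euclid_norm (x - y) = euclid_norm (y - x).
Proof. by rewrite -opprB euclid_normN. Qed.

Lemma ler_dist_euclid x y : `|euclid_norm x - euclid_norm y| <= euclid_norm (x - y).
Proof.
have h (a b : 'rV[R]_n) : euclid_norm a - euclid_norm b <= euclid_norm (a - b).
  by have := euclid_normD (a - b) b; rewrite subrK lerBlDr.
by rewrite ler_norml lerNl opprB h euclid_norm_distC h.
Qed.

Lemma lipschitz_continuous (f : 'rV[R]_n -> R) (L : R) :
  (forall x y, `|f x - f y| <= L * `|x - y|) -> continuous f.
Proof.
move=> fL x; apply/(@cvgrPdist_lt _ _ _ (nbhs x)) => e e0.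
pose d := e / (`|L| + 1).
have L1 : 0 < `|L| + 1 by rewrite ltr_wpDl.
have d0 : 0 < d by rewrite divr_gt0.
near=> y.
rewrite (le_lt_trans (fL _ _))// (@le_lt_trans _ _ ((`|L| + 1) * `|x - y|))//.
  by rewrite ler_wpM2r// (le_trans (ler_norm L))// lerDl.
rewrite -ltr_pdivlMl// mulrC.
by near: y; exact: cvgr_dist_lt.
Unshelve. all: by end_near. Qed.

Lemma euclid_norm_continuous : continuous (@euclid_norm R n).
Proof.
apply: (@lipschitz_continuous _ n%:R) => x y.
exact: (le_trans (ler_dist_euclid _ _) (euclid_le_norm _)).
Qed.

Lemma coord_continuous_rV i : continuous (fun x : 'rV[R]_n => x ord0 i).
Proof.
apply: (@lipschitz_continuous _ 1) => x y; rewrite mul1r.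
rewrite (_ : _ - _ = (x - y) ord0 i); last by rewrite !mxE.
exact: coord_le_norm.
Qed.

Lemma dotrV_continuous (v : 'rV[R]_n) : continuous (dotrV v).
Proof.
apply: (@lipschitz_continuous _ (euclid_norm v * n%:R)) => x y.
rewrite -dotrVNr -dotrVDr (le_trans (cauchy_schwarz_norm _ _))//.
by rewrite -mulrA ler_wpM2l ?euclid_norm_ge0// euclid_le_norm.
Qed.

Lemma dotrV_delta x i : dotrV x (delta_mx ord0 i) = x ord0 i.
Proof.
rewrite /dotrV (bigD1 i)//= big1 ?addr0; last first.
  by move=> j ji; rewrite mxE eqxx (negbTE ji) mulr0.
by rewrite mxE !eqxx mulr1.
Qed.

End euclid.

Section directional.
Context {R : realType} {n : nat}.
Implicit Types (phi : 'rV[R]_n -> R) (x v w : 'rV[R]_n).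
Local Notation e_ i := (@delta_mx R 1 n ord0 i).

Lemma mean_value_coord phi x i (a : R) :
  (forall y, derivable phi y (e_ i)) ->
  exists2 c, `|c| <= `|a| &
    phi (x + a *: e_ i) - phi x = a * partial i phi (x + c *: e_ i).
Proof.
move=> dphi.
pose g (t : R) := phi (x + t *: e_ i).
have gd (t : R) : is_derive t 1 g (partial i phi (x + t *: e_ i)).
  have E : (fun h : R => h^-1 *: ((g \o shift t) (h *: 1) - g t)) =
      (fun h => h^-1 *: ((phi \o shift (x + t *: e_ i)) (h *: e_ i) - phi (x + t *: e_ i))).
    apply/funext => h; rewrite /= /g; congr (_ *: (phi _ - _)).
    by rewrite [h *: 1]mulr1 scalerDl addrCA addrC.
  split; first by rewrite /derivable E; exact: dphi.
  by rewrite /derive E.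
have gc (a1 b1 : R) : {within `[a1, b1], continuous g}.
  by apply: derivable_within_continuous => t _; exact: ex_derive.
have g0 : g 0 = phi x by rewrite /g scale0r addr0.
rewrite -/(g a) -g0; have [a0|a0] := leP 0 a.
- have [c cI ->] := MVT_segment a0 (fun t _ => gd t) (gc _ _).
  exists c; last by rewrite subr0 mulrC.
  by move: cI; rewrite in_itv/= => /andP[c0 ca]; rewrite !ger0_norm.
- have [c cI h] := MVT_segment (ltW a0) (fun t _ => gd t) (gc _ _).
  exists c; last by rewrite -opprB h sub0r mulrN opprK mulrC.
  move: cI; rewrite in_itv/= => /andP[ac c0].
  by rewrite !ler0_norm ?lerN2// ltW.
Qed.

(** The path from [x] to [x + w] changes one coordinate at a time, and the mean value theorem is
    applied on each edge. Only partial derivatives are involved. *)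
Lemma mean_value_rV phi x w : (forall i y, derivable phi y (e_ i)) ->
  exists2 xi : 'I_n -> 'rV[R]_n, (forall i, `|xi i - x| <= `|w|) &
    phi (x + w) - phi x = \sum_(i < n) w ord0 i * partial i phi (xi i).
Proof.
move=> dphi.
(* The corners of the path: [u k] keeps the first [k] coordinates of [w]. *)
pose u (k : nat) : 'rV[R]_n := \row_(j < n) (if (j < k)%N then w ord0 j else 0).
have uS (i : 'I_n) : u i.+1 = u i + w ord0 i *: e_ i.
  apply/rowP => j; rewrite !mxE ltnS leq_eqVlt eqxx/= -[(j == i :> nat)]/(j == i).
  have [->|ji] := eqVneq j i; first by rewrite ltnn add0r mulr1.
  by rewrite mulr0 addr0.
have h (i : 'I_n) : exists y : 'rV[R]_n, `|y - x| <= `|w| /\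
    phi (x + u i.+1) - phi (x + u i) = w ord0 i * partial i phi y.
  have [c cw E] := mean_value_coord (x + u i) (w ord0 i) (dphi i).
  exists (x + u i + c *: e_ i); split; last by rewrite uS addrA.
  rewrite addrC !addrA addNr add0r; apply: norm_le_coord => // k j.
  have -> : k = ord0 by exact: ord1.
  rewrite !mxE eqxx/=; have [->|ji] := eqVneq j i.
    by rewrite ltnn add0r mulr1 (le_trans cw)// coord_le_norm.
  rewrite mulr0 addr0; case: ifP => _; first exact: coord_le_norm.
  by rewrite normr0.
have [xi xiP] := choice h.
exists xi; first by move=> i; have [] := xiP i.
have -> : phi (x + w) - phi x = \sum_(0 <= k < n) (phi (x + u k.+1) - phi (x + u k)).
  rewrite telescope_sumr//; congr (phi _ - phi _).
    by congr (_ + _); apply/rowP => j; rewrite mxE ltn_ord.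
  by rewrite (_ : u 0 = 0) ?addr0//; apply/rowP => j; rewrite !mxE.
by rewrite big_mkord; apply: eq_bigr => i _; have [] := xiP i.
Qed.

(** The points [xi i] of the coordinate path tend to [x] with [h], so continuity of the partial
    derivatives gives every directional derivative. *)
Lemma derivable_direction phi x v : (forall i y, derivable phi y (e_ i)) ->
  (forall i, continuous (partial i phi)) ->
  (fun h : R => h^-1 * (phi (x + h *: v) - phi x)) @ 0^' --> dotrV v (grad phi x).
Proof.
move=> dphi cphi; apply/cvgrPdist_lt => e e0.
pose e' := e / (\sum_(i < n) `|v ord0 i| + 1).
have s1 : 0 < \sum_(i < n) `|v ord0 i| + 1 by rewrite ltr_wpDl// sumr_ge0.
have e'0 : 0 < e' by rewrite divr_gt0.
have : \forall y \near x, forall i, `|partial i phi x - partial i phi y| < e'.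
  have FF : Filter (nbhs x) by exact: nbhs_filter.
  apply: (@filter_forall _ _ (fun i => [set y | `|partial i phi x - partial i phi y| < e']) _ FF) => i.
  exact: (@cvgr_dist_lt _ _ _ (nbhs x) FF _ _ (cphi i x)).
move=> /nbhs_ballP[d /= d0 dP].
near=> h.
have h0 : h != 0 by near: h; exact: nbhs_dnbhs_neq.
have [xi xih ->] := mean_value_rV x (h *: v) dphi.
rewrite mulr_sumr /dotrV -sumrB.
apply: le_lt_trans (ler_norm_sum _ _ _) _.
apply: (@le_lt_trans _ _ (\sum_(i < n) `|v ord0 i| * e')).
  apply: ler_sum => i _; rewrite !mxE mulrA mulKf// -mulrBr normrM ler_wpM2l// ltW//.
  apply: dP; rewrite -ball_normE/= distrC (le_lt_trans (xih i))//.
  rewrite normrZ.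
  apply: (@le_lt_trans _ _ (`|h| * (`|v| + 1))); first by rewrite ler_wpM2l// lerDl.
  rewrite -ltr_pdivlMr ?ltr_wpDl//.
  near: h; apply: dnbhs0_lt; rewrite divr_gt0// ltr_wpDl//.
rewrite -mulr_suml /e' mulrCA gtr_pMr// ltr_pdivrMr// mul1r ltrDl//.
Unshelve. all: by end_near. Qed.

End directional.

Section smooth_functions.
Context {R : realType} {n : nat}.
Implicit Types (phi psi : 'rV[R]_n -> R) (x v : 'rV[R]_n).
Local Notation e_ i := (@delta_mx R 1 n ord0 i).

(** A coinduction principle: [smooth] quantifies over all iterated derivatives, and it suffices to
    find a class of functions stable under [partial]. Products, compositions and convolutions are
    treated by choosing such a class. *)
Lemma smooth_closed (S : ('rV[R]_n -> R) -> Prop) :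
  (forall phi, S phi -> [/\ continuous phi,
    forall i x, derivable phi x (e_ i) & forall i, S (partial i phi)]) ->
  forall phi, S phi -> smooth phi.
Proof.
move=> HS phi Sphi s /=.
have : S (foldr partial phi s).
  by elim: s => //= i s ih; have [_ _] := HS _ ih; exact.
by move=> /HS[].
Qed.

Lemma smooth_continuous phi : smooth phi -> continuous phi.
Proof. by move=> /(_ [::])[]. Qed.

Lemma smooth_derivable phi i x : smooth phi -> derivable phi x (e_ i).
Proof. by move=> /(_ [::])[]. Qed.

Lemma smooth_partial phi i : smooth phi -> smooth (partial i phi).
Proof. by move=> sphi s; have := sphi (rcons s i); rewrite foldr_rcons. Qed.

Lemma partial_cst (a : R) i : partial i (cst a : 'rV[R]_n -> R) = cst 0.
Proof. by apply/funext => x; rewrite /partial derive_cst. Qed.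

Lemma smooth_cst (a : R) : smooth (cst a : 'rV[R]_n -> R).
Proof.
apply: (@smooth_closed [set phi | exists b, phi = cst b]); last by exists a.
move=> _ [b ->]; split; first exact: cst_continuous.
- by move=> i x; exact: derivable_cst.
- by move=> i; exists 0; rewrite partial_cst.
Qed.

Lemma partialD phi psi i : (forall x, derivable phi x (e_ i)) ->
  (forall x, derivable psi x (e_ i)) ->
  partial i (fun x => phi x + psi x) = (fun x => partial i phi x + partial i psi x).
Proof. by move=> dphi dpsi; apply/funext => x; exact: deriveD. Qed.

Lemma partialM phi psi i : (forall x, derivable phi x (e_ i)) ->
  (forall x, derivable psi x (e_ i)) ->
  partial i (fun x => phi x * psi x) =
  (fun x => partial i phi x * psi x + phi x * partial i psi x).
Proof.
move=> dphi dpsi; apply/funext => x.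
by rewrite addrC; apply: etrans (deriveM (dphi x) (dpsi x)) _; congr (_ + _); rewrite mulrC.
Qed.

(** Derivatives of a product are sums of products, so the stable class for [smooth_closed] is the
    algebra generated by smooth functions. *)
Inductive smooth_algebra : ('rV[R]_n -> R) -> Prop :=
| Alg_smooth phi of smooth phi : smooth_algebra phi
| Alg_add phi psi of smooth_algebra phi & smooth_algebra psi :
    smooth_algebra (fun x => phi x + psi x)
| Alg_mul phi psi of smooth_algebra phi & smooth_algebra psi :
    smooth_algebra (fun x => phi x * psi x).

Lemma smooth_algebraP phi : smooth_algebra phi -> smooth phi.
Proof.
apply: smooth_closed => {}phi; elim => {phi} [phi sphi|phi psi _ [cf df pf] _ [cg dg pg]|phi psi af [cf df pf] ag [cg dg pg]].
- split; [exact: smooth_continuous|by move=> i x; exact: smooth_derivable|].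
  by move=> i; apply: Alg_smooth; exact: smooth_partial.
- split.
  + by move=> x; apply: (@continuousD _ _ _ phi psi); [exact: cf|exact: cg].
  + by move=> i x; apply: derivableD.
  + by move=> i; rewrite partialD//; apply: Alg_add.
- split.
  + by move=> x; apply: (@continuousM _ _ phi psi); [exact: cf|exact: cg].
  + by move=> i x; apply: derivableM.
  + by move=> i; rewrite partialM//; apply: Alg_add; apply: Alg_mul.
Qed.

Lemma smoothD phi psi : smooth phi -> smooth psi -> smooth (fun x => phi x + psi x).
Proof. by move=> sf sg; apply: smooth_algebraP; apply: Alg_add; exact: Alg_smooth. Qed.

Lemma smoothM phi psi : smooth phi -> smooth psi -> smooth (fun x => phi x * psi x).
Proof. by move=> sf sg; apply: smooth_algebraP; apply: Alg_mul; exact: Alg_smooth. Qed.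

Lemma smoothZ (a : R) phi : smooth phi -> smooth (fun x => a * phi x).
Proof. by apply: smoothM; exact: smooth_cst. Qed.

Lemma partialZ (a : R) phi i : (forall x, derivable phi x (e_ i)) ->
  partial i (fun x => a * phi x) = (fun x => a * partial i phi x).
Proof.
move=> dphi; rewrite (partialM (phi := cst a) (fun x => derivable_cst _ _ _) dphi).
by apply/funext => x; rewrite partial_cst/= mul0r add0r.
Qed.

Lemma is_derive_coord i j x : is_derive x (e_ i) (fun y : 'rV[R]_n => y ord0 j) (i == j)%:R.
Proof.
have E : (fun h : R => h^-1 *: (((fun y : 'rV[R]_n => y ord0 j) \o shift x) (h *: e_ i) - x ord0 j)) @ 0^' --> ((i == j)%:R : R).
  apply: cvg_near_cst; near=> h.
  have h0 : h != 0 by near: h; exact: nbhs_dnbhs_neq.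
  by rewrite /= !mxE addrK eqxx/= eq_sym [_ *: _]mulKf.
by split; [apply/cvg_ex; eexists; exact: E|exact: cvg_lim E].
Unshelve. all: by end_near. Qed.

Lemma partial_coord i j : partial i (fun y : 'rV[R]_n => y ord0 j) = cst (i == j)%:R.
Proof. by apply/funext => x; exact: (@derive_val _ _ _ _ _ _ _ (is_derive_coord i j x)). Qed.

Lemma smooth_coord j : smooth (fun x : 'rV[R]_n => x ord0 j).
Proof.
apply: (@smooth_closed [set phi | phi = (fun x : 'rV[R]_n => x ord0 j) \/ smooth phi]); last by left.
move=> phi [->|sf]; split.
- exact: coord_continuous_rV.
- by move=> i x; exact: (@ex_derive _ _ _ _ _ _ _ (is_derive_coord i j x)).
- by move=> i; right; rewrite partial_coord; exact: smooth_cst.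
- exact: smooth_continuous.
- by move=> i x; exact: smooth_derivable.
- by move=> i; right; exact: smooth_partial.
Qed.

End smooth_functions.

Section test_function_theory.
Context {R : realType} {n : nat}.
Implicit Types (phi psi : 'rV[R]_n -> R) (x v : 'rV[R]_n) (Om : set 'rV[R]_n).
Local Notation e_ i := (@delta_mx R 1 n ord0 i).
Local Notation mu := (@lebesgue_rV R n).
Local Notation supp phi := (closure [set x | phi x != 0]).

Lemma test_out Om phi x : test_function Om phi -> ~ Om x -> phi x = 0.
Proof.
move=> [_ _ so] nOx; apply: contrapT => /eqP p0; apply: nOx; apply: so.
exact: subset_closure.
Qed.

Lemma test_supp_bounded Om phi : test_function Om phi ->
  exists M, forall x, phi x != 0 -> `|x| <= M.
Proof.
move=> [_ /compact_bounded [M [_ cM]] _]; exists (`|M| + 1) => x p0.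
apply: (cM (`|M| + 1)); last exact: subset_closure.
by rewrite (le_lt_trans (ler_norm M))// ltrDl.
Qed.

Lemma partial_supp phi i : [set x | partial i phi x != 0] `<=` supp phi.
Proof.
move=> x /= px; apply: contrapT => nx.
have /closed_openC oC : closed (supp phi) by exact: closed_closure.
have : \forall y \near x, phi y = (cst 0 : 'rV[R]_n -> R) y.
  apply: filterS (open_nbhs_nbhs (conj oC nx)) => y ny.
  by apply: contrapT => /eqP py; apply: ny; exact: subset_closure.
by move=> /near_eq_derive E; move: px; rewrite /partial E derive_cst eqxx.
Qed.

Lemma test_partial Om phi i : test_function Om phi -> test_function Om (partial i phi).
Proof.
move=> [sf cf fO].
have h : supp (partial i phi) `<=` supp phi.
  rewrite [X in _ `<=` X](closure_id _).1; last exact: closed_closure.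
  by apply: closure_subset; exact: partial_supp.
split; [exact: smooth_partial| |exact: subset_trans h fO].
by apply: subclosed_compact cf h; exact: closed_closure.
Qed.

Lemma test_sub Om phi psi : smooth psi -> (forall x, psi x != 0 -> phi x != 0) ->
  test_function Om phi -> test_function Om psi.
Proof.
move=> spsi h [sf cf fO]; have h' : supp psi `<=` supp phi by exact: closure_subset.
split => //; last exact: subset_trans h' fO.
by apply: subclosed_compact cf h'; exact: closed_closure.
Qed.

Lemma testM Om phi psi : smooth psi -> test_function Om phi ->
  test_function Om (fun x => psi x * phi x).
Proof.
move=> spsi tf; apply: (test_sub _ _ tf); first by apply: (smoothM spsi); case: tf.
by move=> x; rewrite mulf_eq0 negb_or => /andP[].
Qed.

Lemma testZ Om phi (a : R) : test_function Om phi -> test_function Om (fun x => a * phi x).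
Proof. by apply: testM; exact: smooth_cst. Qed.

Lemma testD Om phi psi : test_function Om phi -> test_function Om psi ->
  test_function Om (fun x => phi x + psi x).
Proof.
move=> [sf cf fO] [sg cg gO].
have h : supp (fun x => phi x + psi x) `<=` supp phi `|` supp psi.
  rewrite -closureU; apply: closure_subset => x /= h.
  have [p0|p0] := eqVneq (phi x) 0; last by left.
  by right; move: h; rewrite p0 add0r.
split; first exact: smoothD.
- by apply: subclosed_compact (compactU cf cg) h; exact: closed_closure.
- by move=> x /h [/fO|/gO].
Qed.

Lemma test_bounded Om phi : test_function Om phi ->
  exists2 M : R, 0 <= M & forall x, `|phi x| <= M.
Proof.
move=> [sf cf fO].
have cphi : {within supp phi, continuous phi}.
  by apply: continuous_subspaceT; exact: smooth_continuous.
have [M [_ bM]] := compact_bounded (continuous_compact cphi cf).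
exists (`|M| + 1); first by rewrite addr_ge0.
move=> x; have [->|p0] := eqVneq (phi x) 0; first by rewrite normr0 addr_ge0.
apply: (bM (`|M| + 1)); first by rewrite (le_lt_trans (ler_norm M))// ltrDl.
by exists x => //; exact: subset_closure.
Qed.

Lemma test_continuous Om phi : test_function Om phi -> continuous phi.
Proof. by move=> [sf _ _]; exact: smooth_continuous. Qed.

Lemma test_measurable Om phi : test_function Om phi -> measurable_fun setT phi.
Proof. by move=> /test_continuous; exact: continuous_measurable_rV. Qed.

Lemma test_lipschitz Om phi : test_function Om phi ->
  exists2 L : R, 0 <= L & forall x v, `|phi (x + v) - phi x| <= L * `|v|.
Proof.
move=> tf; have sf : smooth phi by case: tf.
have h i : exists M : R, 0 <= M /\ forall x, `|partial i phi x| <= M.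
  by have [M M0 hM] := test_bounded (test_partial i tf); exists M.
have [M MP] := choice h.
exists (\sum_i M i); first by apply: sumr_ge0 => i _; have [] := MP i.
move=> x v.
have [xi _ ->] := mean_value_rV x v (fun i y => smooth_derivable sf).
rewrite mulr_suml (le_trans (ler_norm_sum _ _ _))//; apply: ler_sum => i _.
have [M0 Mi] := MP i.
by rewrite normrM mulrC ler_pM// coord_le_norm.
Qed.

Lemma bounded_supp_integrable (f : 'rV[R]_n -> R) (M N : R) : measurable_fun setT f ->
  (forall x, `|f x| <= M) -> (forall x, f x != 0 -> `|x| <= N) ->
  mu.-integrable setT (EFin \o f).
Proof.
move=> mf fM fN.
pose B := [set x : 'rV[R]_n | `|x| < N + 1].
have oB : open B.
  rewrite (_ : B = ball 0 (N + 1)); first exact: ball_open.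
  by rewrite -ball_normE; apply/seteqP; split => x; rewrite /B/= sub0r normrN.
have mB := open_measurable_rV oB.
have bB : bounded_set B.
  by exists (N + 1); split; [exact: num_real|move=> y Ny x /ltW/le_trans; apply; exact: ltW].
have -> : EFin \o f = (EFin \o f) \_ B.
  apply/funext => x; rewrite /patch; case: ifPn => // /negP xB /=.
  have [->//|f0] := eqVneq (f x) 0; exfalso; apply: xB; rewrite inE /B/=.
  by rewrite (le_lt_trans (fN _ f0))// ltrDl.
apply/(integrable_mkcond _ mB).
by apply: (bounded_integrable (M := M)) => //; exact: measurable_funS mf.
Qed.

Lemma test_integrable Om phi : test_function Om phi -> mu.-integrable setT (EFin \o phi).
Proof.
move=> tf; have [M _ bM] := test_bounded tf; have [N sN] := test_supp_bounded tf.
by apply: (bounded_supp_integrable (M := M) (N := N)) => //; exact: test_measurable tf.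
Qed.

Lemma cvg_harmonic_quotient phi x v (l : R) :
  (fun h : R => h^-1 * (phi (x + h *: v) - phi x)) @ 0^' --> l ->
  (fun k : nat => k.+1%:R * (phi (x + k.+1%:R^-1 *: v) - phi x)) @ \oo --> l.
Proof.
move=> h; rewrite (_ : (fun k : nat => _) =
  (fun h : R => h^-1 * (phi (x + h *: v) - phi x)) \o (fun k => k.+1%:R^-1)); last first.
  by apply/funext => k; rewrite /= invrK.
apply: cvg_comp h => P /= P0.
have : \forall k \near \oo, (harmonic k : R) != 0 -> P (harmonic k).
  exact: (@cvg_harmonic R _ P0).
by apply: filterS => k; apply; rewrite /harmonic/= invr_eq0 pnatr_eq0.
Qed.

Lemma smooth_quotient_cvg phi x v : smooth phi ->
  (fun k : nat => k.+1%:R * (phi (x + k.+1%:R^-1 *: v) - phi x)) @ \oo -->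
  dotrV v (grad phi x).
Proof.
move=> sf; apply: cvg_harmonic_quotient; apply: derivable_direction.
- by move=> i y; exact: smooth_derivable.
- by move=> i; apply: smooth_continuous; exact: smooth_partial.
Qed.

Lemma integrable_norm_ball (c N : R) :
  mu.-integrable setT (EFin \o (fun x : 'rV[R]_n => c * \1_[set y : 'rV[R]_n | `|y| < N] x)).
Proof.
apply: (bounded_supp_integrable (M := `|c|) (N := N)).
- apply: measurable_funM => //; apply: measurable_indic; apply: open_measurable_rV.
  rewrite (_ : mkset _ = ball 0 N); first exact: ball_open.
  by rewrite -ball_normE; apply/seteqP; split => x; rewrite /= sub0r normrN.
- move=> x; rewrite normrM ler_piMr// indicE.
  by case: (_ \in _); rewrite ?normr1 ?normr0.
- move=> x; rewrite indicE; case: (boolP (_ \in _)); last by rewrite mulr0 eqxx.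
  by rewrite inE/= => /ltW.
Qed.

(** Provides one dominating function for all difference quotients with step [1/(k+1)]. As the step
    is at most 1, both points are outside the support once [x] is farther from it than [|v|]. *)
Lemma quotient_bounded Om phi v : test_function Om phi ->
  exists c N : R, 0 <= c /\ forall (k : nat) x,
    `|k.+1%:R * (phi (x + k.+1%:R^-1 *: v) - phi x)| <=
    c * \1_[set y : 'rV[R]_n | `|y| < N] x.
Proof.
move=> tf; have [L L0 hL] := test_lipschitz tf; have [N sN] := test_supp_bounded tf.
exists (L * `|v|), (N + `|v| + 1); split; first exact: mulr_ge0.
move=> k x.
have k1 : `|k.+1%:R^-1 *: v| <= `|v|.
  by rewrite normrZ ger0_norm// ler_piMl// invf_le1// ler1n.
rewrite indicE; case: (boolP (_ \in _)) => xN.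
  rewrite mulr1 normrM ger0_norm// -ler_pdivlMl// mulrC (le_trans (hL _ _))//.
  by rewrite normrZ (ger0_norm (_ : 0 <= k.+1%:R^-1))// -mulrA (mulrC `|v|).
rewrite mulr0 normr_le0 mulf_eq0 subr_eq0.
have {}xN : N + `|v| + 1 <= `|x| by rewrite leNgt; apply: contra xN; rewrite inE.
have -> : phi x = 0.
  apply/eqP; apply: contraLR xN => /sN; rewrite -ltNge => /le_lt_trans; apply.
  by rewrite -addrA ltrDl ltr_wpDl.
have -> : phi (x + k.+1%:R^-1 *: v) = 0; last by rewrite eqxx orbT.
apply/eqP; apply: contraLR xN => /sN h; rewrite -ltNge.
rewrite -(addrK (k.+1%:R^-1 *: v) x) (le_lt_trans (ler_normB _ _))//.
by rewrite (le_lt_trans (lerD h k1))// ltrDl.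
Qed.

(** By translation invariance each difference quotient has integral 0; dominated convergence passes
    this to the derivative. All integration by parts against test functions rests on this. *)
Lemma Rintegral_partial_eq0 Om phi i : test_function Om phi ->
  \int[mu]_x partial i phi x = 0.
Proof.
move=> tf; have sf : smooth phi by case: tf.
have mphi := test_measurable tf; have iphi := test_integrable tf.
pose F (k : nat) x := k.+1%:R * (phi (x + k.+1%:R^-1 *: e_ i) - phi x).
have mF k : measurable_fun setT (F k).
  apply: measurable_funM => //; apply: measurable_funB => //.
  exact: (measurableT_comp mphi (measurable_shift _)).
have F0 k : \int[mu]_x F k x = 0.
  rewrite /F RintegralZl//; last first.
    by apply: integrable_subr => //; exact: integrable_shift.
  rewrite RintegralB//; last exact: integrable_shift.
  by rewrite Rintegral_shift// subrr mulr0.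
have [c [N [c0 FN]]] := quotient_bounded (e_ i) tf.
have [] := @Rintegral_dct _ _ _ mu setT F (partial i phi) _ measurableT mF _
  (integrable_norm_ball c N) (fun k x _ => FN k x).
  by move=> x _; have := smooth_quotient_cvg (x := x) (v := e_ i) sf; rewrite dotrVC dotrV_delta mxE.
move=> _; under eq_fun do rewrite F0.
by move=> /(cvg_unique _ (@cvg_cst _ _ _ _ _))->.
Qed.

End test_function_theory.

(** * Powers and L^p spaces *)

Section powers.
Context {R : realType}.
Implicit Types a b p q r : R.

Lemma le_powR r a b : 0 <= r -> 0 <= a -> a <= b -> a `^ r <= b `^ r.
Proof.
move=> r0 a0 ab; apply: ge0_ler_powR => //; rewrite nnegrE//.
exact: le_trans ab.
Qed.

Lemma lt_powR r a b : 0 < r -> 0 <= a -> a < b -> a `^ r < b `^ r.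
Proof.
move=> r0 a0 ab; apply: gt0_ltr_powR => //; rewrite nnegrE//.
exact: le_trans (ltW ab).
Qed.

Lemma powRK r a : r != 0 -> 0 <= a -> (a `^ r) `^ r^-1 = a.
Proof. by move=> r0 a0; rewrite -powRrM mulfV// powRr1. Qed.

Lemma powRVK r a : r != 0 -> 0 <= a -> (a `^ r^-1) `^ r = a.
Proof. by move=> r0 a0; rewrite -powRrM mulVf// powRr1. Qed.

Section conjugate.
Variables p q : R.
Hypothesis p1 : 1 < p.
Hypothesis qE : q = p / (p - 1).

Lemma conj_gt0 : 0 < p. Proof. exact: lt_trans p1. Qed.

Lemma conj_gt1 : 1 < q.
Proof. by rewrite qE ltr_pdivlMr ?subr_gt0// mul1r ltrBlDr ltrDl. Qed.

Lemma conjV : p^-1 + q^-1 = 1.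
Proof.
have p0 : p != 0 by rewrite gt_eqF// conj_gt0.
by rewrite qE invf_div -{1}[p^-1]mul1r -mulrDl addrC subrK mulfV.
Qed.

Lemma conj_exp : (p - 1) * q = p.
Proof. by rewrite qE mulrC divfK// subr_eq0 gt_eqF. Qed.

Lemma conj_expV : (q - 1) * p = q.
Proof.
have p10 : p - 1 != 0 by rewrite subr_eq0 gt_eqF.
by rewrite qE; field.
Qed.

Lemma conj_div : p / q = p - 1.
Proof.
have q0 : q != 0 by rewrite gt_eqF// (lt_trans _ conj_gt1).
by rewrite -{1}conj_exp mulfK.
Qed.

(** Young's inequality for [a] and [b^(p-1)], whose q-th power is [b^p]. Rearranged, it says that
    the graph of t^p lies above its tangent at [b]; the Lipschitz bounds, Jensen's inequality and
    the strict convexity below come from this. *)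
Lemma young_tangent a b : 0 <= a -> 0 <= b ->
  p * (a * b `^ (p - 1)) <= a `^ p + (p - 1) * b `^ p.
Proof.
move=> a0 b0; have p0 := conj_gt0.
have := conjugate_powR a0 (powR_ge0 b (p - 1)) p0 (lt_trans ltr01 conj_gt1) conjV.
rewrite -powRrM conj_exp -(ler_pM2l p0) => /le_trans; apply.
by rewrite mulrDr mulrCA mulfV ?gt_eqF// mulr1 mulrCA conj_div mulrC.
Qed.

Lemma powR_tangent a b : 0 <= a -> 0 <= b ->
  b `^ p - a `^ p <= p * b `^ (p - 1) * (b - a).
Proof.
move=> a0 b0; have := young_tangent a0 b0.
rewrite mulrBr -[X in _ -> _ <= X - _]mulrA -[b `^ (p - 1) * b]mulrC mulr_powRB1 ?conj_gt0//.
lra.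
Qed.

Lemma powR_lipschitz a b M : 0 <= a -> 0 <= b -> a <= M -> b <= M ->
  `|a `^ p - b `^ p| <= p * M `^ (p - 1) * `|a - b|.
Proof.
have p0 := conj_gt0.
wlog ba : a b / b <= a.
  move=> h a0 b0 aM bM; have [ba|/ltW ab] := leP b a; first exact: h.
  by rewrite distrC (distrC a); exact: h.
move=> a0 b0 aM bM.
rewrite ger0_norm ?subr_ge0 ?le_powR ?(ltW p0)// ger0_norm ?subr_ge0//.
rewrite (le_trans (powR_tangent b0 a0))// ler_wpM2r ?subr_ge0//.
by rewrite ler_pM2l// le_powR// subr_ge0 ltW.
Qed.

(** Jensen's inequality: in the sum of the tangent inequalities at the mean [t], the linear terms
    cancel. *)
Lemma powR_sum_le (I : finType) (x : I -> R) : (forall i, 0 <= x i) ->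
  (0 < #|I|)%N ->
  (\sum_i x i) `^ p <= #|I|%:R `^ (p - 1) * \sum_i x i `^ p.
Proof.
move=> x0 I0; set N := #|I|%:R : R; have N0 : 0 < N by rewrite ltr0n.
pose t := (\sum_i x i) / N.
have t0 : 0 <= t by rewrite divr_ge0// sumr_ge0.
have St : \sum_i x i = N * t by rewrite /t mulrC divfK// gt_eqF.
have h : \sum_i (t `^ p - x i `^ p) <= 0.
  apply: le_trans (_ : \sum_i p * t `^ (p - 1) * (t - x i) <= 0).
    by apply: ler_sum => i _; exact: powR_tangent.
  by rewrite -mulr_sumr sumrB St sumr_const -/N -[t *+ _]mulr_natl subrr mulr0.
move: h; rewrite sumrB sumr_const subr_le0 -[t `^ p *+ _]mulr_natl -/N => h.
rewrite St powRM// ?(ltW N0)// -(mulr_powRB1 (ltW N0) conj_gt0) -mulrA mulrCA.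
by rewrite ler_wpM2l ?powR_ge0.
Qed.

End conjugate.

Lemma normr_powR_continuous p : 1 < p -> continuous (fun x : R => `|x| `^ p).
Proof.
move=> p1 x; apply/cvgrPdist_lt => e e0.
pose L := p * (`|x| + 1) `^ (p - 1) + 1.
have L0 : 0 < L by rewrite ltr_wpDl// mulr_ge0 ?powR_ge0// ltW// (lt_trans _ p1).
near=> y.
have xy1 : `|x - y| < 1 by near: y; exact: cvgr_dist_lt.
have yx : `|y| <= `|x| + 1.
  rewrite -(subrK x y) (le_trans (ler_normD _ _))// addrC lerD2l// distrC ltW//.
rewrite (le_lt_trans (powR_lipschitz p1 erefl (normr_ge0 _) (normr_ge0 _) _ yx))//.
  by rewrite lerDl.
apply: (@le_lt_trans _ _ (L * `|x - y|)).
  apply: ler_pM => //; first by rewrite mulr_ge0 ?powR_ge0// ltW// (lt_trans _ p1).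
    by rewrite lerDl.
  exact: ler_dist_dist.
rewrite -ltr_pdivlMl// mulrC.
by near: y; apply: cvgr_dist_lt => //; rewrite divr_gt0.
Unshelve. all: by end_near. Qed.

End powers.

Section Lp.
Context d (T : measurableType d) (R : realType) (mu : {measure set T -> \bar R}).
Variables (A : set T) (mA : measurable A) (p q : R).
Hypothesis p1 : 1 < p.
Hypothesis qE : q = p / (p - 1).
Implicit Types f g : T -> R.

Let p0 : 0 < p. Proof. exact: lt_trans p1. Qed.

(** Working form of membership in L^p(A). The Sobolev definitions speak of [Lfun] and of the
    extension by zero; [in_LfunP] translates. *)
Definition Lp_fun f := measurable_fun A f /\ mu.-integrable A (EFin \o (fun x => `|f x| `^ p)).

Lemma measurable_powRn (r : R) f : measurable_fun A f ->
  measurable_fun A (fun x => `|f x| `^ r).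
Proof.
move=> mf; have mn : measurable_fun A (fun x => `|f x|) by exact: measurableT_comp.
exact: (measurableT_comp (measurable_powR r) mn).
Qed.

Lemma Lnorm_restrict r f : 0 < r ->
  ('N[mu]_r%:E[EFin \o (f \_ A)] = (\int[mu]_(x in A) (`|f x| `^ r)%:E) `^ r^-1)%E.
Proof.
move=> r0; rewrite unlock [in RHS]integral_mkcond; congr (_ `^ _)%E.
apply: eq_integral => x _; rewrite /patch /=; case: ifPn => _.
  by [].
by rewrite /= normr0 powR0// gt_eqF.
Qed.

Lemma Lnorm_restrictE r f : 0 < r ->
  mu.-integrable A (EFin \o (fun x => `|f x| `^ r)) ->
  ('N[mu]_r%:E[EFin \o (f \_ A)] = ((\int[mu]_(x in A) (`|f x| `^ r)) `^ r^-1)%:E)%E.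
Proof.
move=> r0 fi; rewrite Lnorm_restrict// -poweR_EFin; congr (_ `^ _)%E.
by rewrite fineK//; exact: integrable_fin_num.
Qed.

Lemma in_LfunP f : f \_ A \in Lfun mu p%:E <-> Lp_fun f.
Proof.
split => [|[mf fi]].
  move=> /andP[]; rewrite inE /= => mf; rewrite inE => /= fn.
  have mf' : measurable_fun A f by apply/measurable_restrictT.
  split => //; apply/integrableP; split.
    by apply/measurable_EFinP; exact: measurable_powRn.
  move: fn; rewrite /finite_norm Lnorm_restrict//.
  move=> h; under eq_integral do rewrite /= ger0_norm ?powR_ge0//.
  rewrite ltey; apply/eqP => E; move: h; rewrite E.
  by rewrite poweRyr ?invr_eq0 ?gt_eqF.
have mf' : measurable_fun setT (f \_ A) by apply/(measurable_restrictT _ mA).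
apply/andP; split; rewrite inE//=.
by rewrite /finite_norm Lnorm_restrictE// ltry.
Qed.

Lemma conj_le_sum a b : 0 <= a -> 0 <= b -> a * b <= a `^ p + b `^ q.
Proof.
move=> a0 b0; have q1 := conj_gt1 p1 qE.
apply: (le_trans (conjugate_powR a0 b0 p0 (lt_trans ltr01 q1) (conjV p1 qE))).
by apply: lerD; rewrite ler_pdivrMr ?(lt_trans ltr01 q1)// ler_peMr ?powR_ge0// ltW.
Qed.

Lemma Lp_hoelder f g : measurable_fun A f -> measurable_fun A g ->
  mu.-integrable A (EFin \o (fun x => `|f x| `^ p)) ->
  mu.-integrable A (EFin \o (fun x => `|g x| `^ q)) ->
  mu.-integrable A (EFin \o (fun x => f x * g x)) /\
  \int[mu]_(x in A) `|f x * g x| <=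
  (\int[mu]_(x in A) (`|f x| `^ p)) `^ p^-1 * (\int[mu]_(x in A) (`|g x| `^ q)) `^ q^-1.
Proof.
move=> mf mg fi gi; have q1 := conj_gt1 p1 qE; have q0 : 0 < q by exact: lt_trans q1.
have mfg : measurable_fun A (fun x => f x * g x) by exact: measurable_funM.
have fgi : mu.-integrable A (EFin \o (fun x => f x * g x)).
  apply: (integrable_dominated mA mfg (integrable_addr mA fi gi)) => x Ax.
  by rewrite normrM; apply: conj_le_sum.
split => //.
have mf' : measurable_fun setT (f \_ A) by apply/(measurable_restrictT _ mA).
have mg' : measurable_fun setT (g \_ A) by apply/(measurable_restrictT _ mA).
have := hoelder mu mf' mg' p0 q0 (conjV p1 qE).
rewrite !Lnorm_restrictE//; rewrite -EFinM Lnorm1.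
rewrite (_ : (\int[mu]_x _ = \int[mu]_(x in A) `|(f x * g x)%:E|)%E); last first.
  rewrite [RHS]integral_mkcond; apply: eq_integral => x _ /=.
  by rewrite /patch; case: ifPn => //; rewrite mulr0 normr0.
rewrite -lee_fin => h; apply: le_trans h.
have fgn : (\int[mu]_(x in A) `|(f x * g x)%:E| \is a fin_num)%E.
  by apply: integrable_fin_num => //; exact: (integrable_abse fgi).
by rewrite -(fineK fgn).
Qed.

Lemma Rintegral_powR_eq0_cvg (F : nat -> R) r : 0 < r -> (forall k, 0 <= F k) ->
  (fun k => F k `^ r) @ \oo --> 0 -> F @ \oo --> 0.
Proof.
move=> r0 F0 h; apply/cvgrPdist_lt => e e0.
have er : 0 < e `^ r by rewrite powR_gt0.
near=> k; have : `|0 - F k `^ r| < e `^ r by near: k; exact: cvgr_dist_lt.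
rewrite !sub0r !normrN !ger0_norm ?powR_ge0// => hk.
rewrite ltNge; apply/negP => ek.
by move: hk; rewrite ltNge le_powR// ltW.
Unshelve. all: by end_near. Qed.

Lemma powR_cvg0 (F : nat -> R) r : 0 < r -> (forall k, 0 <= F k) ->
  F @ \oo --> 0 -> (fun k => F k `^ r) @ \oo --> 0.
Proof.
move=> r0 F0 h; apply: (@Rintegral_powR_eq0_cvg _ r^-1).
- by rewrite invr_gt0.
- by move=> k; exact: powR_ge0.
- by under eq_fun do rewrite powRK ?gt_eqF//.
Qed.

Lemma Lnorm_cvgP (f_ : nat -> T -> R) : (forall k, Lp_fun (f_ k)) ->
  ('N[mu]_p%:E[EFin \o (f_ k \_ A)]%E @[k --> \oo] --> 0%E) <->
  (fun k => \int[mu]_(x in A) (`|f_ k x| `^ p)) @ \oo --> 0.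
Proof.
move=> fi; under eq_fun do rewrite Lnorm_restrictE ?(fi _).2//.
have F0 k : 0 <= \int[mu]_(x in A) (`|f_ k x| `^ p).
  by apply: Rintegral_ge0 => x _; exact: powR_ge0.
split => [h|h].
  apply: (@Rintegral_powR_eq0_cvg _ p^-1); rewrite ?invr_gt0//.
  exact: (fine_cvg h).
apply: cvg_EFin; first exact: nearW.
by apply: powR_cvg0 => //; rewrite invr_gt0.
Qed.

End Lp.

Lemma normr_powR_cvg (R : realType) (p : R) (F : nat -> R) (l : R) : 1 < p ->
  F @ \oo --> l -> (fun k => `|F k| `^ p) @ \oo --> `|l| `^ p.
Proof.
move=> p1 Fl.
exact: (cvg_comp F (fun x : R => `|x| `^ p) Fl (normr_powR_continuous p1 (x := l))).
Qed.

Lemma limn_einf_le_near (R : realType) (u : nat -> \bar R) (e : \bar R) (N : nat) :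
  (forall k, (N <= k)%N -> (u k <= e)%E) -> (limn_einf u <= e)%E.
Proof.
move=> uN; rewrite limn_einf_lim; apply: lime_le; first exact: is_cvg_einfs.
apply: nearW => m; apply: (le_trans _ (uN (maxn m N) (leq_maxr _ _))).
by apply: ereal_inf_lbound; exists (maxn m N) => //=; exact: leq_maxl.
Qed.

(** * Completeness of L^p on a set of finite measure *)

Section Lp_complete.
Context d (T : measurableType d) (R : realType) (mu : {measure set T -> \bar R}).
Variables (A : set T) (mA : measurable A) (p : R).
Hypothesis p1 : 1 < p.
Hypothesis Afin : (mu A < +oo)%E.
Implicit Types f g : T -> R.

Let p0 : 0 < p. Proof. exact: lt_trans p1. Qed.

Lemma powR_add_le (a b : R) : `|a + b| `^ p <= 2 `^ p * (`|a| `^ p + `|b| `^ p).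
Proof.
have h (x y : R) : `|x| <= `|y| -> `|x + y| `^ p <= 2 `^ p * (`|x| `^ p + `|y| `^ p).
  move=> xy; apply: (@le_trans _ _ ((2 * `|y|) `^ p)).
    apply: le_powR; [exact: ltW|exact: normr_ge0|].
    by rewrite (le_trans (ler_normD _ _))// mulr_natl mulr2n lerD2r.
  by rewrite powRM// ler_wpM2l ?powR_ge0// lerDr powR_ge0.
have [ab|/ltW ba] := leP `|a| `|b|; first exact: h.
by rewrite addrC [X in _ * X]addrC; exact: h.
Qed.

Lemma Lp_funD f g : Lp_fun mu A p f -> Lp_fun mu A p g ->
  Lp_fun mu A p (fun x => f x + g x).
Proof.
move=> [mf fi] [mg gi].
have mfg : measurable_fun A (fun x => f x + g x) by exact: measurable_funD.
split => //; apply: (integrable_dominated mA (measurable_powRn _ mfg)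
  (integrable_scaler mA (2 `^ p) (integrable_addr mA fi gi))) => x Ax.
by rewrite ger0_norm ?powR_ge0// powR_add_le.
Qed.

Lemma Lp_funZ (a : R) f : Lp_fun mu A p f -> Lp_fun mu A p (fun x => a * f x).
Proof.
move=> [mf fi]; split; first exact: measurable_funM.
rewrite (_ : (fun x => _) = (fun x => `|a| `^ p * `|f x| `^ p)).
  exact: integrable_scaler.
by apply/funext => x; rewrite normrM powRM.
Qed.

Lemma Lp_funB f g : Lp_fun mu A p f -> Lp_fun mu A p g ->
  Lp_fun mu A p (fun x => f x - g x).
Proof.
move=> hf hg; rewrite (_ : (fun x => _) = (fun x => f x + -1 * g x)).
  by apply: Lp_funD => //; exact: Lp_funZ.
by apply/funext => x; rewrite mulN1r.
Qed.

Lemma Lp_complete (f_ : nat -> T -> R) : (forall k, Lp_fun mu A p (f_ k)) ->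
  (forall e, 0 < e -> exists N, forall k l, (N <= k)%N -> (N <= l)%N ->
    \int[mu]_(x in A) (`|f_ k x - f_ l x| `^ p) <= e) ->
  exists2 f, Lp_fun mu A p f &
    (fun k => \int[mu]_(x in A) (`|f_ k x - f x| `^ p)) @ \oo --> 0.
Proof.
move=> Lf cauchy.
(* The bound is a p-th power so that the L^p norms of the increments are at most [2^-j]. *)
have /choice[N NP] : forall j : nat, exists N, forall k l, (N <= k)%N -> (N <= l)%N ->
    \int[mu]_(x in A) (`|f_ k x - f_ l x| `^ p) <= (2^-1 ^+ j) `^ p.
  move=> j; apply: cauchy; rewrite powR_gt0// exprn_gt0// invr_gt0//.
(* The sum makes the indices monotone and puts [n_ j] beyond [N j]; the summand [j] makes them
   unbounded. *)
pose n_ j := (j + \sum_(i < j.+1) N i)%N.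
have nj j : (j <= n_ j)%N by exact: leq_addr.
have nN j : (N j <= n_ j)%N by rewrite /n_ big_ord_recr/= addnA leq_addl.
have nS j : (n_ j <= n_ j.+1)%N.
  by rewrite /n_ [in leqRHS]big_ord_recr/= addSn ltnW// ltnS addnA leq_addr.
pose g j := f_ (n_ j).
have Lg j : Lp_fun mu A p (g j) by exact: Lf.
pose D_ (j : nat) (x : T) : R := `|g j.+1 x - g j x|.
have mD j : measurable_fun A (D_ j).
  apply: measurableT_comp => //; apply: measurable_funB; [exact: (Lg _).1|exact: (Lg _).1].
(* As [A] has finite measure, Hoelder's inequality against the constant 1 turns the increments into
   an absolutely convergent series in L^1, which therefore converges almost everywhere. *)
pose q := p / (p - 1).
have int1 : mu.-integrable A (EFin \o (fun x : T => `|1 : R| `^ q)).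
  apply/integrableP; split; first exact/measurable_EFinP.
  by under eq_integral do rewrite /= normr1 powR1 normr1; rewrite integral_cst// mul1e.
pose cA := (\int[mu]_(x in A) (`|1 : R| `^ q)) `^ q^-1.
have iD j : mu.-integrable A (EFin \o D_ j) /\
    \int[mu]_(x in A) D_ j x <= 2^-1 ^+ j * cA.
  have [mh hi] := Lp_funB (Lg j.+1) (Lg j).
  have [ih hh] := Lp_hoelder mA p1 erefl mh (measurable_cst (1 : R)) hi int1.
  have E : (fun x => `|(g j.+1 x - g j x) * 1|) = D_ j by apply/funext => x; rewrite mulr1.
  split.
    rewrite -E; exact: (integrable_abse ih).
  rewrite -/(Rintegral mu A (D_ j)) -E; apply: (le_trans hh).
  rewrite ler_wpM2r ?powR_ge0// -[leRHS](powRK (r := p)) ?gt_eqF ?exprn_ge0 ?invr_ge0//.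
  apply: le_powR; first by rewrite invr_ge0 ltW.
    by apply: Rintegral_ge0 => x _; exact: powR_ge0.
  apply: (NP j); [exact: (leq_trans (nN j) (nS j))|exact: nN].
pose h x := (\sum_(j <oo) (D_ j x)%:E)%E.
have D0 j x : (0 <= (D_ j x)%:E)%E by rewrite lee_fin; exact: normr_ge0.
have mh : measurable_fun A h.
  apply: (@ge0_emeasurable_sum _ _ _ A (fun j x => (D_ j x)%:E) xpredT) => //.
  by move=> j _; exact/measurable_EFinP.
have ih : mu.-integrable A h.
  apply/integrableP; split => //.
  under eq_integral => x _ do rewrite gee0_abs ?nneseries_ge0//.
  rewrite integral_nneseries//; last by move=> j; exact/measurable_EFinP.
  apply: (@le_lt_trans _ _ (\sum_(j <oo) (2^-1 ^+ j * cA)%:E)%E).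
    apply: lee_nneseries => //.
      by move=> j _ _; exact: integral_ge0.
    move=> j _; have [iDj hj] := iD j.
    rewrite -[leLHS]fineK ?lee_fin//; exact: integrable_fin_num.
  have -> : (\sum_(j <oo) (2^-1 ^+ j * cA)%:E = (cA * (1 - 2^-1)^-1)%:E)%E.
    have hc : series (geometric cA (2^-1 : R)) @ \oo --> cA * (1 - 2^-1)^-1.
      by apply: cvg_geometric_series; rewrite ger0_norm ?invf_lt1 ?ltr1n.
    rewrite (_ : (fun _ => _) = (EFin \o series (geometric cA (2^-1 : R)))).
      apply/cvg_lim => //; exact: cvg_EFin (nearW _ _) hc.
    apply/funext => m /=; rewrite /series/= -sumEFin; apply: eq_bigr => j _.
    by rewrite mulrC.
  exact: ltry.
(* The points where the increments are summable: a set of full measure in [A], on which the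
   subsequence converges. *)
pose D := A `&` [set x | (h x < +oo)%E].
have mDD : measurable D.
  exact: (measurable_lte mA mh (measurable_cst (+oo%E : \bar R))).
have DA : D `<=` A by move=> x [].
have nD : mu (A `\` D) = 0%E.
  have [Z [mZ Z0 hZ]] := integrable_ae mA ih.
  apply: (subset_measure0 _ mZ) => //; first exact: measurableD.
  move=> x [Ax nDx]; apply: hZ => /= /(_ Ax) hx; apply: nDx; split => //=.
  by rewrite ltey_eq hx.
have cD x : D x -> cvgn (g ^~ x).
  move=> [Ax hx].
  have -> : g ^~ x = (fun j => g 0%N x + series (telescope (g ^~ x)) j).
    by apply/funext => j; rewrite -eq_sum_telescope.
  apply: is_cvgD; first exact: is_cvg_cst.
  apply: normed_cvg; apply: nondecreasing_is_cvgn.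
    by apply: nondecreasing_series => j _ _; exact: normr_ge0.
  exists (fine (h x)) => _ [m _ <-].
  rewrite -lee_fin fineK; last first.
    by rewrite ge0_fin_numE//; apply: nneseries_ge0 => j _ _; exact: D0.
  rewrite /series/= -sumEFin.
  by apply: (nneseries_lim_ge (u_ := fun j => (D_ j x)%:E) (P := xpredT)) => j _ _; exact: D0.
pose f := (fun x => limn (g ^~ x)) \_ D.
have gf x : D x -> g ^~ x @ \oo --> f x.
  by move=> Dx; rewrite /f /patch mem_set//; exact: cD.
have mf : measurable_fun A f.
  apply: measurable_funTS.
  apply: (@measurable_fun_cvg _ _ _ setT (fun j => g j \_ D)).
    move=> j; apply/(measurable_restrictT _ mDD).
    by apply: measurable_funS (Lg j).1.
  move=> x _; have [xD|xD] := pselect (D x).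
    rewrite (_ : (fun j => (g j \_ D) x) = g ^~ x); first exact: gf.
    by apply/funext => j; rewrite /patch mem_set.
  rewrite (_ : (fun j => (g j \_ D) x) = (fun=> f x)); first exact: cvg_cst.
  by apply/funext => j; rewrite /f /patch memNset.
(* Fatou's lemma along the subsequence. A bound on the tail of the Cauchy sequence is inherited by
   the limit, which gives both that [f] is in L^p and the convergence. *)
have key e k : (exists N, (N <= k)%N /\ forall l, (N <= l)%N ->
    \int[mu]_(x in A) (`|f_ k x - f_ l x| `^ p) <= e) ->
    (\int[mu]_(x in A) (`|f_ k x - f x| `^ p)%:E <= e%:E)%E.
  move=> [N0 [N0k hN0]].
  have mkf : measurable_fun A (fun x => (`|f_ k x - f x| `^ p)%:E).
    apply/measurable_EFinP; apply: measurable_powRn.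
    by apply: measurable_funB => //; exact: (Lf k).1.
  have AE : A = D `|` (A `\` D) by rewrite setDUK.
  rewrite [X in (\int[mu]_(x in X) _)%E]AE ge0_integral_setU//; last 3 first.
  - exact: measurableD.
  - by rewrite -AE.
  - by apply/disj_setPS => x [Dx []].
  rewrite (null_set_integral (N := A `\` D)) ?adde0//; last 2 first.
  - exact: measurableD.
  - by apply: measurable_funS mkf => // x [].
  have mkg j : measurable_fun A (fun x => (`|f_ k x - g j x| `^ p)%:E).
    apply/measurable_EFinP; apply: measurable_powRn.
    by apply: measurable_funB; [exact: (Lf k).1|exact: (Lg j).1].
  have ikg j : mu.-integrable A (fun x => (`|f_ k x - g j x| `^ p)%:E).
    exact: (Lp_funB (Lf k) (Lg j)).2.
  apply: (@le_trans _ _ (\int[mu]_(x in D) limn_einf (fun j => (`|f_ k x - g j x| `^ p)%:E))%E).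
    rewrite le_eqVlt; apply/orP; left; apply/eqP; apply: eq_integral => x.
    rewrite inE => Dx.
    have hc : (fun j => (`|f_ k x - g j x| `^ p)%:E) @ \oo --> (`|f_ k x - f x| `^ p)%:E.
      apply: cvg_EFin; first exact: nearW.
      by apply: normr_powR_cvg => //; apply: cvgB; [exact: cvg_cst|exact: gf].
    by rewrite is_cvg_limn_einfE; [apply/esym/cvg_lim|apply: cvgP hc].
  apply: (le_trans (fatou mu mDD _ _)).
  - by move=> j; apply: measurable_funS (mkg j).
  - by move=> j x _; rewrite lee_fin powR_ge0.
  apply: (@limn_einf_le_near _ _ _ N0) => j N0j.
  apply: (@le_trans _ _ (\int[mu]_(x in A) (`|f_ k x - g j x| `^ p)%:E)%E).
    by apply: ge0_subset_integral => // x _; rewrite lee_fin powR_ge0.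
  rewrite -[leLHS]fineK; last exact: (integrable_fin_num mA (ikg j)).
  by rewrite lee_fin; apply: hN0; exact: leq_trans (nj j).
have iff k e : (exists N, (N <= k)%N /\ forall l, (N <= l)%N ->
    \int[mu]_(x in A) (`|f_ k x - f_ l x| `^ p) <= e) ->
    mu.-integrable A (EFin \o (fun x => `|f_ k x - f x| `^ p)).
  move=> /key h2; apply/integrableP; split.
    apply/measurable_EFinP; apply: measurable_powRn.
    by apply: measurable_funB => //; exact: (Lf k).1.
  under eq_integral do rewrite /= ger0_norm ?powR_ge0//.
  exact: le_lt_trans h2 (ltry _).
have Lff : Lp_fun mu A p f.
  have [N0 hN0] := cauchy _ ltr01.
  have L1 : Lp_fun mu A p (fun x => f_ N0 x - f x).
    split; first by apply: measurable_funB => //; exact: (Lf N0).1.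
    by apply: (iff N0 1); exists N0; split => // l hl; exact: hN0.
  rewrite (_ : f = (fun x => f_ N0 x - (f_ N0 x - f x))); last first.
    by apply/funext => x; rewrite opprB addrC subrK.
  exact: Lp_funB.
exists f => //; apply/cvgrPdist_le => e e0.
have [N0 hN0] := cauchy _ e0; exists N0 => // k /= N0k.
rewrite sub0r normrN ger0_norm; last by apply: Rintegral_ge0 => x _; exact: powR_ge0.
rewrite -lee_fin fineK; last exact: (integrable_fin_num mA (Lp_funB (Lf k) Lff).2).
by apply: key; exists N0; split => // l hl; exact: hN0.
Qed.

End Lp_complete.

(** * Uniform convexity of the p-th power of the Euclidean norm *)

Section uniform_convexity.
Context {R : realType} {n : nat} (p : R).
Hypothesis p1 : 1 < p.
Implicit Types a b : 'rV[R]_n.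

Let p0 : 0 < p. Proof. exact: lt_trans p1. Qed.

(** Two tangents are used, at [m] and at the midpoint of [m] and [t]; the second has the larger
    slope, and this makes the inequality strict. *)
Lemma powR_tangent_lt (m t : R) : 0 <= m -> m < t ->
  m `^ p + p * m `^ (p - 1) * (t - m) < t `^ p.
Proof.
move=> m0 mt; pose x := (m + t) / 2.
have mx : m < x by rewrite /x; lra.
have xt : x < t by rewrite /x; lra.
have x0 : 0 <= x by rewrite (le_trans m0)// ltW.
have t0 : 0 <= t by rewrite (le_trans x0)// ltW.
have h1 := powR_tangent p1 erefl t0 x0.
have h2 := powR_tangent p1 erefl x0 m0.
have h3 : m `^ (p - 1) < x `^ (p - 1) by apply: lt_powR => //; rewrite subr_gt0.
have h4 : p * m `^ (p - 1) * (t - x) < p * x `^ (p - 1) * (t - x).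
  by rewrite ltr_pM2r ?subr_gt0// ltr_pM2l.
move: h1 h2 h4; move: (p * m `^ (p - 1)) (p * x `^ (p - 1)) => u v.
move: (t `^ p) (x `^ p) (m `^ p) => tp xp mp; nra.
Qed.

Lemma powR_midpoint_lt (s t : R) : 0 <= s -> 0 <= t -> s != t ->
  ((s + t) / 2) `^ p < (s `^ p + t `^ p) / 2.
Proof.
wlog st : s t / s < t.
  move=> h s0 t0 nst; have [st|ts|/eqP] := ltgtP s t; [exact: h| |by rewrite (negbTE nst)].
  by rewrite (addrC s) (addrC (s `^ p)); apply: h => //; rewrite eq_sym.
move=> s0 t0 _; set m := (s + t) / 2.
have m0 : 0 <= m by rewrite /m; lra.
have mt : m < t by rewrite /m; lra.
have h1 := powR_tangent_lt m0 mt.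
have h2 := powR_tangent p1 erefl s0 m0.
move: h1 h2; have -> : m - s = t - m by rewrite /m; lra.
move: (p * _ * _) (m `^ p) (s `^ p) (t `^ p) => *; lra.
Qed.

(** The defect of midpoint convexity of |z|^p. Its integral becomes small along a minimizing
    sequence. *)
Definition midpoint_gap a b : R :=
  (euclid_norm a `^ p + euclid_norm b `^ p) / 2 - euclid_norm (2^-1 *: (a + b)) `^ p.

(** If the norms differ, t^p is strictly convex; if they agree, the Euclidean norm of the midpoint
    is strictly smaller, by expanding the squares. *)
Lemma midpoint_gap_gt0 a b : a != b -> 0 < midpoint_gap a b.
Proof.
move=> ab; rewrite subr_gt0 euclid_normZ ger0_norm ?invr_ge0//.
have [ea|nab] := eqVneq (euclid_norm a) (euclid_norm b); last first.
  apply: le_lt_trans (powR_midpoint_lt (euclid_norm_ge0 a) (euclid_norm_ge0 b) nab).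
  apply: le_powR; first exact: ltW.
    by rewrite mulr_ge0 ?invr_ge0// euclid_norm_ge0.
  by rewrite mulrC ler_wpM2r ?invr_ge0// euclid_normD.
rewrite ea -mulr2n -[X in X / _]mulr_natr mulfK ?pnatr_eq0//.
apply: lt_powR => //; first by rewrite mulr_ge0 ?invr_ge0// euclid_norm_ge0.
rewrite -ltr_sqr ?nnegrE ?mulr_ge0 ?invr_ge0 ?euclid_norm_ge0//.
have d0 : 0 < euclid_norm (a - b) ^+ 2.
  by rewrite exprn_gt0// lt_neqAle eq_sym euclid_norm_eq0 subr_eq0 ab euclid_norm_ge0.
have : euclid_norm a ^+ 2 = euclid_norm b ^+ 2 by rewrite ea.
move: d0; rewrite exprMn !sqr_euclid_norm.
rewrite !(dotrVDl, dotrVDr, dotrVNl, dotrVNr) (dotrVC b a) => d0 E.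
by rewrite expr2 -invfM ltr_pdivrMl; lra.
Qed.

Lemma midpoint_gap_ge0 a b : 0 <= midpoint_gap a b.
Proof.
have [->|ab] := eqVneq a b; last exact/ltW/midpoint_gap_gt0.
have E : 2^-1 *: (b + b) = b.
  by rewrite -mulr2n -[b *+ 2]scaler_nat scalerA mulVf ?pnatr_eq0// scale1r.
by rewrite /midpoint_gap E; lra.
Qed.

Lemma euclid_powB_le a b :
  euclid_norm (a - b) `^ p <= 2 `^ p * (euclid_norm a `^ p + euclid_norm b `^ p).
Proof.
have := powR_add_le p1 (euclid_norm a) (euclid_norm b).
rewrite !ger0_norm ?addr_ge0 ?euclid_norm_ge0//; apply: le_trans.
by apply: le_powR; [exact: ltW|exact: euclid_norm_ge0|exact: euclid_normB].
Qed.

Lemma le_add_scaled (e x s m g : R) : 0 <= e -> 0 < m -> m <= g -> 0 <= x ->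
  s <= x -> s <= e + x / m * g.
Proof.
move=> e0 m0 mg x0 sx; rewrite (le_trans sx)//.
rewrite (@le_trans _ _ (x / m * g)) ?lerDr//.
by rewrite -mulrA ler_peMr// mulrC ler_pdivlMr// mul1r.
Qed.

Let V2 := ('rV[R]_n * 'rV[R]_n)%type.

Lemma pow_euclid_continuous : continuous (fun a : 'rV[R]_n => euclid_norm a `^ p).
Proof.
move=> a; have -> : (fun a : 'rV[R]_n => euclid_norm a `^ p) =
    (fun x : R => `|x| `^ p) \o (@euclid_norm R n).
  by apply/funext => x /=; rewrite ger0_norm// euclid_norm_ge0.
apply: continuous_comp; first exact: euclid_norm_continuous.
exact: normr_powR_continuous.
Qed.

Lemma comp_pair_continuous (f : 'rV[R]_n -> R) (g : V2 -> 'rV[R]_n) :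
  continuous f -> continuous g -> continuous (f \o g).
Proof. by move=> cf cg x; apply: continuous_comp; [exact: cg|exact: cf]. Qed.

(** Both sides are homogeneous of degree [p], so one may take [|a|^p + |b|^p = 1]. Where
    [|a - b|^p < e] the first term suffices; on the remaining compact set the gap has a positive
    minimum [m], and [C = 2^p / m] works. This qualitative form treats all [p > 1] alike, unlike
    Clarkson's inequalities. *)
Lemma uniform_convexity (e : R) : 0 < e -> exists2 C : R, 0 <= C & forall a b,
  euclid_norm (a - b) `^ p <= e * (euclid_norm a `^ p + euclid_norm b `^ p) +
    C * midpoint_gap a b.
Proof.
move=> e0.
pose N (z : V2) := euclid_norm z.1 `^ p + euclid_norm z.2 `^ p.
pose S (z : V2) := euclid_norm (z.1 - z.2) `^ p.
pose K := [set z : V2 | N z = 1 /\ e <= S z].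
have c1 : continuous (fun z : V2 => euclid_norm z.1 `^ p).
  by apply: (comp_pair_continuous pow_euclid_continuous) => z; exact: cvg_fst.
have c2 : continuous (fun z : V2 => euclid_norm z.2 `^ p).
  by apply: (comp_pair_continuous pow_euclid_continuous) => z; exact: cvg_snd.
have cN : continuous N by move=> z; apply: cvgD; [exact: c1|exact: c2].
have cS : continuous S.
  apply: (comp_pair_continuous pow_euclid_continuous (g := fun z : V2 => z.1 - z.2)) => z.
  by apply: cvgB; [exact: cvg_fst|exact: cvg_snd].
have cG : continuous (fun z : V2 => midpoint_gap z.1 z.2).
  move=> z; apply: cvgB; first by apply: cvgMl; exact: cN.
  apply: (comp_pair_continuous pow_euclid_continuous (g := fun z : V2 => 2^-1 *: (z.1 + z.2))) => {}z.
  by apply: cvgZr; apply: cvgD; [exact: cvg_fst|exact: cvg_snd].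
have cK : compact K.
  pose B : set 'rV[R]_n := [set x | `|x| <= 1].
  have cB : compact B.
    apply: bounded_closed_compact.
      by exists 1; split; [exact: num_real|move=> y /ltW y1 x /le_trans; apply].
    rewrite (_ : B = (fun x => `|x|) @^-1` [set y : R | y <= 1])//.
    apply: preimage_closed; last exact: closed_le.
    by move=> x _; exact: norm_continuous.
  apply: (subclosed_compact _ (compact_setX cB cB)).
    have -> : K = (N @^-1` [set x | x = 1]) `&` (S @^-1` [set x | e <= x]) by [].
    apply: closedI; apply: preimage_closed.
    - by move=> x _; exact: cN.
    - exact: closed_eq.
    - by move=> x _; exact: cS.
    - exact: closed_ge.
  have le1 (a : 'rV[R]_n) : euclid_norm a `^ p <= 1 -> `|a| <= 1.
    move=> h; apply: (le_trans (norm_le_euclid a)); rewrite leNgt; apply/negP => h1.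
    by have := lt_powR p0 ler01 h1; rewrite powR1 => /lt_le_trans /(_ h); rewrite ltxx.
  by move=> z [Nz _]; split; apply: le1; rewrite -Nz /N; [rewrite lerDl|rewrite lerDr]; exact: powR_ge0.
have norm0 a b : N (a, b) = 0 -> euclid_norm (a - b) `^ p = 0.
  rewrite /N/= => /eqP; rewrite paddr_eq0 ?powR_ge0// !powR_eq0 !euclid_norm_eq0.
  by move=> /andP[/andP[/eqP-> _] /andP[/eqP-> _]]; rewrite subrr euclid_norm0 powR0// gt_eqF.
have Nge0 z : 0 <= N z by rewrite addr_ge0// powR_ge0.
have scaled C : 0 <= C -> (forall z, N z = 1 -> S z <= e + C * midpoint_gap z.1 z.2) ->
    forall a b, euclid_norm (a - b) `^ p <= e * (euclid_norm a `^ p + euclid_norm b `^ p) +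
    C * midpoint_gap a b.
  move=> C0 h a b; rewrite -/(N (a, b)).
  have [/norm0 ->|N0] := eqVneq (N (a, b)) 0.
    by rewrite addr_ge0// mulr_ge0// ?midpoint_gap_ge0// ltW.
  have {}N0 : 0 < N (a, b) by rewrite lt_neqAle eq_sym N0 Nge0.
  pose t := N (a, b) `^ (- p^-1).
  have tp : t `^ p = (N (a, b))^-1.
    by rewrite -powRrM mulNr mulVf ?gt_eqF// powR_inv1// ltW.
  have t0 : 0 <= t by exact: powR_ge0.
  have Ht (x : 'rV[R]_n) : euclid_norm (t *: x) `^ p = (N (a, b))^-1 * euclid_norm x `^ p.
    by rewrite euclid_normZ ger0_norm// powRM ?euclid_norm_ge0// tp.
  have := h (t *: a, t *: b); rewrite /N/= !Ht -mulrDr -/(N (a, b)) mulVf ?gt_eqF//.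
  have -> : S (t *: a, t *: b) = (N (a, b))^-1 * euclid_norm (a - b) `^ p.
    by rewrite /S/= -scalerBr Ht.
  have -> : midpoint_gap (t *: a) (t *: b) = (N (a, b))^-1 * midpoint_gap a b.
    rewrite /midpoint_gap (_ : 2^-1 *: (t *: a + t *: b) = t *: (2^-1 *: (a + b))).
      by rewrite !Ht -mulrDr -mulrA -mulrBr.
    by rewrite -scalerDr !scalerA mulrC.
  move=> /(_ erefl); rewrite mulrCA ler_pdivrMl// mulrDr mulVKf ?gt_eqF//.
  by rewrite [N _ * e]mulrC.
(* [K] is empty in dimension 0 or when [e] is large; then [C = 0] does. *)
have [[z0 Kz0]|K0] := pselect (K !=set0); last first.
  exists 0 => //; apply: scaled => // z Nz; rewrite mul0r addr0 leNgt; apply/negP => eS.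
  by apply: K0; exists z; split => //; exact: ltW.
have [c] := compact_EVT_min (ex_intro _ z0 Kz0) cK (continuous_subspaceT cG).
move=> cK0 cmin0.
have cmin t (Kt : K t) := cmin0 t (mem_set Kt).
have [Nc eSc] : K c by exact: (set_mem cK0).
have dpos : 0 < midpoint_gap c.1 c.2.
  apply: midpoint_gap_gt0; apply/eqP => E; move: eSc; rewrite /S E subrr euclid_norm0.
  by rewrite powR0 ?gt_eqF// leNgt e0.
pose m := midpoint_gap c.1 c.2.
exists (2 `^ p / m); first by rewrite divr_ge0 ?powR_ge0// ltW.
apply: scaled => [|z Nz]; first by rewrite divr_ge0 ?powR_ge0// ltW.
have [eS|Se] := leP e (S z); last first.
  by rewrite (le_trans (ltW Se))// lerDl mulr_ge0 ?midpoint_gap_ge0// divr_ge0 ?powR_ge0// ltW.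
have mz : m <= midpoint_gap z.1 z.2 by exact: (cmin z (conj Nz eS)).
apply: (le_add_scaled (ltW e0) dpos mz (powR_ge0 _ _)).
by have := euclid_powB_le z.1 z.2; rewrite -/(N z) Nz mulr1.
Qed.

End uniform_convexity.

Section domain_integrals.
Context {R : realType} {n : nat}.
Local Notation mu := (@lebesgue_rV R n).
Implicit Types (phi psi : 'rV[R]_n -> R) (x v : 'rV[R]_n) (Om : set 'rV[R]_n).
Local Notation e_ i := (@delta_mx R 1 n ord0 i).

Lemma Rintegral_supp Om (f : 'rV[R]_n -> R) : (forall x, ~ Om x -> f x = 0) ->
  \int[mu]_(x in Om) f x = \int[mu]_x f x.
Proof.
move=> f0; rewrite Rintegral_mkcond; apply: eq_Rintegral => x _; rewrite /patch.
by case: ifPn => // /negP xO; rewrite f0// => Ox; apply: xO; rewrite inE.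
Qed.

Lemma Rintegral_test_partialM Om phi psi i : test_function Om phi -> smooth psi ->
  \int[mu]_(x in Om) (psi x * partial i phi x) =
  - \int[mu]_(x in Om) (partial i psi x * phi x).
Proof.
move=> tf spsi; have sf : smooth phi by case: tf.
have ti := test_partial i tf.
rewrite !(Rintegral_supp (Om := Om)); last 2 first.
- by move=> x nx; rewrite (test_out tf nx) mulr0.
- by move=> x nx; rewrite (test_out ti nx) mulr0.
have := Rintegral_partial_eq0 i (testM spsi tf).
rewrite partialM; [|by move=> x; exact: smooth_derivable..].
rewrite RintegralD//; last 2 first.
- by have := test_integrable (testM (smooth_partial i spsi) tf); exact.
- by have := test_integrable (testM spsi ti); exact.
by move/eqP; rewrite addrC addr_eq0 => /eqP.
Qed.

Lemma test_powR_integrable (r : R) Om phi : 0 < r -> test_function Om phi ->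
  mu.-integrable setT (EFin \o (fun x => `|phi x| `^ r)).
Proof.
move=> r0 tf; have [M M0 hM] := test_bounded tf; have [N hN] := test_supp_bounded tf.
apply: (bounded_supp_integrable (M := M `^ r) (N := N)).
- by apply: measurable_powRn; exact: test_measurable tf.
- by move=> x; rewrite ger0_norm ?powR_ge0// le_powR// ltW.
- by move=> x; rewrite powR_eq0 normr_eq0 negb_and => /orP[|/negPn]; [exact: hN|rewrite gt_eqF].
Qed.

End domain_integrals.

(** * Poincare inequality *)

Section poincare.
Context {R : realType} {n : nat} (p : R) (Om : set 'rV[R]_n).
Local Notation mu := (@lebesgue_rV R n).
Local Notation e_ i := (@delta_mx R 1 n ord0 i).
Hypotheses (p1 : 1 < p) (bOm : bounded_set Om).

Let p0 : 0 < p. Proof. exact: lt_trans p1. Qed.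

(** A translation by more than the width of [Om] carries the support off [Om]. So [phi] is, up to
    sign, a sum of [k+1] increments along equal steps of this translation; Jensen's inequality and
    translation invariance bound its norm by that of one difference quotient, and [k] tends to
    infinity. *)
Lemma poincare (i : 'I_n) : exists2 C : R, 0 <= C & forall phi, test_function Om phi ->
  \int[mu]_(x in Om) (`|phi x| `^ p) <=
  C * \int[mu]_(x in Om) (`|partial i phi x| `^ p).
Proof.
have [M [Mr OM]] := bOm.
pose M1 : R := `|M| + 1.
have OM1 x : Om x -> `|x| <= M1 by apply: OM; rewrite (le_lt_trans (ler_norm M))// ltrDl.
have M10 : 0 < M1 by rewrite ltr_wpDl.
(* More than [2 M1], which bounds the width of [Om] in each coordinate. *)
pose L : R := M1 *+ 2 + 1.
have L0 : 0 < L by rewrite addr_gt0// mulrn_wgt0.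
exists (L `^ p); first exact: powR_ge0.
move=> phi tf; have ti := test_partial i tf; have sf : smooth phi by case: tf.
have mphi := test_measurable tf.
rewrite !(Rintegral_supp (Om := Om)); last 2 first.
- by move=> x nx; rewrite (test_out ti nx) normr0 powR0// gt_eqF.
- by move=> x nx; rewrite (test_out tf nx) normr0 powR0// gt_eqF.
pose v : 'rV[R]_n := - L *: e_ i.
have phiv x : phi x != 0 -> phi (x + v) = 0.
  move=> px; have Ox : Om x by apply: contrapT => nx; rewrite (test_out tf nx) eqxx in px.
  apply: (test_out tf) => /OM1; rewrite leNgt => /negP; apply.
  have := coord_le_norm (x + v) ord0 i; apply: lt_le_trans.
  have := le_trans (coord_le_norm x ord0 i) (OM1 _ Ox).
  rewrite !mxE !eqxx mulr1 ler_norml => /andP[h1 h2].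
  rewrite ler0_norm; last by rewrite /L mulr2n; lra.
  by rewrite /L mulr2n; lra.
pose F (k : nat) (x : 'rV[R]_n) : R := k.+1%:R * (phi (x + k.+1%:R^-1 *: v) - phi x).
have mF k : measurable_fun setT (F k).
  apply: measurable_funM => //; apply: measurable_funB => //.
  exact: (measurableT_comp mphi (measurable_shift _)).
have [c [N [c0 FN]]] := quotient_bounded v tf.
pose g (x : 'rV[R]_n) : R := c `^ p * \1_[set y : 'rV[R]_n | `|y| < N] x.
have gi := integrable_norm_ball (c `^ p) N : mu.-integrable setT (EFin \o g).
have Fg k x : `|(`|F k x| `^ p)| <= g x.
  rewrite ger0_norm ?powR_ge0// (le_trans (le_powR (ltW p0) (normr_ge0 _) (FN k x)))//.
  rewrite /g indicE; case: (_ \in _); first by rewrite !mulr1.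
  by rewrite !mulr0 powR0// gt_eqF.
have mFp k : measurable_fun setT (fun x => `|F k x| `^ p) by exact: measurable_powRn.
have iF k : mu.-integrable setT (EFin \o (fun x => `|F k x| `^ p)).
  by apply: (integrable_dominated measurableT (mFp k) gi) => x _; exact: Fg.
have [|_] := @Rintegral_dct _ _ _ mu setT (fun k x => `|F k x| `^ p)
  (fun x => `|dotrV v (grad phi x)| `^ p) g measurableT mFp _ gi (fun k x _ => Fg k x).
  move=> x _; have := smooth_quotient_cvg (x := x) (v := v) sf.
  exact: normr_powR_cvg.
have -> : \int[mu]_x (`|dotrV v (grad phi x)| `^ p) =
    L `^ p * \int[mu]_x (`|partial i phi x| `^ p).
  rewrite -RintegralZl//; last exact: (test_powR_integrable p0 ti).
  apply: eq_Rintegral => x _.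
  by rewrite dotrVZl dotrVC dotrV_delta mxE normrM normrN (gtr0_norm L0) powRM// ltW.
move=> h; apply: (cvgr_to_ge h); apply: nearW => k.
have ishift (j : nat) : mu.-integrable setT
    (EFin \o (fun x => `|k.+1%:R^-1 * F k (x + (j%:R * k.+1%:R^-1) *: v)| `^ p)).
  apply: (integrable_shift (f := fun x => `|k.+1%:R^-1 * F k x| `^ p)).
  rewrite (_ : (fun x => _) = (fun x => k.+1%:R^-1 `^ p * `|F k x| `^ p)).
    exact: integrable_scaler.
  by apply/funext => x; rewrite normrM powRM// ger0_norm.
have tele x : `|phi x| <= \sum_(j < k.+1) `|k.+1%:R^-1 * F k (x + (j%:R * k.+1%:R^-1) *: v)|.
  have [->|px] := eqVneq (phi x) 0; first by rewrite normr0 sumr_ge0.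
  have -> : phi x = - \sum_(0 <= j < k.+1)
      (phi (x + (j.+1%:R * k.+1%:R^-1) *: v) - phi (x + (j%:R * k.+1%:R^-1) *: v)).
    rewrite (@telescope_sumr _ _ _ (fun j => phi (x + (j%:R * k.+1%:R^-1) *: v)))//.
    by rewrite mulfV ?pnatr_eq0// scale1r phiv// mul0r scale0r addr0 sub0r opprK.
  rewrite normrN big_mkord (le_trans (ler_norm_sum _ _ _))//; apply: ler_sum => j _.
  rewrite /F mulKf ?pnatr_eq0// -addrA -scalerDl.
  by rewrite -(natr1 j) mulrDl mul1r.
apply: (@le_trans _ _ (\int[mu]_x (k.+1%:R `^ (p - 1) *
    \sum_(j < k.+1) `|k.+1%:R^-1 * F k (x + (j%:R * k.+1%:R^-1) *: v)| `^ p))).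
  apply: le_Rintegral => //.
  - exact: (test_powR_integrable p0 tf).
  - by apply: integrable_scaler => //; apply: integrable_sumr => // j.
  - move=> x _; apply: le_trans (le_powR (ltW p0) (normr_ge0 _) (tele x)) _.
    by apply: le_trans (powR_sum_le p1 erefl _ _) _; rewrite ?card_ord.
rewrite RintegralZl//; last by apply: integrable_sumr => // j.
rewrite Rintegral_sumr//.
rewrite (eq_bigr (fun=> k.+1%:R^-1 `^ p * \int[mu]_x `|F k x| `^ p)); last first.
  move=> j _; rewrite (Rintegral_shift _ (f := fun x => `|k.+1%:R^-1 * F k x| `^ p)); last first.
    by apply: measurable_powRn; apply: measurable_funM.
  rewrite -RintegralZl//; apply: eq_Rintegral => x _.
  by rewrite normrM powRM// ger0_norm.
(* The powers of [k+1] cancel: [p - 1] from Jensen's inequality, 1 from the number of terms, [-p]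
   from the step. *)
rewrite sumr_const card_ord -[X in _ * X]mulr_natl mulrA [X in X * _]mulrC mulr_powRB1//.
by rewrite mulrA -powRM// mulfV ?pnatr_eq0// powR1 mul1r.
Qed.

End poincare.

(** * Torsion functions: energy estimates and existence *)

Section flux.
Context {R : realType} {n : nat} (p q : R).
Hypotheses (p1 : 1 < p) (qE : q = p / (p - 1)).
Implicit Types z w h : 'rV[R]_n.

Let p0 : 0 < p. Proof. exact: lt_trans p1. Qed.

(** The derivative of |.|^p at [z] in the direction [h], divided by [p]. *)
Definition flux z h : R := euclid_norm z `^ (p - 2) * dotrV z h.

Lemma fluxD z h w : flux z (h + w) = flux z h + flux z w.
Proof. by rewrite /flux dotrVDr mulrDr. Qed.

Lemma fluxZ (a : R) z h : flux z (a *: h) = a * flux z h.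
Proof. by rewrite /flux dotrVZr mulrCA. Qed.

Lemma fluxN z h : flux z (- h) = - flux z h.
Proof. by rewrite -scaleN1r fluxZ mulN1r. Qed.

Lemma powR_sub2 (t : R) : 0 <= t -> t `^ (p - 2) * t = t `^ (p - 1).
Proof.
move=> t0; rewrite mulrC (_ : p - 2 = p - 1 - 1); last by lra.
by rewrite mulr_powRB1// subr_gt0.
Qed.

Lemma norm_flux_le z h : `|flux z h| <= euclid_norm z `^ (p - 1) * euclid_norm h.
Proof.
rewrite /flux normrM (ger0_norm (powR_ge0 _ _)) -powR_sub2 ?euclid_norm_ge0//.
by rewrite -mulrA ler_wpM2l ?powR_ge0// cauchy_schwarz_norm.
Qed.

Lemma flux_id z : flux z z = euclid_norm z `^ p.
Proof.
rewrite /flux -sqr_euclid_norm expr2 mulrA powR_sub2 ?euclid_norm_ge0//.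
by rewrite mulrC mulr_powRB1 ?euclid_norm_ge0.
Qed.

(** Convexity of |z|^p: the scalar tangent inequality for the norms, combined with
    Cauchy-Schwarz. *)
Lemma flux_tangent z w :
  euclid_norm w `^ p - euclid_norm z `^ p <= p * flux w (w - z).
Proof.
have := young_tangent p1 qE (euclid_norm_ge0 z) (euclid_norm_ge0 w).
rewrite fluxD fluxN flux_id mulrBr.
have : flux w z <= euclid_norm z * euclid_norm w `^ (p - 1).
  by rewrite mulrC (le_trans (ler_norm _))// norm_flux_le.
rewrite -(ler_pM2l p0) => h1 h2; have := le_trans h1 h2; lra.
Qed.

(** A positive limit allows any real exponent; [p - 2] may be negative. *)
Lemma powR_cvg_gt0 (a : nat -> R) (l r : R) : 0 < l -> a @ \oo --> l ->
  (fun k => a k `^ r) @ \oo --> l `^ r.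
Proof.
move=> l0 al.
have E (x : R) : 0 < x -> x `^ r = expR (r * ln x).
  by move=> x0; rewrite /powR gt_eqF.
rewrite E//; apply: (@cvg_trans _ ((fun k => expR (r * ln (a k))) @ \oo)).
  apply: near_eq_cvg; near=> k; rewrite E//.
  by near: k; exact: cvgr_gt al _ l0.
have ra : (fun k => r * ln (a k)) @ \oo --> r * ln l.
  by apply: cvgM; [exact: cvg_cst|exact: (cvg_comp a _ al (continuous_ln l0))].
exact: (cvg_comp _ _ ra (@continuous_expR R (r * ln l))).
Unshelve. all: by end_near. Qed.

(** For [p < 2] the factor |z|^(p-2) is singular at 0, so the case [z = 0] is treated through the
    bound |z|^(p-1) |h|, whose exponent is positive. Elsewhere each factor converges. *)
Lemma flux_cvg z h w :
  (fun k => flux (z + k.+1%:R^-1 *: w) h) @ \oo --> flux z h.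
Proof.
have hc : (fun k => k.+1%:R^-1 : R) @ \oo --> 0 by exact: cvg_harmonic.
have nz : (fun k => euclid_norm (z + k.+1%:R^-1 *: w)) @ \oo --> euclid_norm z.
  apply/cvgrPdist_le => e e0.
  have e1 : 0 < e / (euclid_norm w + 1) by rewrite divr_gt0// ltr_wpDl// euclid_norm_ge0.
  near=> k.
  apply: (le_trans (ler_dist_euclid _ _)).
  rewrite opprD addrA subrr sub0r euclid_normN euclid_normZ ger0_norm//.
  apply: (@le_trans _ _ (k.+1%:R^-1 * (euclid_norm w + 1))).
    by rewrite ler_wpM2l// lerDl.
  rewrite -ler_pdivlMr ?ltr_wpDl ?euclid_norm_ge0//.
  have : `|0 - k.+1%:R^-1 : R| < e / (euclid_norm w + 1) by near: k; exact: cvgr_dist_lt.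
  by rewrite sub0r normrN ger0_norm// => /ltW.
have [z0|z0] := eqVneq z 0.
  rewrite {2}/flux {2 3}z0 dotrV0l mulr0.
  apply/norm_cvg0P.
  apply: (@squeeze_cvgr _ _ _ _ (cst 0)
    (fun k => euclid_norm (z + k.+1%:R^-1 *: w) `^ (p - 1) * euclid_norm h)).
  - by apply: nearW => k; rewrite normr_ge0/= norm_flux_le.
  - exact: cvg_cst.
  - rewrite -(mul0r (euclid_norm h)); apply: cvgMr_tmp.
    apply: powR_cvg0; first by rewrite subr_gt0.
      by move=> k; exact: euclid_norm_ge0.
    by move: nz; rewrite {2}z0 euclid_norm0.
apply: cvgM.
  apply: powR_cvg_gt0 => //.
  by rewrite lt_neqAle eq_sym euclid_norm_eq0 z0 euclid_norm_ge0.
have -> : (fun k => dotrV (z + k.+1%:R^-1 *: w) h) = (fun k => dotrV z h + k.+1%:R^-1 * dotrV w h).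
  by apply/funext => k; rewrite dotrVDl dotrVZl.
rewrite -[X in _ --> X]addr0; apply: cvgD; first exact: cvg_cst.
by rewrite -(mul0r (dotrV w h)); apply: cvgMr_tmp.
Unshelve. all: by end_near. Qed.

End flux.

Section vector_Lp.
Context {R : realType} {n : nat} (p q : R) (Om : set 'rV[R]_n) (i0 : 'I_n).
Local Notation mu := (@lebesgue_rV R n).
Hypotheses (p1 : 1 < p) (qE : q = p / (p - 1)) (mOm : measurable Om).
Implicit Types (g h : 'rV[R]_n -> 'rV[R]_n).

Let p0 : 0 < p. Proof. exact: lt_trans p1. Qed.
Let q1 : 1 < q. Proof. exact: conj_gt1 p1 qE. Qed.
Let q0 : 0 < q. Proof. exact: lt_trans q1. Qed.

Definition VLp g := forall i, Lp_fun mu Om p (fun x => g x ord0 i).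

Definition energy g : R := \int[mu]_(x in Om) (euclid_norm (g x) `^ p).

Lemma energy_ge0 g : 0 <= energy g.
Proof. by apply: Rintegral_ge0 => x _; exact: powR_ge0. Qed.

Lemma VLpD g h : VLp g -> VLp h -> VLp (fun x => g x + h x).
Proof.
move=> Vg Vh i; rewrite (_ : (fun x => _) = (fun x => g x ord0 i + h x ord0 i)).
  exact: Lp_funD.
by apply/funext => x; rewrite mxE.
Qed.

Lemma VLpZ (a : R) g : VLp g -> VLp (fun x => a *: g x).
Proof.
move=> Vg i; rewrite (_ : (fun x => _) = (fun x => a * g x ord0 i)).
  exact: Lp_funZ.
by apply/funext => x; rewrite mxE.
Qed.

Lemma VLpB g h : VLp g -> VLp h -> VLp (fun x => g x - h x).
Proof.
move=> Vg Vh; rewrite (_ : (fun x => _) = (fun x => g x + (-1) *: h x)).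
  by apply: VLpD => //; exact: VLpZ.
by apply/funext => x; rewrite scaleN1r.
Qed.

Lemma measurable_dotrV g h : VLp g -> VLp h ->
  measurable_fun Om (fun x => dotrV (g x) (h x)).
Proof.
move=> Vg Vh; apply: measurable_sum => i.
by apply: measurable_funM; [exact: (Vg i).1|exact: (Vh i).1].
Qed.

Lemma measurable_euclid g : VLp g -> measurable_fun Om (fun x => euclid_norm (g x)).
Proof.
move=> Vg; have ms : measurable_fun setT (@Num.sqrt R).
  by apply: continuous_measurable_fun => x; exact: sqrt_continuous.
exact: (measurableT_comp ms (measurable_dotrV Vg Vg)).
Qed.

Lemma measurable_euclid_powR (r : R) g : VLp g ->
  measurable_fun Om (fun x => euclid_norm (g x) `^ r).
Proof. by move=> Vg; exact: (measurableT_comp (measurable_powR r) (measurable_euclid Vg)). Qed.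

Lemma measurable_flux g h : VLp g -> VLp h ->
  measurable_fun Om (fun x => flux p (g x) (h x)).
Proof.
move=> Vg Vh; apply: measurable_funM; [exact: measurable_euclid_powR|exact: measurable_dotrV].
Qed.

(** A crude constant is enough: this only passes from convergence of each component in L^p to
    convergence of the energy. The index [i0] records that the dimension is positive. *)
Lemma euclid_powR_le_sum (z : 'rV[R]_n) :
  euclid_norm z `^ p <= n%:R `^ p * (n%:R `^ (p - 1) * \sum_i `|z ord0 i| `^ p).
Proof.
have n0 : (0 < #|'I_n|)%N by rewrite card_ord (leq_trans _ (ltn_ord i0)).
have := powR_sum_le p1 qE (x := fun i => `|z ord0 i|) (fun i => normr_ge0 _) n0.
rewrite card_ord => h.
apply: le_trans (ler_wpM2l (powR_ge0 _ _) h).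
rewrite -powRM// ?sumr_ge0//; apply: le_powR; first exact: ltW.
  exact: euclid_norm_ge0.
rewrite (le_trans (euclid_le_norm z))// ler_wpM2l//.
apply: norm_le_coord; first by apply: sumr_ge0.
move=> i j; have -> : i = ord0 by exact: ord1.
by rewrite (bigD1 j)//= lerDl sumr_ge0.
Qed.

Lemma integrable_energy g : VLp g ->
  mu.-integrable Om (EFin \o (fun x => euclid_norm (g x) `^ p)).
Proof.
move=> Vg; apply: (integrable_dominated mOm (measurable_euclid_powR p Vg)
  (g := fun x => n%:R `^ p * (n%:R `^ (p - 1) * \sum_i `|g x ord0 i| `^ p))).
  do 2 apply: integrable_scaler => //.
  by apply: integrable_sumr => // i; exact: (Vg i).2.
by move=> x _; rewrite ger0_norm ?powR_ge0// euclid_powR_le_sum.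
Qed.

Lemma energy_le_sum g : VLp g ->
  energy g <= n%:R `^ p * (n%:R `^ (p - 1) *
    \sum_i \int[mu]_(x in Om) (`|g x ord0 i| `^ p)).
Proof.
move=> Vg; have ii i := (Vg i).2.
rewrite -Rintegral_sumr// -!RintegralZl//; last 2 first.
- by apply: integrable_scaler => //; exact: integrable_sumr.
- exact: integrable_sumr.
apply: le_Rintegral => //; first exact: integrable_energy.
- by do 2 apply: integrable_scaler => //; exact: integrable_sumr.
- by move=> x _; exact: euclid_powR_le_sum.
Qed.

Lemma coord_le_energy g i : VLp g ->
  \int[mu]_(x in Om) (`|g x ord0 i| `^ p) <= energy g.
Proof.
move=> Vg; apply: le_Rintegral => //; first exact: (Vg i).2.
  exact: integrable_energy.
by move=> x _; apply: le_powR; [exact: ltW|exact: normr_ge0|exact: coord_le_euclid].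
Qed.

Lemma flux_hoelder g h : VLp g -> VLp h ->
  mu.-integrable Om (EFin \o (fun x => flux p (g x) (h x))) /\
  `|\int[mu]_(x in Om) flux p (g x) (h x)| <= energy g `^ q^-1 * energy h `^ p^-1.
Proof.
move=> Vg Vh.
have mh := measurable_euclid Vh; have mg := measurable_euclid_powR (p - 1) Vg.
have Eh : (fun x => `|euclid_norm (h x)| `^ p) = (fun x => euclid_norm (h x) `^ p).
  by apply/funext => x; rewrite ger0_norm ?euclid_norm_ge0.
have Eg : (fun x => `|euclid_norm (g x) `^ (p - 1)| `^ q) = (fun x => euclid_norm (g x) `^ p).
  by apply/funext => x; rewrite ger0_norm ?powR_ge0// -powRrM (conj_exp p1 qE).
have ih : mu.-integrable Om (EFin \o (fun x => `|euclid_norm (h x)| `^ p)).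
  by rewrite Eh; exact: integrable_energy.
have ig : mu.-integrable Om (EFin \o (fun x => `|euclid_norm (g x) `^ (p - 1)| `^ q)).
  by rewrite Eg; exact: integrable_energy.
have [igh Hh] := Lp_hoelder mOm p1 qE mh mg ih ig.
have ifl : mu.-integrable Om (EFin \o (fun x => flux p (g x) (h x))).
  apply: (integrable_dominated mOm (measurable_flux Vg Vh) igh) => x _.
  by rewrite mulrC norm_flux_le.
split; first exact: ifl.
apply: (le_trans (le_normr_Rintegral mOm ifl)).
apply: (@le_trans _ _ (\int[mu]_(x in Om) `|euclid_norm (h x) * euclid_norm (g x) `^ (p - 1)|)).
  apply: le_Rintegral => //.
  - exact: (integrable_norm ifl).
  - exact: (integrable_norm igh).
  - move=> x _; rewrite mulrC [leRHS]ger0_norm ?mulr_ge0 ?powR_ge0 ?euclid_norm_ge0//.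
    exact: norm_flux_le.
have E1 : \int[mu]_(x in Om) (`|euclid_norm (h x)| `^ p) = energy h.
  by apply: eq_Rintegral => x _; rewrite ger0_norm ?euclid_norm_ge0.
have E2 : \int[mu]_(x in Om) (`|euclid_norm (g x) `^ (p - 1)| `^ q) = energy g.
  by apply: eq_Rintegral => x _; rewrite ger0_norm ?powR_ge0// -powRrM (conj_exp p1 qE).
by apply: (le_trans Hh); rewrite E1 E2 [leRHS]mulrC lexx.
Qed.

Lemma energy_diff_le g h : VLp g -> VLp h ->
  energy g - energy h <= p * (energy g `^ q^-1 * energy (fun x => g x - h x) `^ p^-1).
Proof.
move=> Vg Vh; have Vgh := VLpB Vg Vh; have [ifl hfl] := flux_hoelder Vg Vgh.
rewrite -RintegralB//; try exact: integrable_energy.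
apply: (@le_trans _ _ (\int[mu]_(x in Om) (p * flux p (g x) (g x - h x)))).
  apply: le_Rintegral => //.
  - by apply: integrable_subr => //; exact: integrable_energy.
  - exact: integrable_scaler.
  - by move=> x _; exact: (flux_tangent p1 qE).
by rewrite RintegralZl// ler_pM2l// (le_trans (ler_norm _)).
Qed.

Lemma energyN g h : energy (fun x => g x - h x) = energy (fun x => h x - g x).
Proof. by apply: eq_Rintegral => x _; rewrite euclid_norm_distC. Qed.

Lemma energy_triangle g h : VLp g -> VLp h ->
  energy (fun x => g x - h x) <= 2 `^ p * (energy g + energy h).
Proof.
move=> Vg Vh; have ig := integrable_energy Vg; have ih := integrable_energy Vh.
rewrite -RintegralD// -RintegralZl//; last exact: integrable_addr.
apply: le_Rintegral; first exact: mOm.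
- by apply: integrable_energy; exact: VLpB.
- by apply: integrable_scaler => //; exact: integrable_addr.
- by move=> x _; exact: euclid_powB_le.
Qed.

(** Convexity takes the place of Minkowski's inequality: integrating [flux_tangent] in both orders
    bounds the difference of two energies by [p E^(1/q) d^(1/p)], where [E] is either energy and [d]
    is the energy of the difference. *)
Lemma energy_cvg (g_ : nat -> 'rV[R]_n -> 'rV[R]_n) g : (forall k, VLp (g_ k)) -> VLp g ->
  (fun k => energy (fun x => g_ k x - g x)) @ \oo --> 0 ->
  (fun k => energy (g_ k)) @ \oo --> energy g.
Proof.
move=> Vk Vg dk.
pose d k := energy (fun x => g_ k x - g x).
have dkp : (fun k => d k `^ p^-1) @ \oo --> 0.
  by apply: powR_cvg0 => //; [rewrite invr_gt0|move=> k; exact: energy_ge0].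
(* Bounds [energy g], and also [energy (g_ k)] as soon as [d k <= 1]. *)
pose M := 2 `^ p * (1 + energy g).
have M0 : 0 <= M by rewrite mulr_ge0 ?powR_ge0// addr_ge0// energy_ge0.
have gM : energy g <= M.
  rewrite /M (@le_trans _ _ (1 + energy g)) ?lerDr// ler_peMl ?addr_ge0 ?energy_ge0//.
  by rewrite -[leLHS](powRr0 2) ler_powR ?ler1n// ltW.
apply/cvgrPdist_le => e e0.
pose c := p * M `^ q^-1 + 1.
have c0 : 0 < c by rewrite ltr_wpDl// mulr_ge0 ?powR_ge0// ltW.
have ec : 0 < e / c by rewrite divr_gt0.
near=> k.
have dk1 : d k <= 1.
  have : `|0 - d k| < 1 by near: k; exact: cvgr_dist_lt.
  by rewrite sub0r normrN ger0_norm ?energy_ge0// => /ltW.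
have dke : d k `^ p^-1 <= e / c.
  have : `|0 - d k `^ p^-1| < e / c by near: k; exact: cvgr_dist_lt.
  by rewrite sub0r normrN ger0_norm ?powR_ge0// => /ltW.
have gkM : energy (g_ k) <= M.
  have -> : energy (g_ k) = energy (fun x => (g_ k x - g x) - (- 1) *: g x).
    by apply: eq_Rintegral => x _; rewrite scaleN1r opprK subrK.
  apply: (le_trans (energy_triangle (VLpB (Vk k) Vg) (VLpZ (-1) Vg))).
  apply: ler_wpM2l; first exact: powR_ge0.
  apply: lerD; first exact: dk1.
  by rewrite le_eqVlt; apply/orP; left; apply/eqP; apply: eq_Rintegral => x _; rewrite scaleN1r euclid_normN.
have bound E : 0 <= E -> E <= M -> p * (E `^ q^-1 * d k `^ p^-1) <= e.
  move=> E0 EM; apply: (@le_trans _ _ (c * (e / c))); last by rewrite mulrC divfK ?gt_eqF.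
  rewrite mulrA ler_pM ?mulr_ge0 ?powR_ge0 ?(ltW p0)//.
  rewrite (@le_trans _ _ (p * M `^ q^-1)) ?lerDl// ler_pM2l// le_powR// invr_ge0 ltW//.
rewrite ler_norml lerNl opprB; apply/andP; split.
  by apply: (le_trans (energy_diff_le (Vk k) Vg)); exact: (bound _ (energy_ge0 _) gkM).
apply: (le_trans (energy_diff_le Vg (Vk k))); rewrite energyN.
exact: (bound _ (energy_ge0 _) gM).
Unshelve. all: by end_near. Qed.

End vector_Lp.

Lemma sumr_cvg0 (R : realType) (I : finType) (F : I -> nat -> R) :
  (forall i, F i @ \oo --> 0) -> (fun k => \sum_i F i k) @ \oo --> 0.
Proof.
move=> F0; under eq_fun do rewrite -big_enum/=.
elim: (enum I) => [|i s ih].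
  by rewrite (_ : (fun k => _) = cst 0); [exact: cvg_cst|apply/funext => k; rewrite big_nil].
rewrite (_ : (fun k => _) = (fun k => F i k + \sum_(j <- s) F j k)).
  have h := @cvgD R _ _ _ _ _ _ _ _ (F0 i) ih; rewrite addr0 in h; exact: h.
by apply/funext => k; rewrite big_cons.
Qed.

Section torsion_solution.
Context {R : realType} {n : nat} (p q : R) (Om : set 'rV[R]_n) (i0 : 'I_n).
Local Notation mu := (@lebesgue_rV R n).
Hypotheses (p1 : 1 < p) (qE : q = p / (p - 1)) (mOm : measurable Om) (bOm : bounded_set Om).
Implicit Types (phi psi u : 'rV[R]_n -> R) (g : 'rV[R]_n -> 'rV[R]_n).

Let p0 : 0 < p. Proof. exact: lt_trans p1. Qed.
Let q1 : 1 < q. Proof. exact: conj_gt1 p1 qE. Qed.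
Let q0 : 0 < q. Proof. exact: lt_trans q1. Qed.
Let Omfin : (mu Om < +oo)%E. Proof. exact: bounded_lebesgue_rV_lty. Qed.

Local Notation energy := (energy p Om).

Lemma test_Lp_fun phi : test_function Om phi -> Lp_fun mu Om p phi.
Proof.
move=> tf; split; first exact: measurable_funS (test_measurable tf).
by apply: integrableS (test_powR_integrable p0 tf).
Qed.

Lemma VLp_grad phi : test_function Om phi -> VLp p Om (grad phi).
Proof.
move=> tf i; rewrite (_ : (fun x => _) = partial i phi).
  by apply: test_Lp_fun; exact: test_partial.
by apply/funext => x; rewrite mxE.
Qed.

Lemma Lp_fun_cst1 (r : R) : mu.-integrable Om (EFin \o (fun=> `|1 : R| `^ r)).
Proof.
by apply: (bounded_integrable (M := 1)) => // x _; rewrite normr1 powR1 normr1.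
Qed.

Lemma Rintegral_le_Lp u : Lp_fun mu Om p u ->
  `|\int[mu]_(x in Om) u x| <=
  (\int[mu]_(x in Om) (`|u x| `^ p)) `^ p^-1 * (volume Om) `^ q^-1.
Proof.
move=> [mu_ iu].
have [ih hh] := Lp_hoelder mOm p1 qE mu_ (measurable_cst (1 : R)) iu (Lp_fun_cst1 q).
have E : (fun x => u x * (1 : R)) = u by apply/funext => x; rewrite mulr1.
rewrite /= E in ih.
apply: (le_trans (le_normr_Rintegral mOm ih)).
have -> : \int[mu]_(x in Om) `|u x| = \int[mu]_(x in Om) `|u x * 1|.
  by apply: eq_Rintegral => x _; rewrite mulr1.
apply: (le_trans hh); rewrite (_ : \int[mu]_(x in Om) (`|cst 1 x| `^ q) = volume Om)//.
rewrite -[RHS]mul1r -Rintegral_cst//; apply: eq_Rintegral => x _.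
by rewrite normr1 powR1.
Qed.

Lemma Lp_fun_integrable u : Lp_fun mu Om p u -> mu.-integrable Om (EFin \o u).
Proof.
move=> [mu_ iu].
have [ih _] := Lp_hoelder mOm p1 qE mu_ (measurable_cst (1 : R)) iu (Lp_fun_cst1 q).
by have E : (fun x => u x * (1 : R)) = u by [apply/funext => x; rewrite mulr1]; rewrite /= E in ih.
Qed.

Lemma Rintegral_Lp_cvg (u_ : nat -> 'rV[R]_n -> R) u :
  (forall k, Lp_fun mu Om p (u_ k)) -> Lp_fun mu Om p u ->
  (fun k => \int[mu]_(x in Om) (`|u_ k x - u x| `^ p)) @ \oo --> 0 ->
  (fun k => \int[mu]_(x in Om) u_ k x) @ \oo --> \int[mu]_(x in Om) u x.
Proof.
move=> Lk Lu dk.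
have h k : `|\int[mu]_(x in Om) u_ k x - \int[mu]_(x in Om) u x| <=
    (\int[mu]_(x in Om) (`|u_ k x - u x| `^ p)) `^ p^-1 * (volume Om) `^ q^-1.
  rewrite -RintegralB//; try exact: Lp_fun_integrable.
  exact: (Rintegral_le_Lp (Lp_funB mOm p1 (Lk k) Lu)).
apply/subr_cvg0/norm_cvg0P.
apply: (@squeeze_cvgr _ _ _ _ (cst 0) _ _ _ _ (cvg_cst _) _).
- by apply: nearW => k; rewrite normr_ge0/=; exact: h.
- rewrite -(mul0r (volume Om `^ q^-1)); apply: cvgMr_tmp.
  apply: powR_cvg0 => //; first by rewrite invr_gt0.
  by move=> k; apply: Rintegral_ge0 => x _; exact: powR_ge0.
Qed.

Lemma Rintegral_mul_test_cvg (u_ : nat -> 'rV[R]_n -> R) u psi :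
  (forall k, Lp_fun mu Om p (u_ k)) -> Lp_fun mu Om p u -> test_function Om psi ->
  (fun k => \int[mu]_(x in Om) (`|u_ k x - u x| `^ p)) @ \oo --> 0 ->
  (fun k => \int[mu]_(x in Om) (u_ k x * psi x)) @ \oo --> \int[mu]_(x in Om) (u x * psi x).
Proof.
move=> Lk Lu tpsi dk; have [M M0 hM] := test_bounded tpsi.
have mpsi : measurable_fun Om psi by exact: measurable_funS (test_measurable tpsi).
have Lmul v : Lp_fun mu Om p v -> Lp_fun mu Om p (fun x => v x * psi x).
  move=> [mv iv]; have mvp : measurable_fun Om (fun x => v x * psi x) by exact: measurable_funM.
  split => //; apply: (integrable_dominated mOm (measurable_powRn p mvp)
    (integrable_scaler mOm (M `^ p) iv)) => x _.
  rewrite ger0_norm ?powR_ge0// normrM powRM// mulrC ler_wpM2r ?powR_ge0//.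
  by rewrite le_powR// ltW.
apply: Rintegral_Lp_cvg; [by move=> k; exact: Lmul|exact: Lmul|].
apply: (@squeeze_cvgr _ _ _ _ (cst 0)
  (fun k => M `^ p * \int[mu]_(x in Om) (`|u_ k x - u x| `^ p)) _ _ _ (cvg_cst _) _).
- apply: nearW => k; rewrite Rintegral_ge0/=; last by move=> x _; exact: powR_ge0.
  have [md id] := Lp_funB mOm p1 (Lk k) Lu.
  rewrite -RintegralZl//; apply: le_Rintegral => //.
  + exact: (Lp_funB mOm p1 (Lmul _ (Lk k)) (Lmul _ Lu)).2.
  + exact: integrable_scaler.
  + move=> x _; rewrite -mulrBl normrM powRM// mulrC ler_wpM2r ?powR_ge0//.
    by rewrite le_powR// ltW.
- by rewrite -(mulr0 (M `^ p)); apply: cvgMl_tmp.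
Qed.

Lemma energy_cvg0 (g_ : nat -> 'rV[R]_n -> 'rV[R]_n) : (forall k, VLp p Om (g_ k)) ->
  (forall i, (fun k => \int[mu]_(x in Om) (`|g_ k x ord0 i| `^ p)) @ \oo --> 0) ->
  (fun k => energy (g_ k)) @ \oo --> 0.
Proof.
move=> Vg ci.
apply: (@squeeze_cvgr _ _ _ _ (cst 0)
  (fun k => n%:R `^ p * (n%:R `^ (p - 1) *
    \sum_i \int[mu]_(x in Om) (`|g_ k x ord0 i| `^ p))) _ _ _ (cvg_cst _) _).
- apply: nearW => k; rewrite energy_ge0/=.
  exact: (energy_le_sum i0 p1 qE mOm (Vg k)).
- have := cvgMl_tmp (a := n%:R `^ p) (cvgMl_tmp (a := n%:R `^ (p - 1)) (sumr_cvg0 ci)).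
  by rewrite !mulr0; exact.
Qed.

Lemma W01pP u g : W01p p Om u g ->
  [/\ Lp_fun mu Om p u, VLp p Om g & exists phi_ : nat -> 'rV[R]_n -> R,
    [/\ forall k, test_function Om (phi_ k),
      (fun k => \int[mu]_(x in Om) (`|phi_ k x - u x| `^ p)) @ \oo --> 0 &
      (fun k => energy (fun x => grad (phi_ k) x - g x)) @ \oo --> 0]].
Proof.
move=> [[Lu Lg _] [phi_ [tphi cphi dphi]]].
have {}Lu : Lp_fun mu Om p u by exact/(in_LfunP mu mOm p1 u).
have Vg : VLp p Om g by move=> i; exact: ((in_LfunP mu mOm p1 _).1 (Lg i)).
split => //; exists phi_; split => //.
  have Ld k : Lp_fun mu Om p (phi_ k \- u)%R.
    by apply: Lp_funB => //; exact: test_Lp_fun.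
  exact: ((Lnorm_cvgP mOm p1 Ld).1 cphi).
have Lid i k : Lp_fun mu Om p (fun x => (grad (phi_ k) x - g x) ord0 i).
  by apply: VLpB => //; exact: VLp_grad.
have E i k : (partial i (phi_ k) \- (fun x => g x ord0 i))%R =
    (fun x => (grad (phi_ k) x - g x) ord0 i) by apply/funext => x; rewrite !mxE.
have ci i : (fun k => \int[mu]_(x in Om) (`|(grad (phi_ k) x - g x) ord0 i| `^ p)) @ \oo --> 0.
  have Lid' k : Lp_fun mu Om p (partial i (phi_ k) \- (fun x => g x ord0 i))%R.
    by rewrite E; exact: Lid.
  rewrite (_ : (fun k => _) = (fun k => \int[mu]_(x in Om)
      (`|(partial i (phi_ k) \- (fun x => g x ord0 i))%R x| `^ p))).
    exact: ((Lnorm_cvgP mOm p1 Lid').1 (dphi i)).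
  by apply/funext => k; rewrite E.
apply: energy_cvg0 ci => k i; exact: Lid.
Qed.

(** The solution is not a test function, so testing with it means testing with the approximations
    [phi_ k] and passing to the limit: the integral of [u] is the energy E of its gradient. The last
    two clauses say that E^(1/q) is the best constant in the test inequality. *)
Lemma torsion_solutionP u : torsion_solution p Om u ->
  exists g, [/\ VLp p Om g, \int[mu]_(x in Om) u x = energy g,
    (forall phi, test_function Om phi ->
      \int[mu]_(x in Om) phi x <= energy g `^ q^-1 * energy (grad phi) `^ p^-1) &
    (forall C : R, 0 <= C -> (forall phi, test_function Om phi ->
      \int[mu]_(x in Om) phi x <= C * energy (grad phi) `^ p^-1) ->
      \int[mu]_(x in Om) u x <= C `^ q)].
Proof.
move=> [g Wg weak]; have [Lu Vg [phi_ [tphi cphi cgrad]]] := W01pP Wg.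
have VG k := VLp_grad (tphi k).
have cu : (fun k => \int[mu]_(x in Om) phi_ k x) @ \oo --> \int[mu]_(x in Om) u x.
  by apply: Rintegral_Lp_cvg => // k; exact: test_Lp_fun.
have cE := energy_cvg i0 p1 qE mOm VG Vg cgrad.
have [iflg _] := flux_hoelder i0 p1 qE mOm Vg Vg.
have cfl : (fun k => \int[mu]_(x in Om) phi_ k x) @ \oo --> energy g.
  apply/subr_cvg0/norm_cvg0P.
  apply: (@squeeze_cvgr _ _ _ _ (cst 0)
    (fun k => energy g `^ q^-1 * energy (fun x => grad (phi_ k) x - g x) `^ p^-1) _ _ _ (cvg_cst _) _).
  - apply: nearW => k; rewrite normr_ge0/=.
    have [iflk _] := flux_hoelder i0 p1 qE mOm Vg (VG k).
    have [_] := flux_hoelder i0 p1 qE mOm Vg (VLpB p1 mOm (VG k) Vg).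
    congr (`|_| <= _).
    rewrite -(weak _ (tphi k)).
    rewrite (_ : energy g = \int[mu]_(x in Om) flux p (g x) (g x)); last first.
      by apply: eq_Rintegral => x _; rewrite (flux_id p1).
    rewrite -(RintegralB mOm iflk iflg); apply: eq_Rintegral => x _.
    by rewrite fluxD fluxN.
  - have e0 : (fun k => energy (fun x => grad (phi_ k) x - g x) `^ p^-1) @ \oo --> 0.
      by apply: powR_cvg0; [rewrite invr_gt0|move=> k; exact: energy_ge0|].
    by have := cvgMl_tmp (a := energy g `^ q^-1) e0; rewrite mulr0; exact.
have uE : \int[mu]_(x in Om) u x = energy g.
  exact: (cvg_unique _ cu cfl).
exists g; split => //.
- move=> phi tf; rewrite -(weak _ tf).
  have [_ h] := flux_hoelder i0 p1 qE mOm Vg (VLp_grad tf).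
  exact: le_trans (ler_norm _) h.
(* The inequality for [phi_ k] gives E <= C E^(1/p) in the limit, which is E^(1/q) <= C when E is
   positive. *)
- move=> C C0 hC.
  have E0 := energy_ge0 p Om g.
  have hg : energy g <= C * energy g `^ p^-1.
    have cEp : (fun k => C * energy (grad (phi_ k)) `^ p^-1) @ \oo --> C * energy g `^ p^-1.
      apply: cvgMl_tmp; have [Eg0|Eg0] := eqVneq (energy g) 0.
        rewrite Eg0 powR0 ?invr_eq0 ?gt_eqF//; rewrite Eg0 in cE.
        by apply: (powR_cvg0 _ _ cE); [rewrite invr_gt0|move=> k; exact: energy_ge0].
      by apply: powR_cvg_gt0 => //; rewrite lt_neqAle eq_sym Eg0.
    rewrite -{1}uE; apply: (ler_cvg_to cu cEp); apply: nearW => k; exact: hC.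
  rewrite uE; have [->|Eg0] := eqVneq (energy g) 0; first exact: powR_ge0.
  have Egp : 0 < energy g by rewrite lt_neqAle eq_sym Eg0.
  have h2 : energy g `^ q^-1 <= C.
    have pq := conjV p1 qE.
    rewrite (_ : q^-1 = 1 - p^-1); last by rewrite -pq; ring.
    rewrite powRD ?Eg0 ?implybT// powRr1// powRN ler_pdivrMr// powR_gt0//.
  rewrite -[leLHS](powRVK (r := q)) ?gt_eqF//.
  by apply: le_powR; [exact: ltW|exact: powR_ge0|].
Qed.
End torsion_solution.

Lemma test0 {R : realType} {n : nat} (Om : set 'rV[R]_n) : test_function Om (fun=> 0).
Proof.
have E : [set x : 'rV[R]_n | (0 : R) != 0] = set0.
  by apply/seteqP; split => // x /=; rewrite eqxx.
split; first exact: (smooth_cst 0).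
  by rewrite E closure0; exact: compact0.
by rewrite E closure0.
Qed.

Lemma grad_test {R : realType} {n : nat} (Om : set 'rV[R]_n) phi psi (a : R) :
  test_function Om phi -> test_function Om psi ->
  grad (fun x => phi x + a * psi x) = (fun x => grad phi x + a *: grad psi x).
Proof.
move=> [sphi _ _] [spsi _ _]; apply/funext => x; apply/rowP => i; rewrite !mxE.
have dphi y : derivable phi y (delta_mx ord0 i) by exact: (sphi [::]).2.
have dpsi y : derivable psi y (delta_mx ord0 i) by exact: (spsi [::]).2.
have dapsi y : derivable (fun x => a * psi x) y (delta_mx ord0 i).
  exact: (smoothZ a spsi [::]).2.
by rewrite (partialD dphi dapsi) (partialZ a dpsi).
Qed.

Lemma midpoint_arith (R : realFieldType) (p a b c d e : R) : p != 0 ->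
  2^-1 * a + 2^-1 * b - c =
  p * ((a / p - d + (b / p - e)) / 2 - (c / p - (2^-1 * d + 2^-1 * e))).
Proof. by move=> p0; field. Qed.

(** * Existence of the torsion function *)

Section torsion_existence.
Context {R : realType} {n : nat} (p q : R) (Om : set 'rV[R]_n) (i0 : 'I_n).
Local Notation mu := (@lebesgue_rV R n).
Hypotheses (p1 : 1 < p) (qE : q = p / (p - 1)) (mOm : measurable Om) (bOm : bounded_set Om).
Implicit Types (phi psi u : 'rV[R]_n -> R) (g : 'rV[R]_n -> 'rV[R]_n).

Let p0 : 0 < p. Proof. exact: lt_trans p1. Qed.
Let q1 : 1 < q. Proof. exact: conj_gt1 p1 qE. Qed.
Let q0 : 0 < q. Proof. exact: lt_trans q1. Qed.
Let Omfin : (mu Om < +oo)%E. Proof. exact: bounded_lebesgue_rV_lty. Qed.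

Local Notation energy := (energy p Om).

(** The Poincare inequality in the single direction [i0], then Hoelder's inequality; it makes the
    linear term of [torsion_energy] subordinate to the energy. *)
Lemma Rintegral_test_le : exists2 C : R, 0 <= C & forall phi, test_function Om phi ->
  \int[mu]_(x in Om) phi x <= C * energy (grad phi) `^ p^-1.
Proof.
have [C C0 hC] := poincare p1 bOm i0.
exists (C `^ p^-1 * volume Om `^ q^-1); first by rewrite mulr_ge0 ?powR_ge0.
move=> phi tf.
apply: (le_trans (ler_norm _)).
apply: (le_trans (Rintegral_le_Lp p1 qE mOm bOm (test_Lp_fun p1 mOm tf))).
rewrite mulrAC ler_wpM2r ?powR_ge0// -powRM ?energy_ge0//.
apply: le_powR; first by rewrite invr_ge0 ltW.
  by apply: Rintegral_ge0 => x _; exact: powR_ge0.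
apply: (le_trans (hC phi tf)); apply: ler_wpM2l => //.
rewrite (_ : partial i0 phi = (fun x => grad phi x ord0 i0)).
  exact: (coord_le_energy i0 p1 qE mOm i0 (VLp_grad p1 mOm tf)).
by apply/funext => x; rewrite mxE.
Qed.

(** The functional whose Euler-Lagrange equation is the torsion problem, on test functions only. *)
Definition torsion_energy phi : R := energy (grad phi) / p - \int[mu]_(x in Om) phi x.

Lemma torsion_energy_coercive : exists K : R, forall phi, test_function Om phi ->
  energy (grad phi) / (2 * p) - K <= torsion_energy phi.
Proof.
have [C C0 hC] := Rintegral_test_le.
(* Young's inequality for (E/(2p))^(1/p) and C (2p)^(1/p): the first term absorbs half of E/p and
   the second is this constant. *)
exists ((C * (2 * p) `^ p^-1) `^ q) => phi tf.
have p2 : 0 < 2 * p by rewrite mulr_gt0.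
have E0 := energy_ge0 p Om (grad phi).
have h := conj_le_sum p1 qE (powR_ge0 (energy (grad phi) / (2 * p)) p^-1)
  (mulr_ge0 C0 (powR_ge0 (2 * p) p^-1)).
rewrite powRVK ?gt_eqF// in h; last by rewrite divr_ge0// ltW.
rewrite mulrCA -powRM ?divfK ?gt_eqF// in h; last by rewrite ltW.
  have {h} := le_trans (hC phi tf) h; rewrite /torsion_energy => h.
  have -> : energy (grad phi) / p = energy (grad phi) / (2 * p) + energy (grad phi) / (2 * p).
    by field; rewrite gt_eqF.
  lra.
by rewrite divr_ge0// ltW.
Qed.

(** The linear part cancels in the midpoint defect of the functional, so that only the convexity gap
    of the gradients remains. *)
Lemma torsion_energy_midpoint phi psi : test_function Om phi -> test_function Om psi ->
  \int[mu]_(x in Om) midpoint_gap p (grad phi x) (grad psi x) =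
  p * ((torsion_energy phi + torsion_energy psi) / 2 -
       torsion_energy (fun x => 2^-1 * phi x + 2^-1 * psi x)).
Proof.
move=> tphi tpsi.
have tm := testD (testZ 2^-1 tphi) (testZ 2^-1 tpsi).
have VA := VLp_grad p1 mOm tphi; have VB := VLp_grad p1 mOm tpsi; have VM := VLp_grad p1 mOm tm.
have iA := integrable_energy i0 p1 qE mOm VA.
have iB := integrable_energy i0 p1 qE mOm VB.
have iM := integrable_energy i0 p1 qE mOm VM.
have gE x : grad (fun x => 2^-1 * phi x + 2^-1 * psi x) x = 2^-1 *: (grad phi x + grad psi x).
  rewrite (grad_test 2^-1 (testZ 2^-1 tphi) tpsi) scalerDr; congr (_ + _).
  have := grad_test 2^-1 (test0 Om) tphi.
  rewrite (_ : (fun x => 0 + 2^-1 * phi x) = (fun x => 2^-1 * phi x)); last first.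
    by apply/funext => y; rewrite add0r.
  move=> ->; rewrite -[RHS]add0r; congr (_ + _).
  by apply/rowP => i; rewrite !mxE (partial_cst 0 i).
have -> : \int[mu]_(x in Om) midpoint_gap p (grad phi x) (grad psi x) =
    2^-1 * energy (grad phi) + 2^-1 * energy (grad psi) -
    energy (grad (fun x => 2^-1 * phi x + 2^-1 * psi x)).
  have hA := integrable_scaler mOm 2^-1 iA; have hB := integrable_scaler mOm 2^-1 iB.
  transitivity (\int[mu]_(x in Om) ((2^-1 * euclid_norm (grad phi x) `^ p +
      2^-1 * euclid_norm (grad psi x) `^ p) -
      euclid_norm (grad (fun x => 2^-1 * phi x + 2^-1 * psi x) x) `^ p)).
    by apply: eq_Rintegral => x _; rewrite gE /midpoint_gap -mulrDr [X in _ = X - _]mulrC.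
  have iS := integrable_addr mOm hA hB; rewrite /= in iS.
  rewrite (RintegralB mOm iS iM); congr (_ - _).
  rewrite (RintegralD mOm hA hB); congr (_ + _).
    exact: (RintegralZl 2^-1 mOm iA).
  exact: (RintegralZl 2^-1 mOm iB).
have jA := integrableS measurableT mOm (@subsetT _ Om) (test_integrable tphi).
have jB := integrableS measurableT mOm (@subsetT _ Om) (test_integrable tpsi).
rewrite /torsion_energy (RintegralD mOm (integrable_scaler mOm 2^-1 jA)
  (integrable_scaler mOm 2^-1 jB)) (RintegralZl 2^-1 mOm jA) (RintegralZl 2^-1 mOm jB).
by apply: midpoint_arith; rewrite gt_eqF.
Qed.
End torsion_existence.

Lemma midpoint_value_le (R : realFieldType) (m a b c d : R) :
  m <= c -> a <= m + d -> b <= m + d -> (a + b) / 2 - c <= d.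
Proof. lra. Qed.

Lemma cauchy_arith (R : realFieldType) (e M C p G A B t : R) : 0 < e -> 0 < M -> 0 <= C ->
  0 < p -> 2 * (C * p + 1) / e < t -> A <= M -> B <= M -> G <= p * t^-1 ->
  e / (4 * M) * (A + B) + C * G <= e.
Proof.
move=> e0 M0 C0 p0 ht AM BM Gp.
have Cp : 0 < C * p + 1 by rewrite ltr_wpDl// mulr_ge0// ltW.
have t0 : 0 < t by apply: lt_trans ht; rewrite divr_gt0// mulr_gt0.
rewrite [leRHS](splitr e) lerD//.
  have -> : e / (4 * M) * (A + B) = e / 2 * ((A + B) / (2 * M)).
    by field; rewrite gt_eqF.
  rewrite -[leRHS]mulr1 ler_pM2l ?divr_gt0// ler_pdivrMr ?mulr_gt0//; lra.
apply: (le_trans (ler_wpM2l C0 Gp)).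
rewrite mulrA ler_pdivrMr//.
rewrite ltr_pdivrMr// in ht.
by rewrite mulrAC ler_pdivlMr// mulrC [leRHS]mulrC; lra.
Qed.

Lemma variation_arith (R : realFieldType) (p t a b u v F : R) : 0 < p -> 0 < t ->
  a / p - u <= b / p - (u + t * v) -> b - a <= p * t * F -> v <= F.
Proof.
move=> p0 t0 h1 h2.
have pt : 0 < p * t by rewrite mulr_gt0.
rewrite -(ler_pM2l pt); apply: le_trans h2.
rewrite -mulrA -ler_pdivlMl// mulrBr -[p^-1 * b]mulrC -[p^-1 * a]mulrC.
lra.
Qed.

(** The steps are at most 1, so one integrable function dominates all the perturbed fluxes. *)
Lemma flux_step_le (R : realType) n (p : R) (g h : 'rV[R]_n) (k : nat) : 1 < p ->
  `|flux p (g + k.+1%:R^-1 *: h) h| <=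
  2 `^ p * (euclid_norm g `^ p + euclid_norm h `^ p) + euclid_norm h `^ p.
Proof.
move=> p1; have p0 : 0 < p by exact: lt_trans p1.
have t0 : (0 : R) <= k.+1%:R^-1 by rewrite invr_ge0.
have t1 : k.+1%:R^-1 <= 1 :> R by rewrite invf_le1// ler1n.
apply: (le_trans (norm_flux_le p1 _ _)).
rewrite mulrC; apply: (le_trans (conj_le_sum p1 erefl (euclid_norm_ge0 h) (powR_ge0 _ (p - 1)))).
rewrite -powRrM (conj_exp p1 erefl) addrC lerD2r.
rewrite -[k.+1%:R^-1 *: h]opprK.
apply: (le_trans (euclid_powB_le p1 _ _)); rewrite ler_wpM2l ?powR_ge0// lerD2l.
rewrite euclid_normN euclid_normZ ger0_norm// le_powR ?(ltW p0)//.
  by rewrite mulr_ge0 ?euclid_norm_ge0.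
by rewrite -[leRHS]mul1r ler_wpM2r ?euclid_norm_ge0.
Qed.

Section torsion_existence2.
Context {R : realType} {n : nat} (p q : R) (Om : set 'rV[R]_n) (i0 : 'I_n).
Local Notation mu := (@lebesgue_rV R n).
Hypotheses (p1 : 1 < p) (qE : q = p / (p - 1)) (mOm : measurable Om) (bOm : bounded_set Om).
Implicit Types (phi psi u : 'rV[R]_n -> R) (g : 'rV[R]_n -> 'rV[R]_n).

Let p0 : 0 < p. Proof. exact: lt_trans p1. Qed.
Let q1 : 1 < q. Proof. exact: conj_gt1 p1 qE. Qed.
Let q0 : 0 < q. Proof. exact: lt_trans q1. Qed.
Let Omfin : (mu Om < +oo)%E. Proof. exact: bounded_lebesgue_rV_lty. Qed.

Local Notation energy := (energy p Om).
Local Notation J := (torsion_energy p Om).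

Lemma test_subtract phi psi : test_function Om phi -> test_function Om psi ->
  test_function Om (fun x => phi x - psi x) /\
  grad (fun x => phi x - psi x) = (fun x => grad phi x - grad psi x).
Proof.
move=> tphi tpsi.
have E : (fun x => phi x - psi x) = (fun x => phi x + (-1) * psi x).
  by apply/funext => x; rewrite mulN1r.
rewrite E; split; first by apply: testD => //; exact: testZ.
by rewrite (grad_test _ tphi tpsi); apply/funext => x; rewrite scaleN1r.
Qed.

Lemma torsion_energy_inf : exists m : R, (forall phi, test_function Om phi -> m <= J phi) /\
  exists phi_ : nat -> 'rV[R]_n -> R, forall k, test_function Om (phi_ k) /\
    J (phi_ k) <= m + k.+1%:R^-1.
Proof.
have [K hK] := torsion_energy_coercive i0 p1 qE mOm bOm.
pose S : set R := [set J phi | phi in test_function Om].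
have p2 : 0 < 2 * p by rewrite mulr_gt0.
have hS : has_inf S.
  split; first by exists (J (fun=> 0)); exists (fun=> 0) => //; exact: test0.
  exists (- K) => _ [phi tphi <-]; apply: le_trans (hK phi tphi).
  by rewrite lerDr divr_ge0 ?energy_ge0// ltW.
exists (inf S); split.
  by move=> phi tphi; apply: ge_inf; [exact: hS.2|exists phi].
have /choice[phi_ Hphi] : forall k : nat, exists phi,
    test_function Om phi /\ J phi <= inf S + k.+1%:R^-1.
  move=> k; have k0 : (0 : R) < k.+1%:R^-1 by rewrite invr_gt0.
  by have [_ [phi tphi <-] /ltW] := inf_adherent k0 hS; exists phi.
by exists phi_.
Qed.

(** The midpoint of two near-minimizers has energy at least [m], so their gap has integral at most
    [p/(N+1)]. By coercivity the energies are bounded, and uniform convexity turns a small gap into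
    a small distance of the gradients. *)
Lemma minimizing_cauchy (m : R) (phi_ : nat -> 'rV[R]_n -> R) :
  (forall phi, test_function Om phi -> m <= J phi) ->
  (forall k, test_function Om (phi_ k) /\ J (phi_ k) <= m + k.+1%:R^-1) ->
  forall e : R, 0 < e -> exists N, forall k l, (N <= k)%N -> (N <= l)%N ->
    energy (grad (fun x => phi_ k x - phi_ l x)) <= e.
Proof.
move=> hm hphi e e0.
have [K hK] := torsion_energy_coercive i0 p1 qE mOm bOm.
have p2 : 0 < 2 * p by rewrite mulr_gt0.
pose M : R := 2 * p * (`|m| + 1 + `|K|).
have M0 : 0 < M by rewrite mulr_gt0// ltr_wpDr// ltr_wpDl.
have EM k : energy (grad (phi_ k)) <= M.
  have [tk Jk] := hphi k; have := le_trans (hK _ tk) Jk.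
  rewrite lerBlDr ler_pdivrMr// => /le_trans; apply.
  rewrite mulrC ler_pM2l// lerD ?ler_norm// lerD ?ler_norm//.
  by rewrite invf_le1// ler1n.
(* Both energies are at most [M], so the first term of [uniform_convexity] contributes at most
   [e/2]. *)
have e1 : 0 < e / (4 * M) by rewrite divr_gt0// mulr_gt0.
have [C C0 hC] := @uniform_convexity R n p p1 _ e1.
have C1 : 0 < 2 * (C * p + 1) / e.
  by rewrite divr_gt0// mulr_gt0// ltr_wpDl// mulr_ge0// ltW.
pose N := Num.truncn (2 * (C * p + 1) / e).
have hN : 2 * (C * p + 1) / e < N.+1%:R by exact: truncnS_gt.
exists N => k l Nk Nl.
have [tk Jk] := hphi k; have [tl Jl] := hphi l.
have [td gd] := test_subtract tk tl.
have tm := testD (testZ 2^-1 tk) (testZ 2^-1 tl).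
have VA := VLp_grad p1 mOm tk; have VB := VLp_grad p1 mOm tl.
have VM := VLp_grad p1 mOm tm; have VD := VLp_grad p1 mOm td.
have iA := integrable_energy i0 p1 qE mOm VA.
have iB := integrable_energy i0 p1 qE mOm VB.
have iD := integrable_energy i0 p1 qE mOm VD.
have gap := torsion_energy_midpoint i0 p1 qE mOm tk tl.
have igap : mu.-integrable Om (EFin \o (fun x => midpoint_gap p (grad (phi_ k) x) (grad (phi_ l) x))).
  have iV := integrable_energy i0 p1 qE mOm (VLpZ mOm 2^-1 (VLpD p1 mOm VA VB)).
  apply: (integrable_subr mOm _ iV).
  rewrite (_ : (fun x => _) = (fun x => 2^-1 * (euclid_norm (grad (phi_ k) x) `^ p
     + euclid_norm (grad (phi_ l) x) `^ p))); last by apply/funext => x; rewrite mulrC.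
  exact: (integrable_scaler mOm 2^-1 (integrable_addr mOm iA iB)).
rewrite gd.
have jS := integrable_scaler mOm (e / (4 * M)) (integrable_addr mOm iA iB).
have jG := integrable_scaler mOm C igap.
have : energy (fun x => grad (phi_ k) x - grad (phi_ l) x) <=
    e / (4 * M) * (energy (grad (phi_ k)) + energy (grad (phi_ l))) +
    C * \int[mu]_(x in Om) midpoint_gap p (grad (phi_ k) x) (grad (phi_ l) x).
  rewrite -(RintegralD mOm iA iB) -(RintegralZl C mOm igap).
  rewrite -(RintegralZl _ mOm (integrable_addr mOm iA iB)) -(RintegralD mOm jS jG).
  rewrite gd in iD.
  apply: (le_Rintegral mOm iD (integrable_addr mOm jS jG)) => x _; exact: hC.
move=> /le_trans; apply.
have hx : k.+1%:R^-1 <= N.+1%:R^-1 :> R by rewrite lef_pV2 ?posrE// ler_nat.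
have hy : l.+1%:R^-1 <= N.+1%:R^-1 :> R by rewrite lef_pV2 ?posrE// ler_nat.
have gapN : \int[mu]_(x in Om) midpoint_gap p (grad (phi_ k) x) (grad (phi_ l) x) <= p * N.+1%:R^-1.
  rewrite gap ler_pM2l//.
  exact: (midpoint_value_le (hm _ tm) (le_trans Jk (lerD (lexx m) hx))
    (le_trans Jl (lerD (lexx m) hy))).
exact: (cauchy_arith e0 M0 C0 p0 hN (EM k) (EM l) gapN).
Qed.

(** The Cauchy property of the gradients passes to each partial derivative and, through the Poincare
    inequality, to the functions. The sequence itself then witnesses membership in W_0^{1,p}, and
    integration by parts against a fixed test function survives the limit. *)
Lemma minimizing_limit (phi_ : nat -> 'rV[R]_n -> R) :
  (forall k, test_function Om (phi_ k)) ->
  (forall e : R, 0 < e -> exists N, forall k l, (N <= k)%N -> (N <= l)%N ->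
    energy (grad (fun x => phi_ k x - phi_ l x)) <= e) ->
  exists u g, [/\ W01p p Om u g, VLp p Om g,
    (fun k => \int[mu]_(x in Om) phi_ k x) @ \oo --> \int[mu]_(x in Om) u x &
    (fun k => energy (fun x => grad (phi_ k) x - g x)) @ \oo --> 0].
Proof.
move=> tphi cauchy.
have [C C0 hC] := poincare p1 bOm i0.
have Lphi k := test_Lp_fun p1 mOm (tphi k).
have Vphi k := VLp_grad p1 mOm (tphi k).
have Vd k l := VLp_grad p1 mOm (test_subtract (tphi k) (tphi l)).1.
have gradE k l i : (fun x => grad (fun x => phi_ k x - phi_ l x) x ord0 i) =
    (fun x => partial i (phi_ k) x - partial i (phi_ l) x).
  by rewrite (test_subtract (tphi k) (tphi l)).2; apply/funext => x; rewrite !mxE.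
have [u Lu cu] : exists2 u, Lp_fun mu Om p u &
    (fun k => \int[mu]_(x in Om) (`|phi_ k x - u x| `^ p)) @ \oo --> 0.
  apply: (Lp_complete mOm p1 Omfin Lphi) => e e0.
  have C1 : 0 < C + 1 by rewrite ltr_wpDl.
  have [N hN] := cauchy (e / (C + 1)) (divr_gt0 e0 C1).
  exists N => k l Nk Nl; apply: (le_trans (hC _ (test_subtract (tphi k) (tphi l)).1)).
  have h1 := coord_le_energy i0 p1 qE mOm i0 (Vd k l).
  have {}h1 := le_trans h1 (hN k l Nk Nl).
  apply: (@le_trans _ _ ((C + 1) * (e / (C + 1)))); last by rewrite mulrC divfK// gt_eqF.
  apply: (ler_pM C0); [by apply: Rintegral_ge0 => x _; exact: powR_ge0|by rewrite lerDl|].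
  apply: le_trans h1; rewrite le_eqVlt; apply/orP; left; apply/eqP.
  by apply: eq_Rintegral => x _; rewrite mxE.
have /choice[g0 Hg] : forall i, exists gi, Lp_fun mu Om p gi /\
    (fun k => \int[mu]_(x in Om) (`|partial i (phi_ k) x - gi x| `^ p)) @ \oo --> 0.
  move=> i.
  have Li k : Lp_fun mu Om p (partial i (phi_ k)).
    exact: (test_Lp_fun p1 mOm (test_partial i (tphi k))).
  have [|gi] := Lp_complete mOm p1 Omfin Li; last by exists gi.
  move=> e e0; have [N hN] := cauchy e e0.
  exists N => k l Nk Nl; have := coord_le_energy i0 p1 qE mOm i (Vd k l).
  move=> /le_trans /(_ (hN k l Nk Nl)); apply: le_trans.
  rewrite le_eqVlt; apply/orP; left; apply/eqP.
  by apply: eq_Rintegral => x _; rewrite (congr1 (fun f => f x) (gradE k l i)).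
pose g : 'rV[R]_n -> 'rV[R]_n := fun x => \row_i g0 i x.
have gE i : (fun x => g x ord0 i) = g0 i by apply/funext => x; rewrite mxE.
have Vg : VLp p Om g by move=> i; rewrite gE; exact: (Hg i).1.
have Lpar i k : Lp_fun mu Om p (partial i (phi_ k)).
  exact: (test_Lp_fun p1 mOm (test_partial i (tphi k))).
exists u, g; split; [|exact: Vg| |].
- split; [split|].
  + exact/(in_LfunP mu mOm p1 u).
  + by move=> i; apply/(in_LfunP mu mOm p1 _); exact: Vg.
  + move=> psi tpsi i.
    have tpi := test_partial i tpsi.
    have h1 := Rintegral_mul_test_cvg p1 qE mOm bOm Lphi Lu tpi cu.
    have h2 := Rintegral_mul_test_cvg p1 qE mOm bOm (Lpar i) (Hg i).1 tpsi (Hg i).2.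
    rewrite (_ : \int[mu]_(x in Om) (g x ord0 i * psi x) = \int[mu]_(x in Om) (g0 i x * psi x)); last first.
      by apply: eq_Rintegral => x _; rewrite mxE.
    have h3 : (fun k => \int[mu]_(x in Om) (phi_ k x * partial i psi x)) @ \oo -->
        - \int[mu]_(x in Om) (g0 i x * psi x).
      rewrite (_ : (fun k => _) = (fun k => - \int[mu]_(x in Om) (partial i (phi_ k) x * psi x))).
        exact: (cvgN h2).
      by apply/funext => k; apply: (Rintegral_test_partialM _ tpsi); case: (tphi k).
    exact: (cvg_unique _ h1 h3).
  + exists phi_; split; [exact: tphi| |].
    * by apply/(Lnorm_cvgP mOm p1 (f_ := fun k => (phi_ k \- u)%R)) => // k; exact: Lp_funB.
    * move=> i; rewrite gE.
      by apply/(Lnorm_cvgP mOm p1 (f_ := fun k => (partial i (phi_ k) \- g0 i)%R)) => [k|]; [apply: Lp_funB => //; exact: (Hg i).1|exact: (Hg i).2].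
- exact: (Rintegral_Lp_cvg p1 qE mOm bOm Lphi Lu cu).
- apply: (energy_cvg0 i0 p1 qE mOm) => [k|i]; first exact: VLpB.
  rewrite (_ : (fun k => _) = (fun k => \int[mu]_(x in Om) (`|partial i (phi_ k) x - g0 i x| `^ p))).
    exact: (Hg i).2.
  by apply/funext => k; apply: eq_Rintegral => x _; rewrite !mxE.
Qed.

(** The functional is defined on test functions but the minimizer is not one. Hence minimality is
    used as [m <= J (phi_ k + t psi)], with [k] going to infinity first and [t] to 0 afterwards. *)
Lemma torsion_solution_exists : exists u, torsion_solution p Om u.
Proof.
have [m [hm [phi_ hphi]]] := torsion_energy_inf.
have tphi k := (hphi k).1.
have [u [g [Wg Vg cu cg]]] := minimizing_limit tphi (minimizing_cauchy hm hphi).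
have Vphi k := VLp_grad p1 mOm (tphi k).
exists u, g => //.
have cJ : (fun k => J (phi_ k)) @ \oo --> energy g / p - \int[mu]_(x in Om) u x.
  apply: cvgB => //; apply: cvgMr_tmp; exact: (energy_cvg i0 p1 qE mOm Vphi Vg cg).
have Jle : energy g / p - \int[mu]_(x in Om) u x <= m.
  have hc : (fun k => m + k.+1%:R^-1) @ \oo --> m.
    by have := cvgD (cvg_cst m) (@cvg_harmonic R); rewrite addr0; exact.
  by apply: (ler_cvg_to cJ hc); apply: nearW => k; exact: (hphi k).2.
have key psi : test_function Om psi ->
    \int[mu]_(x in Om) psi x <= \int[mu]_(x in Om) flux p (g x) (grad psi x).
  move=> tpsi; have Vpsi := VLp_grad p1 mOm tpsi.
  have iphi k := integrableS measurableT mOm (@subsetT _ Om) (test_integrable (tphi k)).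
  have ipsi := integrableS measurableT mOm (@subsetT _ Om) (test_integrable tpsi).
  have Vt (t : R) := VLpD p1 mOm Vg (VLpZ mOm t Vpsi).
  have step (t : R) : 0 < t -> \int[mu]_(x in Om) psi x <=
      \int[mu]_(x in Om) flux p (g x + t *: grad psi x) (grad psi x).
    move=> t0.
    have tk k := testD (tphi k) (testZ t tpsi).
    have gk k := grad_test t (tphi k) tpsi.
    have ck : (fun k => energy (fun x => grad (phi_ k) x + t *: grad psi x)) @ \oo -->
        energy (fun x => g x + t *: grad psi x).
      apply: (energy_cvg i0 p1 qE mOm) => [k|//|].
        exact: (VLpD p1 mOm (Vphi k) (VLpZ mOm t Vpsi)).
      have E : (fun k => energy (fun x => (grad (phi_ k) x + t *: grad psi x) -
          (g x + t *: grad psi x))) = (fun k => energy (fun x => grad (phi_ k) x - g x)).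
        by apply/funext => k; apply: eq_Rintegral => x _; rewrite opprD addrACA subrr addr0.
      by rewrite E; exact: cg.
    have cJt : (fun k => energy (fun x => grad (phi_ k) x + t *: grad psi x) / p -
          (\int[mu]_(x in Om) phi_ k x + t * \int[mu]_(x in Om) psi x)) @ \oo -->
        energy (fun x => g x + t *: grad psi x) / p -
          (\int[mu]_(x in Om) u x + t * \int[mu]_(x in Om) psi x).
      apply: cvgB; first exact: cvgMr_tmp.
      by apply: cvgD; [exact: cu|exact: cvg_cst].
    have mle : m <= energy (fun x => g x + t *: grad psi x) / p -
        (\int[mu]_(x in Om) u x + t * \int[mu]_(x in Om) psi x).
      apply: (cvgr_to_ge cJt); apply: nearW => k.
      have := hm _ (tk k); rewrite /torsion_energy gk.
      rewrite (RintegralD mOm (iphi k) (integrable_scaler mOm t ipsi)).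
      by rewrite (RintegralZl t mOm ipsi).
    have [ifl _] := flux_hoelder i0 p1 qE mOm (Vt t) Vpsi.
    have ig := integrable_energy i0 p1 qE mOm Vg.
    have igt := integrable_energy i0 p1 qE mOm (Vt t).
    (* The tangent is taken at the perturbed field, which is the end where convexity bounds the
       increment from above. Dividing by [t] then leaves an inequality without remainder. *)
    have tang : energy (fun x => g x + t *: grad psi x) - energy g <=
        p * t * \int[mu]_(x in Om) flux p (g x + t *: grad psi x) (grad psi x).
      rewrite -(RintegralB mOm igt ig) -(RintegralZl (p * t) mOm ifl).
      apply: (le_Rintegral mOm (integrable_subr mOm igt ig) (integrable_scaler mOm (p * t) ifl)) => x _.
      apply: (le_trans (flux_tangent p1 qE _ _)).
      by rewrite [g x + _ - _]addrAC subrr add0r fluxZ mulrA.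
    exact: (variation_arith p0 t0 (le_trans Jle mle) tang).
  have [_ cfl] : mu.-integrable Om (EFin \o (fun x => flux p (g x) (grad psi x))) /\
     (fun k => \int[mu]_(x in Om) flux p (g x + k.+1%:R^-1 *: grad psi x) (grad psi x)) @ \oo -->
     \int[mu]_(x in Om) flux p (g x) (grad psi x).
    have iG := integrable_energy i0 p1 qE mOm Vg.
    have iP := integrable_energy i0 p1 qE mOm Vpsi.
    apply: (Rintegral_dct mOm _ _ (integrable_addr mOm (integrable_scaler mOm (2 `^ p) (integrable_addr mOm iG iP)) iP)).
    + by move=> k; exact: measurable_flux.
    + by move=> x _; exact: flux_cvg.
    + move=> k x _; exact: flux_step_le.
  by apply: (cvgr_to_ge cfl); apply: nearW => k; apply: step; rewrite invr_gt0.
move=> psi tpsi; apply/eqP; rewrite eq_le; apply/andP; split; last exact: key.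
have [ifl _] := flux_hoelder i0 p1 qE mOm Vg (VLp_grad p1 mOm tpsi).
have ipsi := integrableS measurableT mOm (@subsetT _ Om) (test_integrable tpsi).
(* The opposite inequality comes from testing with [- psi]. *)
have [tN gN] := test_subtract (test0 Om) tpsi.
have := key _ tN.
rewrite (_ : \int[mu]_(x in Om) (0 - psi x) = - \int[mu]_(x in Om) psi x); last first.
  rewrite -mulN1r -(RintegralZl (-1) mOm ipsi).
  by apply: eq_Rintegral => x _; rewrite sub0r mulN1r.
rewrite (_ : Rintegral _ _ (fun x => flux _ _ _) = - \int[mu]_(x in Om) flux p (g x) (grad psi x)).
  by rewrite lerN2.
rewrite -mulN1r -(RintegralZl (-1) mOm ifl).
apply: eq_Rintegral => x _; rewrite gN fluxD fluxN mulN1r.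
have -> : grad (fun=> 0) x = 0; last by rewrite /flux dotrVC dotrV0l mulr0 add0r.
by apply/rowP => i; rewrite !mxE (partial_cst 0 i).
Qed.
End torsion_existence2.

(** * Upper bound by the inradius *)

Section ray_height.
Context {R : realType} {n : nat}.
Local Notation mu := (@lebesgue_rV R n).
Variables (A : set 'rV[R]_n) (v : 'rV[R]_n) (r : R).
Hypotheses (mA : measurable A) (bA : bounded_set A)
  (segA : forall y (t h : R), 0 <= t -> t <= h -> A y -> A (y + h *: v) -> A (y + t *: v))
  (heightA : forall y (h : R), 0 <= h -> A y -> A (y + h *: v) -> h <= r).
Implicit Types (f : 'rV[R]_n -> R) (y w : 'rV[R]_n).

Lemma measurable_setI_shift w : measurable (A `&` [set y | A (y + w)]).
Proof.
apply: measurableI => //; rewrite -[X in measurable X]setTI.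
exact: (measurable_shift w).
Qed.

Lemma measurable_patch_shift f w : measurable_fun A f ->
  measurable_fun setT (fun y => (f \_ A) (y + w)).
Proof.
move=> mf; have mp := (measurable_restrictT f mA).1 mf.
exact: (measurableT_comp mp (measurable_shift w)).
Qed.

Lemma Rintegral_patch_shift f w : measurable_fun A f ->
  \int[mu]_y ((f \_ A) (y + w)) = \int[mu]_(y in A) f y.
Proof.
move=> mf; rewrite [RHS]Rintegral_mkcond; apply: Rintegral_shift.
exact/(measurable_restrictT f mA).
Qed.

Lemma patch_shift_le f w (M : R) : (forall y, A y -> `|f y| <= M) -> 0 <= M ->
  forall y, `|(f \_ A) (y + w)| <= M.
Proof.
move=> fM M0 y; rewrite /patch; case: ifPn => [|_]; last by rewrite normr0.
by rewrite inE => /fM.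
Qed.

(** The shift could only lose the mass of [f] at points of [A] reached from outside, where [f]
    vanishes. *)
Lemma Rintegral_shift_in f w : measurable_fun A f ->
  (forall y, A y -> ~ A (y - w) -> f y = 0) ->
  \int[mu]_(y in A) f y = \int[mu]_(y in A) ((f \_ A) (y + w)).
Proof.
move=> mf f0; rewrite -(Rintegral_patch_shift w mf) [RHS]Rintegral_mkcond.
apply: eq_Rintegral => y _; rewrite [in RHS]/patch; case: ifPn => // /negP nAy.
rewrite /patch; case: ifPn => //; rewrite inE => Ayw; apply: f0 => //.
by rewrite addrK => Ay; apply: nAy; rewrite inE.
Qed.

Lemma Rintegral_shift_ge0_le f w (M : R) : measurable_fun A f ->
  (forall y, A y -> 0 <= f y) -> (forall y, A y -> f y <= M) ->
  \int[mu]_(y in A) ((f \_ A) (y + w)) <= \int[mu]_(y in A) f y.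
Proof.
move=> mf f0 fM; rewrite -[leRHS](Rintegral_patch_shift w mf) [leLHS]Rintegral_mkcond.
have M1 y : A y -> `|f y| <= `|M|.
  by move=> Ay; rewrite ger0_norm ?f0// (le_trans (fM y Ay))// ler_norm.
have ms := measurable_patch_shift w mf.
have ip : mu.-integrable setT (EFin \o (fun y => (f \_ A) (y + w))).
  have : mu.-integrable A (EFin \o f) by exact: (bounded_integrable mA bA mf M1).
  move=> /(integrable_mkcond _ mA); rewrite restrict_EFin => h.
  exact: (integrable_shift w h).
have p0 y : 0 <= (f \_ A) (y + w).
  by rewrite /patch; case: ifPn => //; rewrite inE => /f0.
apply: le_Rintegral => //.
  apply: (integrable_dominated measurableT _ ip).
    apply/(measurable_restrictT (fun y => (f \_ A) (y + w)) mA).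
    exact: measurable_funS ms.
  by move=> y _; rewrite [X in `|X|]/patch; case: ifPn => _; rewrite ?normr0// ger0_norm.
by move=> y _; rewrite [leLHS]/patch; case: ifPn.
Qed.

(** The length, in multiples of [v], from [y] to the far end of its segment in [A]: the function m
    of the overview. *)
Definition ray_height y : R := sup [set h | 0 <= h /\ A (y + h *: v)].
Local Notation m := ray_height.

Let m_ubound y : A y -> ubound [set h | 0 <= h /\ A (y + h *: v)] r.
Proof. by move=> Ay h [h0 Ah]; exact: (heightA h0 Ay Ah). Qed.

Lemma ray_height_ge y h : A y -> 0 <= h -> A (y + h *: v) -> h <= m y.
Proof.
by move=> Ay h0 Ah; apply: ub_le_sup => //; exists r; exact: m_ubound.
Qed.

Lemma ray_height_ge0 y : A y -> 0 <= m y.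
Proof. by move=> Ay; apply: ray_height_ge => //; rewrite scale0r addr0. Qed.

Lemma ray_height_le y : A y -> m y <= r.
Proof.
move=> Ay; apply: ge_sup; last exact: m_ubound.
by exists 0; rewrite /= scale0r addr0.
Qed.

Lemma ray_height_in y h : A y -> 0 <= h -> h < m y -> A (y + h *: v).
Proof.
move=> Ay h0 hm; have hd : 0 < m y - h by rewrite subr_gt0.
have [|h' [h'0 Ah'] ] := sup_adherent hd (E := [set h | 0 <= h /\ A (y + h *: v)]).
  split; last by exists r; exact: m_ubound.
  by exists 0; rewrite /= scale0r addr0.
by rewrite subKr => /ltW hh'; exact: (segA h0 hh' Ay Ah').
Qed.

Lemma ray_height_shift y h : A y -> 0 <= h -> A (y + h *: v) ->
  m (y + h *: v) = m y - h.
Proof.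
move=> Ay h0 Ah; apply/eqP; rewrite eq_le; apply/andP; split.
  apply: ge_sup; first by exists 0; rewrite /= scale0r addr0.
  move=> t [t0]; rewrite /= -addrA -scalerDl => Aht.
  by rewrite lerBrDl; apply: ray_height_ge => //; rewrite addr_ge0.
rewrite lerBlDr; apply/ler_addgt0Pr => e e0.
have [hm|] := leP (m y) h.
  by rewrite (le_trans hm)// -addrA addrCA lerDl addr_ge0// ?(ltW e0)// ray_height_ge0.
move=> hm.
set t := Num.max h (m y - e / 2).
have tm : t < m y by rewrite gt_max hm/= ltrBlDr ltrDl divr_gt0.
have th : h <= t by rewrite le_max lexx.
have t0 : 0 <= t by exact: le_trans th.
have At := ray_height_in Ay t0 tm.
have : t - h <= m (y + h *: v).
  apply: ray_height_ge => //; first by rewrite subr_ge0.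
  by rewrite -addrA -scalerDl [h + _]addrC subrK.
have : m y - e / 2 <= t by rewrite le_max lexx orbT.
lra.
Qed.

(** As sections are segments, the height exceeds [t] exactly when [y + h v] is in [A] for some
    rational [h > t]. Truncation at 0 keeps the steps nonnegative, and [k = 0] covers negative
    [t]. *)
Lemma measurable_ray_height : measurable_fun A m.
Proof.
apply: (measurability _ (RGenOInfty.measurableE R)) => //.
move=> _ [_ [t ->] <-].
rewrite (_ : A `&` _ = \bigcup_(k : rat) (if t < Num.max 0 (ratr k)
   then A `&` [set y | A (y + Num.max 0 (ratr k) *: v)] else set0)).
  by apply: countable_bigcupT_measurable => // k; case: ifPn => // _; exact: measurable_setI_shift.
apply/seteqP; split => [y [Ay]|y [k _]].
  rewrite /= in_itv/= andbT => tm.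
  have [t0|t0] := ltP t 0.
    by exists 0 => //; rewrite rmorph0 maxxx t0/=; split => //=; rewrite scale0r addr0.
  have [k] := rat_in_itvoo tm; rewrite in_itv/= => /andP[tk km].
  have k0 : 0 <= ratr k :> R by exact: (le_trans t0 (ltW tk)).
  exists k => //; rewrite max_r// tk; split => //=.
  exact: ray_height_in.
case: ifPn => // tk [Ay /= Ak]; split => //=; rewrite in_itv/= andbT.
apply: (lt_le_trans tk); apply: ray_height_ge => //.
by rewrite le_max lexx.
Qed.

Local Notation mh h y := (Num.max 0 (m y - h)).

Lemma ray_height_max_in y h : A y -> 0 <= h -> A (y + h *: v) -> mh h y = m (y + h *: v).
Proof.
move=> Ay h0 Ah; rewrite (ray_height_shift Ay h0 Ah) max_r// subr_ge0.
exact: ray_height_ge.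
Qed.

Lemma ray_height_max_out y h : A y -> 0 <= h -> ~ A (y + h *: v) -> mh h y = 0.
Proof.
move=> Ay h0 nAh; rewrite max_l// subr_le0 leNgt; apply/negP => hm.
by apply: nAh; exact: ray_height_in.
Qed.

(** With [G 0 = 0], leaving [A] and having height 0 cannot be distinguished. The shifted extension
    by zero is thus a function of the truncated height alone. *)
Lemma ray_height_max_patch (G : R -> R) y h : G 0 = 0 -> A y -> 0 <= h ->
  ((G \o m) \_ A) (y + h *: v) = G (mh h y).
Proof.
move=> G0 Ay h0; rewrite /patch; case: ifPn => [|/negP nA].
  by rewrite inE => Ah; rewrite /= (ray_height_max_in Ay h0 Ah).
by rewrite (ray_height_max_out Ay h0)// => Ah; apply: nA; rewrite inE.
Qed.

Lemma ray_height_maxP y h : A y -> 0 <= h -> 0 <= mh h y /\ m y - h <= mh h y /\ mh h y <= m y.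
Proof.
move=> Ay h0; split; first by rewrite le_max lexx.
split; first by rewrite le_max lexx orbT.
by rewrite ge_max ray_height_ge0// gerBl.
Qed.

Lemma ray_height_max_cvg y : A y -> (fun k => mh k.+1%:R^-1 y) @ \oo --> m y.
Proof.
move=> Ay; apply: (@squeeze_cvgr _ _ _ _ (fun k => m y - k.+1%:R^-1) (cst (m y)) _ _ _ _ (cvg_cst _)).
  apply: nearW => k; have k0 : (0 : R) <= k.+1%:R^-1 by rewrite invr_ge0.
  by have [_ [-> ->] ] := ray_height_maxP Ay k0.
have := cvgB (cvg_cst (m y)) (@cvg_harmonic R); rewrite subr0; exact.
Qed.

Lemma measurable_ray_height_max h : measurable_fun A (fun y => mh h y).
Proof.
apply: measurable_maxr; first exact: measurable_cst.
by apply: measurable_funB; [exact: measurable_ray_height|exact: measurable_cst].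
Qed.

End ray_height.

Lemma harmonic_lt (R : realType) (e : R) : 0 < e -> \forall k \near \oo, (k.+1%:R^-1 : R) < e.
Proof. by move=> e0; exact: (cvgr_lt _ (@cvg_harmonic R) _ e0). Qed.

(** Concavity of G(t) = r^q t - t^(q+1), with the tangent at the smaller point [b]. If the step
    overshoots, then [b = 0] and r^q h still dominates. *)
Lemma ray_gap_arith (R : realType) (r q a b h : R) : 0 < q -> 0 <= a -> 0 <= h ->
  b = Num.max 0 (a - h) ->
  (r `^ q * a - a `^ (q + 1)) - (r `^ q * b - b `^ (q + 1)) <=
  h * (r `^ q - (q + 1) * b `^ q).
Proof.
move=> q0 a0 h0 bE.
have b0 : 0 <= b by rewrite bE le_max lexx.
have q1 : 1 < q + 1 by rewrite ltrDr.
have h1 := powR_tangent q1 erefl a0 b0; rewrite addrK in h1.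
have rq : 0 <= r `^ q by exact: powR_ge0.
have aq : 0 <= a `^ (q + 1) by exact: powR_ge0.
have [ah|ha] := leP (a - h) 0.
  have -> : b = 0 by rewrite bE max_l.
  have z1 : (0 : R) `^ q = 0 by rewrite powR0// gt_eqF.
  have z2 : (0 : R) `^ (q + 1) = 0 by rewrite powR0// gt_eqF// addr_gt0.
  rewrite z1 z2.
  have : r `^ q * a <= r `^ q * h by rewrite ler_wpM2l// -subr_le0.
  lra.
have bh : a = b + h by rewrite bE max_r ?subrK// ltW.
rewrite bh in h1 aq *; rewrite opprD addrA subrr add0r in h1.
lra.
Qed.

Section ray_integrals.
Context {R : realType} {n : nat}.
Local Notation mu := (@lebesgue_rV R n).
Variables (A : set 'rV[R]_n) (v : 'rV[R]_n) (r : R).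
Hypotheses (mA : measurable A) (bA : bounded_set A) (r0 : 0 <= r)
  (segA : forall y (t h : R), 0 <= t -> t <= h -> A y -> A (y + h *: v) -> A (y + t *: v))
  (heightA : forall y (h : R), 0 <= h -> A y -> A (y + h *: v) -> h <= r).
Local Notation m := (ray_height A v).
Local Notation mh h y := (Num.max 0 (m y - h)).

Let mm : measurable_fun A m. Proof. exact: measurable_ray_height mA segA heightA. Qed.
Let mmax h : measurable_fun A (fun y => mh h y).
Proof. exact: measurable_ray_height_max mA segA heightA h. Qed.
Let maxP y (h : R) (Ay : A y) (h0 : 0 <= h) := ray_height_maxP heightA Ay h0.
Let m0 y (Ay : A y) := ray_height_ge0 heightA Ay.
Let mr y (Ay : A y) := ray_height_le heightA Ay.

(** On a segment of length l <= r the claim is that G' = r^q - (q+1) t^q has integral G(l) >= 0. In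
    place of integrating along segments, a shift by [h v] can only lose mass of the nonnegative
    function [G \o m]; by concavity the loss per unit step is bounded by the integral of G' at the
    truncated heights, and [h] tends to 0. *)
Lemma Rintegral_ray_height_le (q : R) : 1 < q ->
  \int[mu]_(y in A) (m y `^ q) <= r `^ q / (q + 1) * volume A.
Proof.
move=> q1; have q0 : 0 < q by exact: lt_trans q1.
pose G (t : R) := r `^ q * t - t `^ (q + 1).
have G0 : G 0 = 0 by rewrite /G mulr0 powR0 ?subrr// gt_eqF// addr_gt0.
have qp1 : 0 < q + 1 by rewrite addr_gt0.
have Gge0 (t : R) : 0 <= t -> t <= r -> 0 <= G t.
  move=> t0 tr; rewrite /G -(mulr_powRB1 t0 qp1) addrK mulrC -mulrBr.
  by rewrite mulr_ge0// subr_ge0 le_powR// ltW.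
have Gle (t : R) : 0 <= t -> t <= r -> G t <= r `^ q * r.
  move=> t0 tr; rewrite /G lerBlDr (le_trans (ler_wpM2l (powR_ge0 r q) tr))// lerDl powR_ge0//.
have mG (f : 'rV[R]_n -> R) : measurable_fun A f -> measurable_fun A (G \o f).
  move=> mf; apply: measurable_funB; first by apply: measurable_funM => //; exact: measurable_cst.
  exact: (measurableT_comp (measurable_powR (q + 1)) mf).
have mpow (f : 'rV[R]_n -> R) : measurable_fun A f -> measurable_fun A (fun y => f y `^ q).
  by move=> mf; exact: (measurableT_comp (measurable_powR q) mf).
have step (h : R) : 0 < h ->
    \int[mu]_(y in A) (mh h y `^ q) <= r `^ q / (q + 1) * volume A.
  move=> h0.
  have h0' := ltW h0.
  have le1 := Rintegral_shift_ge0_le mA bA (h *: v) (mG _ mm)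
    (fun y Ay => Gge0 _ (m0 Ay) (mr Ay)) (fun y Ay => Gle _ (m0 Ay) (mr Ay)).
  have E : \int[mu]_(y in A) (((G \o m) \_ A) (y + h *: v)) = \int[mu]_(y in A) G (mh h y).
    apply: eq_Rintegral => y; rewrite inE => Ay.
    exact: (ray_height_max_patch segA heightA G0 Ay h0').
  rewrite {}E in le1.
  have iG (f : 'rV[R]_n -> R) : measurable_fun A f -> (forall y, A y -> 0 <= f y /\ f y <= r) ->
      mu.-integrable A (EFin \o (G \o f)).
    move=> mf hf; apply: (bounded_integrable (M := r `^ q * r) mA bA (mG _ mf)) => y Ay.
    by have [f0 fr] := hf y Ay; rewrite ger0_norm ?Gge0// Gle.
  have i1 := iG _ mm (fun y Ay => conj (m0 Ay) (mr Ay)).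
  have hmax y : A y -> 0 <= mh h y /\ mh h y <= r.
    by move=> Ay; have [b0 [_ bm] ] := maxP Ay h0'; split => //; exact: (le_trans bm (mr Ay)).
  have i2 := iG _ (mmax h) hmax.
  have i3 : mu.-integrable A (EFin \o (fun y => mh h y `^ q)).
    apply: (bounded_integrable (M := r `^ q) mA bA (mpow _ (mmax h))) => y Ay.
    by have [b0 br] := hmax y Ay; rewrite ger0_norm ?powR_ge0// le_powR// ltW.
  have ic : mu.-integrable A (EFin \o (fun=> r `^ q)).
    apply: (bounded_integrable (M := r `^ q) mA bA (measurable_cst _)) => y Ay.
    by rewrite ger0_norm ?powR_ge0.
  have i4 := integrable_scaler mA (q + 1) i3.
  have i5 := integrable_subr mA ic i4.
  have : 0 <= \int[mu]_(y in A) (h * (r `^ q - (q + 1) * mh h y `^ q)).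
    rewrite -subr_ge0 -(RintegralB mA i1 i2) in le1.
    apply: (le_trans le1); apply: (le_Rintegral mA (integrable_subr mA i1 i2) (integrable_scaler mA h i5)).
    by move=> y Ay; exact: (ray_gap_arith r q0 (m0 Ay) h0' erefl).
  rewrite (RintegralZl h mA i5) pmulr_rge0// (RintegralB mA ic i4).
  rewrite (RintegralZl (q + 1) mA i3) Rintegral_cst// subr_ge0 -/(volume A).
  by rewrite mulrAC ler_pdivlMr// mulrC.
have hc : (fun k => \int[mu]_(y in A) (mh k.+1%:R^-1 y `^ q)) @ \oo --> \int[mu]_(y in A) (m y `^ q).
  have ic : mu.-integrable A (EFin \o (fun=> r `^ q)).
    apply: (bounded_integrable (M := r `^ q) mA bA (measurable_cst _)) => y Ay.
    by rewrite ger0_norm ?powR_ge0.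
  apply: (Rintegral_dct mA _ _ ic _).2.
  - by move=> k; exact: mpow.
  - move=> y Ay; have := normr_powR_cvg q1 (ray_height_max_cvg heightA Ay).
    rewrite (ger0_norm (m0 Ay)); apply: cvg_trans; apply: near_eq_cvg; apply: nearW => k.
    by rewrite ger0_norm// le_max lexx.
  - move=> k y Ay; have k0 : (0 : R) <= k.+1%:R^-1 by rewrite invr_ge0.
    have [b0 [_ bm] ] := maxP Ay k0.
    by rewrite ger0_norm ?powR_ge0// le_powR ?(ltW q0)// (le_trans bm (mr Ay)).
by apply: (cvgr_to_le hc); apply: nearW => k; apply: step; rewrite invr_gt0.
Qed.

(** Integration by parts along [v]: m decreases at unit rate, [phi] vanishes near the entrance of
    each segment and m at its exit, so there are no boundary terms. The product [m * phi] keeps its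
    integral under small shifts, and its difference quotient tends to the difference of the two
    integrands. *)
Lemma Rintegral_ray (Om : set 'rV[R]_n) phi (h0 : R) : test_function Om phi -> 0 < h0 ->
  (forall y (h : R), A y -> 0 < h -> h < h0 -> ~ A (y - h *: v) -> phi y = 0) ->
  \int[mu]_(y in A) phi y = \int[mu]_(y in A) (m y * dotrV v (grad phi y)).
Proof.
move=> tphi h0p out.
have [M M0 bM] := test_bounded tphi.
have mphi : measurable_fun A phi by exact: measurable_funS (test_measurable tphi).
have [c [N [c0 bc] ] ] := quotient_bounded v tphi.
have {N}bc (k : nat) x : `|k.+1%:R * (phi (x + k.+1%:R^-1 *: v) - phi x)| <= c.
  by apply: (le_trans (bc k x)); rewrite indicE ler_piMr// lern1 leq_b1.
have hk0 k : (0 : R) < k.+1%:R^-1 by rewrite invr_gt0.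
have hksmall : \forall k \near \oo, (k.+1%:R^-1 : R) < h0.
  exact: harmonic_lt.
have outk k : (k.+1%:R^-1 : R) < h0 -> forall y, A y -> ~ A (y - k.+1%:R^-1 *: v) -> phi y = 0.
  by move=> kh y Ay nA; exact: (out y _ Ay (hk0 k) kh nA).
have mfS (k : nat) : measurable_fun A (fun y => phi (y + k.+1%:R^-1 *: v)).
  apply: measurable_funS (measurableT_comp (test_measurable tphi) (measurable_shift (k.+1%:R^-1 *: v))) => //.
have iphi : mu.-integrable A (EFin \o phi) by apply: (bounded_integrable (M := M)).
(* The indicator of positive height. At height 0 the quotient of the truncated height is 0 and not
   1, so the limit contains [D * phi], and these exit points have to be shown negligible. *)
pose D y : R := if m y == 0 then 0 else 1.
have mE0 : measurable_fun A (fun y => m y == 0).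
  by apply: measurable_fun_eqr => //; exact: measurable_cst.
have mD : measurable_fun A D by apply: measurable_fun_if => //; exact: measurable_cst.
(* For a small shift a point of positive height still has positive height, and a point of height 0
   has left [A]. So the shifted copies of [(1 - D) * phi] tend to 0 pointwise, while their integrals
   do not change. *)
have Z : \int[mu]_(y in A) ((1 - D y) * phi y) = 0.
  pose F y : R := (1 - D y) * phi y.
  have mF : measurable_fun A F.
    by apply: measurable_funM => //; apply: measurable_funB => //; exact: measurable_cst.
  have FM y : `|F y| <= M.
    rewrite /F normrM -[leRHS]mul1r ler_pM// /D; case: ifP => _; rewrite ?subr0 ?subrr ?normr1 ?normr0//.
  have cF : (fun k => \int[mu]_(y in A) ((F \_ A) (y + k.+1%:R^-1 *: v))) @ \oo --> \int[mu]_(y in A) (cst 0 y : R).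
    have ic : mu.-integrable A (EFin \o (fun=> M)).
      by apply: (bounded_integrable (M := M) mA bA (measurable_cst _)) => y _; rewrite ger0_norm.
    apply: (Rintegral_dct mA _ _ ic _).2.
    - by move=> k; apply: measurable_funS (measurable_patch_shift mA (k.+1%:R^-1 *: v) mF).
    - move=> y Ay; apply: cvg_near_cst.
      have [my0|my0] := eqVneq (m y) 0.
        apply: nearW => k; rewrite /patch; case: ifPn => //; rewrite inE => Ak.
        have := ray_height_ge heightA Ay (ltW (hk0 k)) Ak.
        by rewrite my0 leNgt hk0.
      have myp : 0 < m y by rewrite lt_neqAle eq_sym my0 m0.
      have : \forall k \near \oo, (k.+1%:R^-1 : R) < m y by exact: harmonic_lt.
      apply: filterS => k km; rewrite /patch; case: ifPn => //; rewrite inE => Ak.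
      rewrite /F /D (ray_height_shift segA heightA Ay (ltW (hk0 k)) Ak) subr_eq0 gt_eqF//.
      by rewrite subrr mul0r.
    - by move=> k y Ay; apply: patch_shift_le M0 _ => z _; exact: FM.
  have cF' : (fun k => \int[mu]_(y in A) ((F \_ A) (y + k.+1%:R^-1 *: v))) @ \oo --> \int[mu]_(y in A) F y.
    apply: cvg_near_cst; apply: filterS hksmall => k kh.
    rewrite -(Rintegral_shift_in mA mF)// => y Ay nA.
    by rewrite /F (outk k kh y Ay nA) mulr0.
  have -> : \int[mu]_(y in A) ((1 - D y) * phi y) = \int[mu]_(y in A) (cst 0 y : R).
    exact: (cvg_unique _ cF' cF).
  by rewrite Rintegral_cst// mul0r.
have iDphi : mu.-integrable A (EFin \o (fun y => D y * phi y)).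
  apply: (bounded_integrable (M := M) mA bA); first exact: measurable_funM.
  move=> y _; rewrite normrM -[leRHS]mul1r ler_pM// /D; case: ifP => _; rewrite ?normr1 ?normr0//.
have key : mu.-integrable A (EFin \o (fun y => m y * dotrV v (grad phi y) - D y * phi y)) /\
  (fun k => \int[mu]_(y in A)
     (mh k.+1%:R^-1 y * (k.+1%:R * (phi (y + k.+1%:R^-1 *: v) - phi y)) -
      k.+1%:R * (m y - mh k.+1%:R^-1 y) * phi y)) @ \oo -->
  \int[mu]_(y in A) (m y * dotrV v (grad phi y) - D y * phi y).
  have ic : mu.-integrable A (EFin \o (fun=> r * c + M)).
    have rcM : 0 <= r * c + M by rewrite addr_ge0// mulr_ge0.
    by apply: (bounded_integrable (M := r * c + M) mA bA (measurable_cst _)) => y _; rewrite ger0_norm.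
  apply: (Rintegral_dct mA _ _ ic _).
  - move=> k; apply: measurable_funB; apply: measurable_funM => //.
    + by apply: measurable_funM; [exact: measurable_cst|exact: measurable_funB].
    + by apply: measurable_funM; [exact: measurable_cst|exact: measurable_funB].
  - move=> y Ay; apply: cvgB; apply: cvgM.
    + exact: (ray_height_max_cvg heightA Ay).
    + by apply: smooth_quotient_cvg; case: tphi.
    + apply: cvg_near_cst; rewrite /D; case: eqVneq => [my0|my0].
        apply: nearW => k; rewrite my0 max_l ?subrr ?mulr0//.
      have myp : 0 < m y by rewrite lt_neqAle eq_sym my0 m0.
      have : \forall k \near \oo, (k.+1%:R^-1 : R) < m y by exact: harmonic_lt.
      apply: filterS => k km; rewrite max_r; last by rewrite subr_ge0 ltW.
      by rewrite subKr mulfV.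
    + exact: cvg_cst.
  - move=> k y Ay; have [b0 [mb bm] ] := maxP Ay (ltW (hk0 k)).
    apply: (le_trans (ler_normB _ _)); apply: lerD; rewrite normrM.
      by apply: ler_pM => //; rewrite ger0_norm// (le_trans bm (mr Ay)).
    rewrite -[leRHS]mul1r; apply: ler_pM => //.
    rewrite ger0_norm; last by rewrite mulr_ge0// subr_ge0.
    by rewrite mulrC -ler_pdivlMr// mul1r lerBlDl -lerBlDr.
(* By the discrete product rule the integrand is [k+1] times the shifted product minus the product,
   whose integrals agree once the step is below [h0]. *)
have ck : (fun k => \int[mu]_(y in A)
     (mh k.+1%:R^-1 y * (k.+1%:R * (phi (y + k.+1%:R^-1 *: v) - phi y)) -
      k.+1%:R * (m y - mh k.+1%:R^-1 y) * phi y)) @ \oo --> 0.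
  apply: cvg_near_cst; apply: filterS hksmall => k kh.
  pose F y : R := m y * phi y.
  have mF : measurable_fun A F by exact: measurable_funM.
  have FM y : A y -> `|F y| <= r * M.
    by move=> Ay; rewrite normrM ler_pM// ger0_norm ?mr// m0.
  have E1 := Rintegral_shift_in mA (w := k.+1%:R^-1 *: v) mF
    (fun y Ay nA => etrans (congr1 (fun t => m y * t) (outk k kh y Ay nA)) (mulr0 _)).
  have E2 : \int[mu]_(y in A) ((F \_ A) (y + k.+1%:R^-1 *: v)) =
      \int[mu]_(y in A) (mh k.+1%:R^-1 y * phi (y + k.+1%:R^-1 *: v)).
    apply: eq_Rintegral => y; rewrite inE => Ay; rewrite /patch.
    case: ifPn => [|/negP nA].
      by rewrite inE => Ak; rewrite /F (ray_height_max_in segA heightA Ay (ltW (hk0 k)) Ak).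
    rewrite (ray_height_max_out segA heightA Ay (ltW (hk0 k))) ?mul0r// => Ak; apply: nA.
    by rewrite inE.
  rewrite {}E2 in E1.
  have iF : mu.-integrable A (EFin \o F) by apply: (bounded_integrable (M := r * M)).
  have iF2 : mu.-integrable A (EFin \o (fun y => mh k.+1%:R^-1 y * phi (y + k.+1%:R^-1 *: v))).
    apply: (bounded_integrable (M := r * M) mA bA); first exact: measurable_funM.
    move=> y Ay; have [b0 [_ bm] ] := maxP Ay (ltW (hk0 k)).
    by rewrite normrM ler_pM// ger0_norm// (le_trans bm (mr Ay)).
  transitivity (\int[mu]_(y in A) (k.+1%:R * (mh k.+1%:R^-1 y * phi (y + k.+1%:R^-1 *: v) - F y))).
    by apply: eq_Rintegral => y _; rewrite /F; ring.
  by rewrite (RintegralZl k.+1%:R mA (integrable_subr mA iF2 iF)) (RintegralB mA iF2 iF) -E1 subrr mulr0.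
have lim0 : \int[mu]_(y in A) (m y * dotrV v (grad phi y) - D y * phi y) = 0.
  exact: (cvg_unique _ key.2 ck).
have igrad : mu.-integrable A (EFin \o (fun y => m y * dotrV v (grad phi y))).
  have := integrable_addr mA key.1 iDphi; congr (integrable _ _ (EFin \o _)).
  by apply/funext => y; rewrite subrK.
have E3 : \int[mu]_(y in A) phi y = \int[mu]_(y in A) (D y * phi y).
  apply/eqP; rewrite -subr_eq0 -(RintegralB mA iphi iDphi) -Z; apply/eqP.
  by apply: eq_Rintegral => y _; rewrite mulrBl mul1r.
apply/esym/eqP; rewrite E3 -subr_eq0 -(RintegralB mA igrad iDphi); apply/eqP.
by apply: lim0.
Qed.
End ray_integrals.

Lemma affine_between_ge (R : realFieldType) (a b t h : R) : 0 <= t -> t <= h ->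
  0 <= a -> 0 <= a + h * b -> 0 <= a + t * b.
Proof.
move=> t0 th a0 ah; have [b0|b0] := leP 0 b; first by rewrite addr_ge0// mulr_ge0.
by apply: (le_trans ah); rewrite lerD2l ler_nM2r.
Qed.

Lemma affine_between_gt (R : realFieldType) (a b t h : R) : 0 <= t -> t <= h ->
  0 < a -> 0 < a + h * b -> 0 < a + t * b.
Proof.
move=> t0 th a0 ah; have [b0|b0] := leP 0 b; first by rewrite ltr_pwDl// mulr_ge0.
by apply: (lt_le_trans ah); rewrite lerD2l ler_nM2r.
Qed.

(** * Nearest-facet cells of a polytope *)

Section polytope.
Context {R : realType} {n : nat}.
Local Notation mu := (@lebesgue_rV R n).
Variables (N : nat) (i0 : 'I_N) (nu : 'I_N -> 'rV[R]_n) (c : 'I_N -> R).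
Hypothesis nu1 : forall i, euclid_norm (nu i) = 1.
Local Notation s i x := (dotrV (nu i) x - c i).

(** With inward unit normals [nu i], the number [s i x] is the signed distance to the i-th bounding
    hyperplane. *)
Definition polytope := [set x | forall i, 0 < s i x].

(* Points nearest to the i-th facet; ties go to the facet of least index, so
   that the cells partition the polytope. *)
Definition facet_cell i := [set x | 0 < s i x /\
  forall j, 0 <= s j x - s i x /\ ((j < i)%N -> 0 < s j x - s i x)].

Let sD i x (t : R) w : s i (x + t *: w) = s i x + t * dotrV (nu i) w.
Proof. by rewrite dotrVDr dotrVZr addrAC. Qed.

Let dD i j x (t : R) w : s j (x + t *: w) - s i (x + t *: w) =
  (s j x - s i x) + t * (dotrV (nu j) w - dotrV (nu i) w).
Proof. by rewrite !sD; ring. Qed.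

Lemma facet_cell_polytope i : facet_cell i `<=` polytope.
Proof.
move=> x [si h] j; have [h1 _] := h j.
by apply: (lt_le_trans si); rewrite -subr_ge0.
Qed.

Lemma facet_cell_unique i j x : facet_cell i x -> facet_cell j x -> i = j.
Proof.
move=> [_ hi] [_ hj]; apply/val_inj/eqP; rewrite eqn_leq; apply/andP; split; rewrite leqNgt; apply/negP => ij.
- have [_ /(_ ij) h] := hi j; have [h' _] := hj i.
  lra.
- have [_ /(_ ij) h] := hj i; have [h' _] := hi j.
  lra.
Qed.

Lemma facet_cell_exists x : polytope x -> exists i, facet_cell i x.
Proof.
move=> Px.
have [i1 _ hi1] := @arg_minP _ R 'I_N i0 xpredT (fun i => s i x) isT.
pose Q (k : nat) := [exists i : 'I_N, (i == k :> nat) && (s i x <= s i1 x)].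
have exQ : exists k, Q k by exists i1; apply/existsP; exists i1; rewrite eqxx lexx.
case: (ex_minnP exQ) => k /existsP[i /andP[/eqP ik si]] hmin.
exists i; split; first exact: Px.
move=> j; have sj := hi1 j isT; split; first by rewrite subr_ge0 (le_trans si).
move=> ji; rewrite subr_gt0 ltNge; apply/negP => sji.
have : Q j by apply/existsP; exists j; rewrite eqxx/= (le_trans sji).
by move=> /hmin; rewrite -ik leqNgt ji.
Qed.

Lemma measurable_facet_cell i : measurable (facet_cell i).
Proof.
have ms (j : 'I_N) : measurable_fun setT (fun x : 'rV[R]_n => s j x).
  apply: measurable_funB; last exact: measurable_cst.
  by apply: continuous_measurable_rV; exact: dotrV_continuous.
have md (j : 'I_N) : measurable_fun setT (fun x : 'rV[R]_n => s j x - s i x).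
  exact: measurable_funB.
rewrite (_ : facet_cell i = [set x | 0 < s i x] `&` \bigcap_(j in [set: 'I_N])
  (if (j < i)%N then [set x | 0 < s j x - s i x] else [set x | 0 <= s j x - s i x])).
  have mgt (f : 'rV[R]_n -> R) : measurable_fun setT f -> measurable [set x | 0 < f x].
    move=> mf; have := mf measurableT `]0, +oo[%classic (measurable_itv _).
    by rewrite setTI; congr measurable; apply/seteqP; split => x /=; rewrite in_itv/= andbT.
  have mge (f : 'rV[R]_n -> R) : measurable_fun setT f -> measurable [set x | 0 <= f x].
    move=> mf; have := mf measurableT `[0, +oo[%classic (measurable_itv _).
    by rewrite setTI; congr measurable; apply/seteqP; split => x /=; rewrite in_itv/= andbT.
  apply: measurableI; first exact: mgt.
  apply: fin_bigcap_measurable => // j _; case: ifP => _; [exact: mgt|exact: mge].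
apply/seteqP; split => x [si h]; split => // j.
  by move=> _; have [h1 h2] := h j; case: ifPn => ij //=; exact: h2.
have := h j I; case: ifPn => ij /= hj; split => //; exact: ltW.
Qed.

Lemma facet_cell_segment i y (t h : R) : 0 <= t -> t <= h -> facet_cell i y ->
  facet_cell i (y + h *: nu i) -> facet_cell i (y + t *: nu i).
Proof.
move=> t0 th [siy hy] [sih hh]; split.
  by rewrite sD; rewrite sD in sih; exact: affine_between_gt th siy sih.
move=> j; have [h1 h2] := hy j; have [h3 h4] := hh j.
rewrite dD in h3 h4; rewrite dD; split; first exact: affine_between_ge th h1 h3.
by move=> ij; exact: affine_between_gt th (h2 ij) (h4 ij).
Qed.

(** Moving towards facet i lowers [s i] at unit rate and each other [s j] at rate at most 1, so
    facet i stays nearest until it is reached. Hence a backward step leaving the cell must cross the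
    facet, near which test functions vanish. *)
Lemma facet_cell_inward i y (h : R) : 0 <= h -> facet_cell i y -> h < s i y ->
  facet_cell i (y - h *: nu i).
Proof.
move=> h0 [siy hy] hs.
have nn j : dotrV (nu j) (nu i) <= 1.
  by apply: (le_trans (cauchy_schwarz _ _)); rewrite !nu1 mulr1.
have ni : dotrV (nu i) (nu i) = 1 by rewrite -sqr_euclid_norm nu1 expr1n.
have hj j : 0 <= h * (1 - dotrV (nu j) (nu i)) by rewrite mulr_ge0// subr_ge0.
rewrite -scaleNr; split; first by rewrite sD ni mulr1; lra.
move=> j; have [h1 h2] := hy j; rewrite dD ni; have := hj j; split; first by lra.
by move=> /h2; lra.
Qed.

(** The distance to the nearest facet is the radius of a ball in the polytope. This is how the
    inradius bounds the heights of the cells. *)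
Lemma facet_cell_ball i y : facet_cell i y -> euclid_ball y (s i y) `<=` polytope.
Proof.
move=> [siy hy] z; rewrite /euclid_ball /= => zy j; have [h1 _] := hy j.
have := cauchy_schwarz_norm (nu j) (z - y).
rewrite nu1 mul1r dotrVDr dotrVNr ler_norml => /andP[h2 _].
lra.
Qed.

Variables (Om : set 'rV[R]_n) (r : R).
Hypotheses (mOm : measurable Om) (bOm : bounded_set Om) (PO : polytope `<=` Om)
  (ballO : forall x (t : R), 0 < t -> euclid_ball x t `<=` Om -> t <= r) (r0 : 0 <= r).

Lemma facet_cell_le i y : facet_cell i y -> s i y <= r.
Proof.
move=> cy; apply: (ballO (x := y)); first by case: cy.
by apply: subset_trans PO; exact: facet_cell_ball.
Qed.

Lemma facet_cell_height i y (h : R) : 0 <= h -> facet_cell i y ->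
  facet_cell i (y + h *: nu i) -> h <= r.
Proof.
move=> h0 [siy _] cyh; have := facet_cell_le cyh; rewrite sD.
have -> : dotrV (nu i) (nu i) = 1 by rewrite -sqr_euclid_norm nu1 expr1n.
lra.
Qed.

Lemma test_facet_distance phi : test_function polytope phi ->
  exists2 h0 : R, 0 < h0 & forall i y, phi y != 0 -> h0 <= s i y.
Proof.
move=> [_ cK KP].
have /choice[d hd] : forall i, exists d : R, 0 < d /\ forall y, phi y != 0 -> d <= s i y.
  move=> i; have [K0|/set0P K0] := eqVneq (closure [set x | phi x != 0]) set0.
    exists 1; split => // y py; have : closure [set x | phi x != 0] y by exact: subset_closure.
    by rewrite K0.
  have cs : {within closure [set x | phi x != 0], continuous (fun x => s i x)}.
    apply: continuous_subspaceT; apply: (lipschitz_continuous (L := n%:R)) => x y.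
    have -> : s i x - s i y = dotrV (nu i) (x - y) by rewrite dotrVDr dotrVNr; ring.
    by rewrite (le_trans (cauchy_schwarz_norm _ _))// nu1 mul1r euclid_le_norm.
  have [x xK xmin] := compact_EVT_min K0 cK cs.
  exists (s i x); split; first by apply: KP; rewrite inE in xK.
  by move=> y py; apply: xmin; rewrite inE; exact: subset_closure.
exists (\big[Num.min/1]_i d i).
  by elim/big_ind: _ => // [a b a0 b0|i _]; [rewrite lt_min a0|case: (hd i)].
by move=> i y py; apply: le_trans ((hd i).2 y py); rewrite (bigD1 i)//= ge_min lexx.
Qed.

Lemma Rintegral_facet_cells (f : 'I_N -> 'rV[R]_n -> R) (g : 'rV[R]_n -> R) :
  (forall i y, facet_cell i y -> f i y = g y) -> (forall y, ~ polytope y -> g y = 0) ->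
  (forall i, mu.-integrable (facet_cell i) (EFin \o f i)) ->
  mu.-integrable Om (EFin \o g) /\
  \int[mu]_(y in Om) g y = \sum_i \int[mu]_(y in facet_cell i) f i y.
Proof.
move=> fg g0 fi.
have CO i : facet_cell i `<=` Om by apply: subset_trans PO; exact: facet_cell_polytope.
have mC := measurable_facet_cell.
have gE : g = (fun y => \sum_i (f i \_ (facet_cell i)) y).
  apply/funext => y; have [Py|nPy] := pselect (polytope y).
    have [i Ci] := facet_cell_exists Py.
    rewrite (bigD1 i)//= big1 ?addr0; last first.
      move=> j ji; rewrite /patch; case: ifPn => //; rewrite inE => Cj.
      by move: ji; rewrite (facet_cell_unique Cj Ci) eqxx.
    by rewrite /patch mem_set// fg.
  rewrite g0// big1// => i _; rewrite /patch; case: ifPn => //; rewrite inE => Ci.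
  by case: nPy; exact: facet_cell_polytope Ci.
have ip i : mu.-integrable Om (EFin \o (f i \_ (facet_cell i))).
  by rewrite -restrict_EFin; apply/(integrable_restrict _ (mC i) mOm); rewrite setIC (setIidl (CO i)).
rewrite gE; split; first exact: (integrable_sumr mOm ip).
rewrite (Rintegral_sumr mOm ip); apply: eq_bigr => i _.
by rewrite -Rintegral_mkcondr (setIidr (CO i)).
Qed.

(** Each cell contributes the integral of its height times a directional derivative, at most the
    height times |grad phi|. Then comes one application of Hoelder's inequality on [Om], and the
    bound on the q-th powers of the heights is summed over the disjoint cells. *)
Lemma Rintegral_test_polytope (j0 : 'I_n) (p q : R) phi : 1 < p -> q = p / (p - 1) ->
  test_function polytope phi ->
  \int[mu]_(x in Om) phi x <=
  (r `^ q / (q + 1) * volume Om) `^ q^-1 * energy p Om (grad phi) `^ p^-1.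
Proof.
move=> p1 qE tphi.
have q1 := conj_gt1 p1 qE; have q0 : 0 < q by exact: lt_trans q1.
have [h0 h0p hh0] := test_facet_distance tphi.
have mC := measurable_facet_cell.
have CO i : facet_cell i `<=` Om by apply: subset_trans PO; exact: facet_cell_polytope.
have bC i : bounded_set (facet_cell i).
  have [M [Mr OM] ] := bOm.
  by exists M; split => // x Mx y Cy; exact: (OM x Mx y (CO i y Cy)).
have seg i := @facet_cell_segment i.
have hgt i := @facet_cell_height i.
pose m i := ray_height (facet_cell i) (nu i).
have mm i : measurable_fun (facet_cell i) (m i).
  exact: (measurable_ray_height (mC i) (seg i) (hgt i)).
have m0 i y : facet_cell i y -> 0 <= m i y.
  by move=> Cy; exact: (ray_height_ge0 (hgt i) Cy).
have mr i y : facet_cell i y -> m i y <= r.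
  by move=> Cy; exact: (ray_height_le (hgt i) Cy).
have tO : test_function Om phi.
  by case: tphi => sphi cphi sP; split => //; exact: subset_trans PO.
have E1 i : \int[mu]_(y in facet_cell i) phi y =
    \int[mu]_(y in facet_cell i) (m i y * dotrV (nu i) (grad phi y)).
  apply: (Rintegral_ray (mC i) (bC i) r0 (seg i) (hgt i) tO h0p) => y h Cy hp hh nC.
  apply/eqP; apply: contra_notT nC => py.
  by apply: facet_cell_inward => //; [exact: ltW|exact: (lt_le_trans hh (hh0 i y py))].
have Vg := VLp_grad p1 mOm tO.
have mG := measurable_euclid Vg.
pose G y := euclid_norm (grad phi y).
have iGp : mu.-integrable Om (EFin \o (fun y => `|G y| `^ p)).
  rewrite (_ : (fun y => `|G y| `^ p) = (fun y => euclid_norm (grad phi y) `^ p)).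
    exact: (integrable_energy j0 p1 qE mOm Vg).
  by apply/funext => y; rewrite ger0_norm ?euclid_norm_ge0.
have iG : mu.-integrable Om (EFin \o G) by exact: (Lp_fun_integrable p1 qE mOm bOm (conj mG iGp)).
have iGC i : mu.-integrable (facet_cell i) (EFin \o (fun y => r * G y)).
  by apply: integrable_scaler => //; exact: integrableS iG.
have mGC i : measurable_fun (facet_cell i) G by exact: measurable_funS mG.
have imG i : mu.-integrable (facet_cell i) (EFin \o (fun y => m i y * G y)).
  apply: (integrable_dominated (mC i) _ (iGC i)); first exact: measurable_funM.
  move=> y Cy; rewrite normrM ler_pM//; last by rewrite ger0_norm ?euclid_norm_ge0.
  by rewrite ger0_norm ?mr// m0.
have imd i : mu.-integrable (facet_cell i) (EFin \o (fun y => m i y * dotrV (nu i) (grad phi y))).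
  apply: (integrable_dominated (mC i) _ (iGC i)).
    apply: measurable_funM => //; apply: measurable_sum => j.
    apply: measurable_funM; first exact: measurable_cst.
    by apply: measurable_funS (Vg j).1 => //; exact: CO.
  move=> y Cy; rewrite normrM ler_pM//; first by rewrite ger0_norm ?mr// m0.
  by rewrite (le_trans (cauchy_schwarz_norm _ _))// nu1 mul1r.
(* The heights glued into a single function, so that Hoelder's inequality is applied once and not
   cell by cell. *)
pose w y : R := \sum_i (m i \_ (facet_cell i)) y.
have wE i y : facet_cell i y -> m i y = w y.
  move=> Cy; rewrite /w (bigD1 i)//= big1 ?addr0; last first.
    move=> j ji; rewrite /patch; case: ifPn => //; rewrite inE => Cj.
    by move: ji; rewrite (facet_cell_unique Cj Cy) eqxx.
  by rewrite /patch mem_set.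
have w0 y : ~ polytope y -> w y = 0.
  move=> nP; rewrite /w big1// => i _; rewrite /patch; case: ifPn => //; rewrite inE => Ci.
  by case: nP; exact: facet_cell_polytope Ci.
have wge0 y : 0 <= w y.
  by apply: sumr_ge0 => i _; rewrite /patch; case: ifPn => //; rewrite inE => /m0.
have im i : mu.-integrable (facet_cell i) (EFin \o m i).
  by apply: (bounded_integrable (M := r)) => // y Cy; rewrite ger0_norm ?mr// m0.
have imq i : mu.-integrable (facet_cell i) (EFin \o (fun y => m i y `^ q)).
  apply: (bounded_integrable (M := r `^ q)) => //.
    exact: (measurableT_comp (measurable_powR q) (mm i)).
  by move=> y Cy; rewrite ger0_norm ?powR_ge0// le_powR ?(ltW q0)// ?m0// mr.
have mw := integrable_measurable (Rintegral_facet_cells wE w0 im).1.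
have [_ Ephi] : mu.-integrable Om (EFin \o phi) /\
    \int[mu]_(y in Om) phi y = \sum_i \int[mu]_(y in facet_cell i) phi y.
  apply: (Rintegral_facet_cells (f := fun=> phi)) => // [y nP|i]; first exact: (test_out tphi nP).
  by apply: integrableS (test_integrable tphi).
have [_ EwG] : mu.-integrable Om (EFin \o (fun y => w y * G y)) /\
    \int[mu]_(y in Om) (w y * G y) = \sum_i \int[mu]_(y in facet_cell i) (m i y * G y).
  apply: Rintegral_facet_cells => // [i y Cy|y nP]; first by rewrite (wE i).
  by rewrite w0// mul0r.
have [iwq Ewq] : mu.-integrable Om (EFin \o (fun y => `|w y| `^ q)) /\
    \int[mu]_(y in Om) (`|w y| `^ q) = \sum_i \int[mu]_(y in facet_cell i) (m i y `^ q).
  apply: Rintegral_facet_cells => // [i y Cy|y nP].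
    by rewrite -(wE i y Cy) ger0_norm// m0.
  by rewrite w0// normr0 powR0// gt_eqF.
have [iP EP] : mu.-integrable Om (EFin \o (\1_polytope : 'rV[R]_n -> R)) /\
    \int[mu]_(y in Om) \1_polytope y = \sum_i \int[mu]_(y in facet_cell i) (1 : R).
  apply: (Rintegral_facet_cells (f := fun _ _ => 1)).
  - by move=> i y /facet_cell_polytope Py; rewrite indicE mem_set.
  - by move=> y nP; rewrite indicE memNset.
  - move=> i; apply: (bounded_integrable (M := 1)) => // y _; by rewrite normr1.
have hvol : \sum_i volume (facet_cell i) <= volume Om.
  have i1 : mu.-integrable Om (EFin \o (fun=> 1 : R)).
    by apply: (bounded_integrable (M := 1)) => // y _; rewrite normr1.
  rewrite -[leRHS]mul1r -(Rintegral_cst mu mOm).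
  apply: le_trans (le_Rintegral mOm iP i1 _); last first.
    by move=> y _; rewrite indicE lern1 leq_b1.
  rewrite EP le_eqVlt; apply/orP; left; apply/eqP; apply: eq_bigr => i _.
  by rewrite Rintegral_cst// mul1r.
have [_ hH] := Lp_hoelder mOm p1 qE mG mw iGp iwq.
have step1 : \int[mu]_(x in Om) phi x <= \int[mu]_(y in Om) (w y * G y).
  rewrite Ephi EwG; apply: ler_sum => i _; rewrite E1.
  apply: (le_Rintegral (mC i) (imd i) (imG i)) => y Cy; apply: ler_wpM2l; first exact: m0.
  by apply: (le_trans (ler_norm _)); rewrite (le_trans (cauchy_schwarz_norm _ _))// nu1 mul1r.
apply: (le_trans step1).
rewrite (_ : \int[mu]_(y in Om) (w y * G y) = \int[mu]_(y in Om) `|euclid_norm (grad phi y) * w y|); last first.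
  by apply: eq_Rintegral => y _; rewrite ger0_norm ?mulr_ge0 ?euclid_norm_ge0// mulrC.
apply: (le_trans hH); rewrite mulrC.
rewrite (_ : \int[mu]_(x in Om) (`|euclid_norm (grad phi x)| `^ p) = energy p Om (grad phi)); last first.
  by apply: eq_Rintegral => y _; rewrite ger0_norm ?euclid_norm_ge0.
apply: ler_wpM2r; first exact: powR_ge0.
apply: le_powR; first by rewrite invr_ge0 ltW.
  by apply: Rintegral_ge0 => y _; exact: powR_ge0.
rewrite Ewq; apply: (@le_trans _ _ (\sum_i (r `^ q / (q + 1) * volume (facet_cell i)))).
  by apply: ler_sum => i _; exact: (Rintegral_ray_height_le (mC i) (bC i) (seg i) (hgt i) q1).
by rewrite -mulr_sumr ler_wpM2l// divr_ge0 ?powR_ge0// addr_ge0// ltW.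
Qed.
End polytope.

Lemma dotrV_expand {R : realType} n (u v : 'rV[R]_n) (a : R) :
  dotrV (u + a *: v) (u + a *: v) = dotrV u u + a * (2 * dotrV u v + a * dotrV v v).
Proof. by rewrite dotrVDl !dotrVDr !dotrVZl !dotrVZr (dotrVC v u); ring. Qed.

Lemma convex_setE {R : realType} n (Om : set 'rV[R]_n) : convex_set Om ->
  forall x y (t : R), 0 <= t -> t <= 1 -> Om x -> Om y -> Om (t *: x + (1 - t) *: y).
Proof.
move=> cO x y t t0 t1 Ox Oy.
by have := cO x y (Itv01 t0 t1); rewrite !inE /=; apply.
Qed.

(** * The gauge of a convex domain and approximation by polytopes *)

Section gauge.
Context {R : realType} {n : nat}.
Variables (Om : set 'rV[R]_n) (x0 : 'rV[R]_n) (r : R).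
Hypotheses (oO : open Om) (bO : bounded_set Om) (cO : convex_set Om) (r0 : 0 < r)
  (ballO : euclid_ball x0 r `<=` Om).
Implicit Types (x y z : 'rV[R]_n) (s t : R).

(** The Minkowski functional of [Om - x0]. Its argument is a displacement from [x0]. *)
Definition gauge y : R := inf [set s | 0 < s /\ Om (x0 + s^-1 *: y)].
Local Notation S y := [set s | 0 < s /\ Om (x0 + s^-1 *: y)].

Let segO := convex_setE cO.

Lemma gauge_mem y s : euclid_norm y < r * s -> S y s.
Proof.
move=> ys; have s0 : 0 < s by rewrite -(pmulr_rgt0 _ r0) (le_lt_trans (euclid_norm_ge0 y)).
split => //; apply: ballO; rewrite /euclid_ball/= addrAC subrr add0r euclid_normZ.
by rewrite ger0_norm ?invr_ge0 ?ltW// mulrC ltr_pdivrMr.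
Qed.

Lemma gauge_nonempty y : S y !=set0.
Proof.
exists ((euclid_norm y + 1) / r); apply: gauge_mem.
by rewrite mulrC divfK ?gt_eqF// ltrDl.
Qed.

Lemma gauge_ge0 y : 0 <= gauge y.
Proof. by apply: lb_le_inf; [exact: gauge_nonempty|move=> s [/ltW]]. Qed.

Let S_lbound y : has_lbound (S y).
Proof. by exists 0 => s [/ltW]. Qed.

Lemma gauge_le y s : S y s -> gauge y <= s.
Proof. by move=> Ss; exact: ge_inf. Qed.

Lemma gauge_lt_mem y s : gauge y < s -> S y s.
Proof.
move=> /(inf_lt (gauge_nonempty y))[t [t0 Ot] ts].
have s0 : 0 < s by exact: lt_trans ts.
split => //.
have ts0 : 0 <= t / s by rewrite divr_ge0// ltW.
have ts1 : t / s <= 1 by rewrite ler_pdivrMr// mul1r ltW.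
have Ox0 : Om x0.
  by apply: ballO; rewrite /euclid_ball/= subrr euclid_norm0.
have := segO ts0 ts1 Ot Ox0; congr (Om _).
rewrite scalerDr scalerA (_ : t / s / t = s^-1); last by field; rewrite !gt_eqF.
by rewrite addrAC -scalerDl addrCA subrr addr0 scale1r.
Qed.

Lemma gauge_euclid_le y : gauge y <= euclid_norm y / r.
Proof.
apply/ler_addgt0Pr => e e0; apply: gauge_le; apply: gauge_mem.
by rewrite mulrDr mulrC divfK ?gt_eqF// ltrDl mulr_gt0.
Qed.

Lemma gauge_lt1 x : Om x <-> gauge (x - x0) < 1.
Proof.
split => [Ox|/gauge_lt_mem[_]]; last by rewrite invr1 scale1r addrC subrK.
have /nbhs_ballP[e /= e0 he] : nbhs x Om by exact: open_nbhs_nbhs.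
(* Small enough that stretching [x - x0] by [1 + t] moves [x] by less than [e]; the point stays in
   [Om], and the gauge at [x] is at most [1/(1+t)]. *)
pose t : R := e / (2 * (`|x - x0| + 1)).
have t0 : 0 < t by rewrite divr_gt0// mulr_gt0// ltr_wpDl.
have t1 : 0 < 1 + t by rewrite addr_gt0.
apply: (@le_lt_trans _ _ ((1 + t)^-1)); last by rewrite invf_lt1// ltrDl.
apply: gauge_le; split; first by rewrite invr_gt0.
rewrite invrK; apply: he; rewrite -ball_normE /ball_/=.
rewrite scalerDl scale1r addrA [x0 + _]addrC subrK opprD addrA subrr sub0r normrN.
rewrite normrZ ger0_norm ?(ltW t0)// /t mulrAC ltr_pdivrMr; last first.
  by rewrite mulr_gt0// ltr_wpDl.
rewrite ltr_pM2l//; have N0 : 0 <= `|x - x0| :> R by exact: normr_ge0.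
lra.
Qed.

Lemma gaugeZ y t : 0 < t -> gauge (t *: y) = t * gauge y.
Proof.
have half z u : 0 < u -> gauge (u *: z) <= u * gauge z.
  move=> u0; rewrite -ler_pdivrMl//; apply: lb_le_inf; first exact: gauge_nonempty.
  move=> s [s0 Os]; rewrite ler_pdivrMl//; apply: gauge_le; split; first exact: mulr_gt0.
  by rewrite invfM scalerA mulrAC mulVf ?gt_eqF// mul1r.
move=> t0; apply/eqP; rewrite eq_le half//=.
rewrite -ler_pdivlMl//; have := half (t *: y) t^-1; rewrite invr_gt0 => /(_ t0).
by rewrite scalerA mulVf ?gt_eqF// scale1r.
Qed.

Lemma gauge0 : gauge 0 = 0.
Proof.
by apply/eqP; rewrite eq_le gauge_ge0 (le_trans (gauge_euclid_le 0))// euclid_norm0 mul0r.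
Qed.

Lemma gaugeD y z : gauge (y + z) <= gauge y + gauge z.
Proof.
apply/ler_addgt0Pr => e e0.
have e2 : 0 < e / 2 by rewrite divr_gt0.
set a := gauge y + e / 2; set b := gauge z + e / 2.
have [a0 Oa] : S y a by apply: gauge_lt_mem; rewrite ltrDl.
have [b0 Ob] : S z b by apply: gauge_lt_mem; rewrite ltrDl.
have -> : gauge y + gauge z + e = a + b by rewrite /a /b; field.
have ab : 0 < a + b by rewrite addr_gt0.
apply: gauge_le; split => //.
have h0 : 0 <= a / (a + b) by rewrite divr_ge0// ltW.
have h1 : a / (a + b) <= 1 by rewrite ler_pdivrMr// mul1r lerDl ltW.
have := segO h0 h1 Oa Ob; congr (Om _).
have -> : 1 - a / (a + b) = b / (a + b) by field; rewrite gt_eqF.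
rewrite !scalerDr !scalerA addrACA -scalerDl -mulrDl mulfV ?gt_eqF// scale1r.
congr (_ + (_ *: _ + _ *: _)); field; rewrite !gt_eqF//.
Qed.

Lemma gauge_lipschitz y z : `|gauge y - gauge z| <= euclid_norm (y - z) / r.
Proof.
have h a b : gauge a - gauge b <= euclid_norm (a - b) / r.
  rewrite lerBlDl; have := gaugeD b (a - b); rewrite addrC subrK => /le_trans; apply.
  by rewrite lerD2l gauge_euclid_le.
by rewrite ler_norml h andbT lerNl opprB euclid_norm_distC h.
Qed.

Lemma gauge_continuous : continuous (fun x => gauge (x - x0)).
Proof.
apply: (lipschitz_continuous (L := n%:R / r)) => x y.
apply: (le_trans (gauge_lipschitz _ _)).
rewrite opprB subrKA mulrAC ler_pM2r ?invr_gt0//.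
exact: euclid_le_norm.
Qed.

Lemma gauge_center : Om x0.
Proof. by apply: ballO; rewrite /euclid_ball/= subrr euclid_norm0. Qed.

Lemma gauge_level_bounded t : bounded_set [set x | gauge (x - x0) <= t].
Proof.
have [M [Mr OM] ] := bO.
pose u : R := `|t| + 1; have u0 : 0 < u by rewrite ltr_wpDl.
have OM1 x : Om x -> `|x| <= `|M| + 1.
  by move=> Ox; apply: OM Ox; rewrite (le_lt_trans (ler_norm M))// ltrDl.
exists (`|x0| + u * (`|M| + 1 + `|x0|)); split; first exact: num_real.
move=> N hN x /= xt; apply: (le_trans _ (ltW hN)).
have [_ Ox] : S (x - x0) u.
  by apply: gauge_lt_mem; rewrite (le_lt_trans xt)// (le_lt_trans (ler_norm t))// ltrDl.
have -> : x = x0 + u *: ((x0 + u^-1 *: (x - x0)) - x0).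
  by rewrite [x0 + _ - _]addrAC subrr add0r scalerA mulfV ?gt_eqF// scale1r addrC subrK.
apply: (le_trans (ler_normD _ _)); rewrite lerD2l normrZ ger0_norm ?(ltW u0)// ler_pM2l//.
by apply: (le_trans (ler_normB _ _)); rewrite lerD2r OM1.
Qed.

Lemma gauge_level_compact t : compact [set x | gauge (x - x0) <= t].
Proof.
apply: bounded_closed_compact; first exact: gauge_level_bounded.
rewrite (_ : [set x | _] = (fun x => gauge (x - x0)) @^-1` [set s | s <= t])//.
by apply: closed_comp => [x _|]; [exact: gauge_continuous|exact: closed_le].
Qed.

Lemma gauge_sphere_compact : compact [set x | gauge (x - x0) = 1].
Proof.
apply: (subclosed_compact _ (gauge_level_compact (t := 1))); last by move=> x /= ->.
rewrite (_ : [set x | _] = (fun x => gauge (x - x0)) @^-1` [set 1])//.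
apply: closed_comp => [x _|]; first exact: gauge_continuous.
exact: closed_eq.
Qed.

Lemma gauge_level_convex t x y (a : R) : 0 <= a -> a <= 1 ->
  gauge (x - x0) <= t -> gauge (y - x0) <= t -> gauge (x + a *: (y - x) - x0) <= t.
Proof.
move=> a0 a1 xt yt.
have [->|an0] := eqVneq a 0; first by rewrite scale0r addr0.
have [->|an1] := eqVneq a 1; first by rewrite scale1r [x + _]addrC subrK.
have ap : 0 < a by rewrite lt_neqAle eq_sym an0.
have bp : 0 < 1 - a by rewrite subr_gt0 lt_neqAle an1.
have -> : x + a *: (y - x) - x0 = (1 - a) *: (x - x0) + a *: (y - x0).
  by apply/rowP => i; rewrite !mxE; ring.
apply: (le_trans (gaugeD _ _)); rewrite !gaugeZ//.
have : (1 - a) * gauge (x - x0) <= (1 - a) * t by rewrite ler_pM2l.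
have : a * gauge (y - x0) <= a * t by rewrite ler_pM2l.
lra.
Qed.

(* nu points from z to its orthogonal projection on the convex set. *)
Lemma gauge_level_separation t z : 0 <= t -> t < gauge (z - x0) ->
  exists nu (c : R), [/\ euclid_norm nu = 1, dotrV nu z - c < 0 &
    forall x, gauge (x - x0) <= t -> 0 < dotrV nu x - c].
Proof.
move=> t0 tz.
have C0 : [set x | gauge (x - x0) <= t] !=set0 by exists x0; rewrite /= subrr gauge0.
have cN : {within [set x | gauge (x - x0) <= t], continuous (fun x => euclid_norm (x - z))}.
  apply: continuous_subspaceT; apply: (lipschitz_continuous (L := n%:R)) => x y.
  apply: (le_trans (ler_dist_euclid _ _)); rewrite opprB subrKA; exact: euclid_le_norm.
have [w] := compact_EVT_min C0 (gauge_level_compact (t := t)) cN.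
rewrite inE /= => wt wmin.
have wz0 : 0 < euclid_norm (w - z).
  rewrite lt_neqAle euclid_norm_ge0 andbT eq_sym euclid_norm_eq0 subr_eq0.
  by apply: contraTneq tz => <-; rewrite -leNgt.
(* The variational inequality of the projection: if the angle were acute, a small move from [w]
   towards [x] would come closer to [z]. *)
have obtuse x : gauge (x - x0) <= t -> 0 <= dotrV (w - z) (x - w).
  move=> xt; rewrite leNgt; apply/negP => neg.
  set b := dotrV (w - z) (x - w) in neg; set d := dotrV (x - w) (x - w).
  have d0 : 0 <= d by exact: dotrV_ge0.
  (* At most 1 to stay on the segment, and such that [a d < - b], so the linear decrease wins over
     the quadratic term. Using [d + 1] avoids dividing by 0. *)
  pose a : R := Num.min 1 (- b / (d + 1)).
  have a0 : 0 < a by rewrite lt_min ltr01 divr_gt0 ?oppr_gt0// ltr_wpDl.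
  have a1 : a <= 1 by rewrite ge_min lexx.
  have ab : a * d < - b.
    apply: (@lt_le_trans _ _ (a * (d + 1))); first by rewrite ltr_pM2l// ltrDl.
    by rewrite -ler_pdivlMr ?ltr_wpDl// ge_min lexx orbT.
  have := wmin (w + a *: (x - w)); rewrite inE /= => /(_ (gauge_level_convex (ltW a0) a1 wt xt)).
  rewrite -(ler_pXn2r (ltn0Sn 1)) ?nnegrE ?euclid_norm_ge0// !sqr_euclid_norm.
  have -> : w + a *: (x - w) - z = (w - z) + a *: (x - w) by rewrite addrAC.
  rewrite dotrV_expand -/b -/d.
  have : a * (2 * b + a * d) < 0 by rewrite pmulr_rlt0//; lra.
  lra.
pose nu := (euclid_norm (w - z))^-1 *: (w - z).
(* The hyperplane passes through the midpoint of [w] and [z], so that both inequalities are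
   strict. *)
exists nu, (dotrV nu (2^-1 *: (w + z))).
have nuE v : dotrV nu v = (euclid_norm (w - z))^-1 * dotrV (w - z) v by rewrite dotrVZl.
have i0 : 0 < (euclid_norm (w - z))^-1 by rewrite invr_gt0.
have dwz : 0 < dotrV (w - z) (w - z) by rewrite -sqr_euclid_norm exprn_gt0.
split.
- by rewrite /nu euclid_normZ ger0_norm ?invr_ge0 ?euclid_norm_ge0// mulVf// gt_eqF.
- rewrite -dotrVNr -dotrVDr nuE pmulr_rlt0//.
  have -> : z - 2^-1 *: (w + z) = (- 2^-1) *: (w - z) by apply/rowP => i; rewrite !mxE; field.
  by rewrite dotrVZr mulNr oppr_lt0 mulr_gt0// invr_gt0.
- move=> x xt; rewrite -dotrVNr -dotrVDr nuE pmulr_rgt0//.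
  have -> : x - 2^-1 *: (w + z) = (x - w) + 2^-1 *: (w - z) by apply/rowP => i; rewrite !mxE; field.
  by rewrite dotrVDr dotrVZr ltr_wpDl ?obtuse// mulr_gt0// invr_gt0.
Qed.
End gauge.

Section gauge_polytope.
Context {R : realType} {n : nat}.
Variables (Om : set 'rV[R]_n) (x0 : 'rV[R]_n) (r : R).
Hypotheses (oO : open Om) (bO : bounded_set Om) (cO : convex_set Om) (r0 : 0 < r)
  (ballO : euclid_ball x0 r `<=` Om).
Local Notation gauge := (gauge Om x0).

Lemma gauge_gt0 (v : 'rV[R]_n) : v != 0 -> 0 < gauge v.
Proof.
move=> v0; rewrite lt_neqAle eq_sym (gauge_ge0 r0 ballO) andbT; apply/eqP => g0.
have [M [Mr OM] ] := bO.
pose K : R := `|M| + 1 + `|x0|.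
have K0 : 0 < K by rewrite ltr_wpDr// ltr_wpDl.
have OK x : Om x -> `|x - x0| <= K.
  move=> Ox; apply: (le_trans (ler_normB _ _)); rewrite lerD2r.
  by apply: OM Ox; rewrite (le_lt_trans (ler_norm M))// ltrDl.
have nv : 0 < `|v| :> R by rewrite normr_gt0.
(* Puts [x0 + v/s] at distance [2 K] from [x0], whereas points of [Om] are within [K]. *)
pose s : R := `|v| / (2 * K).
have s0 : 0 < s by rewrite divr_gt0// mulr_gt0.
have [_ Ox] : 0 < s /\ Om (x0 + s^-1 *: v) by apply: (gauge_lt_mem cO r0 ballO); rewrite g0.
have := OK _ Ox; rewrite addrAC subrr add0r normrZ ger0_norm ?invr_ge0 ?(ltW s0)//.
rewrite ler_pdivrMl// /s mulrAC ler_pdivlMr ?mulr_gt0// ler_pM2l//.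
by apply/negP; rewrite -ltNge ltr_pMl// ltr1n.
Qed.

(** Each point of the sphere of gauge 1 is cut off from the level set by a half-space, and by
    compactness finitely many of them cut off the whole sphere. A point of the resulting polytope
    outside [Om] would be joined to [x0] by a segment in the polytope that meets the sphere, which
    is impossible. *)
Lemma polytope_between (j0 : 'I_n) (t : R) : 0 <= t -> t < 1 ->
  exists N (i0 : 'I_N) (nu : 'I_N -> 'rV[R]_n) (c : 'I_N -> R), [/\ forall i, euclid_norm (nu i) = 1,
    [set x | gauge (x - x0) <= t] `<=` polytope nu c & polytope nu c `<=` Om].
Proof.
move=> t0 t1.
have /choice[f hf] : forall z, exists nuc : 'rV[R]_n * R, gauge (z - x0) = 1 ->
    [/\ euclid_norm nuc.1 = 1, dotrV nuc.1 z - nuc.2 < 0 &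
    forall x, gauge (x - x0) <= t -> 0 < dotrV nuc.1 x - nuc.2].
  move=> z; have [z1|z1] := eqVneq (gauge (z - x0)) 1; last first.
    by exists (0, 0) => /eqP; rewrite (negbTE z1).
  have tz : t < gauge (z - x0) by rewrite z1.
  by have [nu [c h] ] := gauge_level_separation bO cO r0 ballO t0 tz; exists (nu, c).
pose D := [set z | gauge (z - x0) = 1].
pose U (z : 'rV[R]_n) := [set x | dotrV (f z).1 x - (f z).2 < 0].
have oU z : D z -> open (U z).
  move=> _; rewrite (_ : U z = dotrV (f z).1 @^-1` [set s | s < (f z).2]).
    by apply: open_comp => [x _|]; [exact: dotrV_continuous|exact: open_lt].
  by apply/seteqP; split => x /=; rewrite /U/= subr_lt0.
have := gauge_sphere_compact bO cO r0 ballO; rewrite compact_cover.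
move=> /(_ _ D U oU)[|F' FD' DF'].
  by move=> z z1; exists z => //; rewrite /U/=; have [] := hf z z1.
have [F FD DF] : exists2 F : seq 'rV[R]_n, {subset F <= D} &
    forall x, D x -> exists2 z, z \in F & U z x.
  exists (finmap.enum_fset F'); first exact: FD'.
  by move=> x /DF'[z zF Uz]; exists z.
have hF (i : 'I_(size F)) : gauge (nth 0 F i - x0) = 1.
  have : nth 0 F i \in F by rewrite mem_nth.
  by move=> /FD; rewrite inE.
(* Any nonzero vector yields a point of the sphere, so the finite cover, and with it the set of
   facets, is not empty. *)
pose e : 'rV[R]_n := delta_mx ord0 j0.
have e0 : e != 0.
  by apply/eqP => /rowP/(_ j0); rewrite !mxE !eqxx => /eqP; rewrite oner_eq0.
have ge := gauge_gt0 e0.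
have De : D (x0 + (gauge e)^-1 *: e).
  by rewrite /D/= addrAC subrr add0r (gaugeZ r0 ballO) ?invr_gt0// mulVf// gt_eqF.
have [z /= zF _] := DF _ De.
have iF : (index z F < size F)%N by rewrite index_mem.
exists (size F), (Ordinal iF), (fun i => (f (nth 0 F i)).1), (fun i => (f (nth 0 F i)).2); split.
- by move=> i; have [] := hf _ (hF i).
- by move=> x /= xt i; have [_ _] := hf _ (hF i); apply.
- move=> w Pw; apply/(gauge_lt1 oO cO r0 ballO); rewrite ltNge; apply/negP => gw.
  have g0 : 0 < gauge (w - x0) by exact: lt_le_trans gw.
  have Du : D (x0 + (gauge (w - x0))^-1 *: (w - x0)).
    by rewrite /D/= addrAC subrr add0r (gaugeZ r0 ballO) ?invr_gt0// mulVf// gt_eqF.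
  have [y /= yF] := DF _ Du.
  have iy : (index y F < size F)%N by rewrite index_mem.
  have := Pw (Ordinal iy); rewrite /= nth_index// => sw.
  have [_ _ hx] : [/\ euclid_norm (f y).1 = 1, dotrV (f y).1 y - (f y).2 < 0 &
    forall x, gauge (x - x0) <= t -> 0 < dotrV (f y).1 x - (f y).2].
    by apply: hf; have := FD _ yF; rewrite inE.
  have sx0 : 0 < dotrV (f y).1 x0 - (f y).2 by apply: hx; rewrite subrr (gauge0 r0 ballO).
  rewrite /U/= ltNge => /negP; apply; apply: ltW.
  have -> : dotrV (f y).1 (x0 + (gauge (w - x0))^-1 *: (w - x0)) - (f y).2 =
      (dotrV (f y).1 x0 - (f y).2) + (gauge (w - x0))^-1 * dotrV (f y).1 (w - x0).
    by rewrite dotrVDr dotrVZr addrAC.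
  apply: (@affine_between_gt _ _ _ _ 1) => //; first by rewrite invr_ge0 ltW.
    by rewrite invf_le1.
  by rewrite mul1r dotrVDr dotrVNr; move: sw; lra.
Qed.

End gauge_polytope.

Lemma euclid_ball_sub {R : realType} n (Om : set 'rV[R]_n) x : open Om -> Om x ->
  exists2 e : R, 0 < e & euclid_ball x e `<=` Om.
Proof.
move=> oO Ox; have /nbhs_ballP[e /= e0 he] : nbhs x Om by exact: open_nbhs_nbhs.
exists e => // y /= xy; apply: he; rewrite -ball_normE /ball_/= distrC.
by rewrite (le_lt_trans (norm_le_euclid _)).
Qed.

Lemma Rintegral_test_inradius {R : realType} {n : nat} (j0 : 'I_n) (p q r : R)
    (Om : set 'rV[R]_n) phi : 1 < p -> q = p / (p - 1) -> convex_domain Om ->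
  0 <= r -> (forall x (t : R), 0 < t -> euclid_ball x t `<=` Om -> t <= r) ->
  test_function Om phi ->
  \int[lebesgue_rV n]_(x in Om) phi x <=
  (r `^ q / (q + 1) * volume Om) `^ q^-1 * energy p Om (grad phi) `^ p^-1.
Proof.
move=> p1 qE [[x0 Ox0] oO bO cO] r0 hr [sphi cphi sO].
have [e e0 he] := euclid_ball_sub oO Ox0.
have mOm := open_measurable_rV oO.
pose K := closure [set x | phi x != 0].
(* The maximum of the gauge on the compact support, or 0 if the support is empty. *)
have [t [t0 t1 ht] ] : exists t : R, [/\ 0 <= t, t < 1 & forall x, K x -> gauge Om x0 (x - x0) <= t].
  have [K0|/set0P K0] := eqVneq K set0; first by exists 0; split => // x; rewrite K0.
  have cg : {within K, continuous (fun x : 'rV[R]_n => gauge Om x0 (x - x0))}.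
    by apply: continuous_subspaceT; exact: (gauge_continuous cO e0 he).
  have [x] := compact_EVT_max K0 cphi cg.
  rewrite inE => Kx hx; exists (gauge Om x0 (x - x0)); split.
  - exact: (gauge_ge0 e0 he).
  - by apply/(gauge_lt1 oO cO e0 he); exact: sO.
  - by move=> y Ky; apply: hx; rewrite inE.
have [N [i0 [nu [c [nu1 KP PO] ] ] ] ] := polytope_between oO bO cO e0 he j0 t0 t1.
apply: (Rintegral_test_polytope i0 nu1 mOm bO PO hr r0 j0 p1 qE).
by split => // x Kx; apply: KP; exact: ht.
Qed.

(** * Homogeneous functions and the unit ball *)

Lemma one_sub_exp (R : realFieldType) n (t : R) : 0 < t -> t <= 1 ->
  1 - t ^+ n <= n%:R * (1 - t).
Proof.
move=> t0 t1; elim: n => [|n ih]; first by rewrite expr0 subrr mul0r.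
have h : t * (1 - t ^+ n) <= 1 - t ^+ n.
  by rewrite -[leRHS]mul1r ler_wpM2r// subr_ge0 exprn_ile1// ltW.
rewrite exprS -natr1 mulrDl mul1r; move: h ih.
lra.
Qed.

Lemma cvg_one_sub_harmonic (R : realType) : (fun k : nat => 1 - k.+2%:R^-1 : R) @ \oo --> (1 : R).
Proof.
have hc : (fun k : nat => k.+2%:R^-1 : R) @ \oo --> (0 : R).
  by rewrite (cvg_shiftS (fun k : nat => k.+1%:R^-1 : R)); exact: (@cvg_harmonic R).
by have := cvgB (cvg_cst (1 : R)) hc; rewrite subr0; exact.
Qed.

Section homogeneous.
Context {R : realType} {n : nat}.
Local Notation mu := (@lebesgue_rV R n).
Variables (j : 'rV[R]_n -> R).
Hypotheses (mj : measurable_fun setT j) (j0 : forall y, 0 <= j y)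
  (jZ : forall (t : R) y, 0 < t -> j (t *: y) = t * j y)
  (bW : bounded_set [set y | j y < 1]).
Local Notation W := [set y | j y < 1].

Lemma measurable_sublevel (t : R) : measurable [set y | j y < t].
Proof.
have := mj measurableT (Y := `]-oo, t[%classic) (measurable_itv _).
by rewrite setTI; congr measurable; apply/seteqP; split => x /=; rewrite in_itv/=.
Qed.

(** Stands in for polar coordinates. The nonnegative function 1 - j^q has a smaller integral on the
    dilate t W than on W; rescaling t W to W gives t^n (V - t^q I) <= V - I. *)
Lemma Rintegral_homogeneous_dilate (q t : R) : 1 < q -> 0 < t -> t < 1 ->
  \int[mu]_(y in W) (j y `^ q) * (1 - t ^+ n * t `^ q) <= volume W * (1 - t ^+ n).
Proof.
move=> q1 t0 t1; have q0 : 0 < q by exact: lt_trans q1.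
have mW := measurable_sublevel 1.
have mjq : measurable_fun setT (fun y => j y `^ q).
  exact: (measurableT_comp (measurable_powR q) mj).
have m1jq : measurable_fun setT (fun y => 1 - j y `^ q).
  by apply: measurable_funB => //; exact: measurable_cst.
have jq1 (s : R) y : 0 <= s -> s <= 1 -> j y < 1 -> s * j y `^ q <= 1.
  move=> s0 s1 jy; rewrite -[leRHS]mulr1 ler_pM ?powR_ge0//.
  have : j y `^ q <= 1 `^ q by apply: le_powR => //; exact: ltW.
  by rewrite powR1.
have i1 : mu.-integrable W (EFin \o (fun=> 1 : R)).
  by apply: (bounded_integrable (M := 1)) => // y _; rewrite normr1.
have iq : mu.-integrable W (EFin \o (fun y => j y `^ q)).
  apply: (bounded_integrable (M := 1)) => //; first exact: measurable_funS mjq.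
  by move=> y Wy; rewrite ger0_norm ?powR_ge0// -[leLHS]mul1r jq1.
have iB (s : R) : mu.-integrable W (EFin \o (fun y => 1 - s * j y `^ q)).
  by apply: integrable_subr => //; exact: integrable_scaler.
pose f := (fun y => 1 - j y `^ q) \_ [set y | j y < t].
have mf : measurable_fun setT f.
  apply/(measurable_restrictT _ (measurable_sublevel t)).
  exact: measurable_funS m1jq.
have fW y : f y <= ((fun y => 1 - 1 * j y `^ q) \_ W) y.
  rewrite /f /patch; case: ifPn => [|_].
    by rewrite inE /= => jy; rewrite mem_set ?mul1r//=; exact: lt_trans t1.
  by case: ifPn => //; rewrite inE /= => jy; rewrite subr_ge0 jq1.
have f0 y : 0 <= f y.
  rewrite /f /patch; case: ifPn => //; rewrite inE /= => jy.
  by rewrite subr_ge0 -[leLHS]mul1r jq1//; exact: lt_trans t1.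
have := ge0_Rintegral_dilate t0 mf f0.
have -> : \int[mu]_x f (t *: x) = \int[mu]_(x in W) (1 - t `^ q * j x `^ q).
  rewrite [RHS]Rintegral_mkcond; apply: eq_Rintegral => y _.
  have tW : (t *: y \in [set y | j y < t]) = (y \in W).
    have H : (j (t *: y) < t) = (j y < 1) by rewrite jZ// -[X in _ < X]mulr1 ltr_pM2l.
    by apply/idP/idP; rewrite !inE /= H.
  by rewrite /f /patch tW jZ// powRM// ltW.
move=> E.
have le1 : \int[mu]_x f x <= \int[mu]_(x in W) (1 - 1 * j x `^ q).
  rewrite [leRHS]Rintegral_mkcond.
  have iR : mu.-integrable setT (EFin \o ((fun y => 1 - 1 * j y `^ q) \_ W)).
    by rewrite -restrict_EFin; apply/(integrable_mkcond _ mW); exact: iB.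
  apply: le_Rintegral => //.
  apply: (integrable_dominated measurableT mf iR) => y _.
  by rewrite ger0_norm.
move: le1; rewrite -E !(RintegralB mW i1 (integrable_scaler mW _ iq)) !(RintegralZl _ mW iq).
rewrite Rintegral_cst// mul1r -/(volume W) mul1r => le1.
rewrite !mulrBr mulr1 [_ * (_ * _)]mulrCA mulrA in le1 *.
move: le1; set I := \int[mu]_(_ in _) _; set V := volume _; set T := t ^+ n.
lra.
Qed.

(** The dilation inequality divided by 1 - t as t tends to 1: tangent estimates bound 1 - t^(n+q)
    from below and 1 - t^n from above. *)
Lemma Rintegral_homogeneous_le (q : R) : 1 < q ->
  \int[mu]_(y in W) (j y `^ q) <= n%:R / (n%:R + q) * volume W.
Proof.
move=> q1; set I := Rintegral _ _ _; set V := volume W.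
have I0 : 0 <= I by apply: Rintegral_ge0 => y _; exact: powR_ge0.
have V0 : 0 <= V by exact: fine_ge0.
have s1 : 1 < n%:R + q by rewrite ltr_wpDl.
have s0 : 0 < n%:R + q by exact: lt_trans s1.
have step (t : R) : 0 < t -> t < 1 -> I * (n%:R + q) * t `^ (n%:R + q - 1) <= n%:R * V.
  move=> t0 t1; have h := Rintegral_homogeneous_dilate q1 t0 t1; rewrite -/I -/V in h.
  have tE : t ^+ n * t `^ q = t `^ (n%:R + q).
    by rewrite powRD ?powR_mulrn ?(ltW t0)// gt_eqF ?implybT.
  rewrite tE in h.
  have h2 := powR_tangent s1 erefl (ler01 : 0 <= (1 : R)) (ltW t0); rewrite powR1 in h2.
  have h3 := one_sub_exp n t0 (ltW t1).
  have u0 : 0 < 1 - t by rewrite subr_gt0.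
  rewrite -(ler_pM2r u0).
  have h4 : (n%:R + q) * t `^ (n%:R + q - 1) * (1 - t) <= 1 - t `^ (n%:R + q).
    by rewrite -lerN2 -mulrN !opprB.
  have h5 := ler_wpM2l I0 h4; have h6 := ler_wpM2l V0 h3.
  rewrite !mulrA in h5 h6 *; apply: (le_trans h5); apply: (le_trans h).
  by rewrite (le_trans h6)// [V * _]mulrC.
have tc := @cvg_one_sub_harmonic R.
have tc2 : (fun k : nat => I * (n%:R + q) * (1 - k.+2%:R^-1) `^ (n%:R + q - 1)) @ \oo -->
    I * (n%:R + q).
  have := cvgMl_tmp (a := I * (n%:R + q)) (powR_cvg_gt0 (r := n%:R + q - 1) ltr01 tc).
  by rewrite powR1 mulr1; exact.
have : I * (n%:R + q) <= n%:R * V.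
  apply: (cvgr_to_le tc2); apply: nearW => k; apply: step.
    by rewrite subr_gt0 invf_lt1// ltr1n.
  by rewrite ltrBlDr ltrDl invr_gt0.
by rewrite mulrAC ler_pdivlMr.
Qed.

End homogeneous.

Lemma torsion_test_le {R : realType} {n : nat} (i0 : 'I_n) (p q C : R) (Om : set 'rV[R]_n) :
  1 < p -> q = p / (p - 1) -> open Om -> bounded_set Om -> 0 <= C ->
  (forall phi, test_function Om phi ->
    \int[lebesgue_rV n]_(x in Om) phi x <= C `^ q^-1 * energy p Om (grad phi) `^ p^-1) ->
  torsional_rigidity p Om <= C.
Proof.
move=> p1 qE oO bO C0 hC.
have mOm := open_measurable_rV oO.
have q0 : 0 < q by exact: lt_trans (conj_gt1 p1 qE).
have ex := torsion_solution_exists i0 p1 qE mOm bO.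
rewrite /torsional_rigidity /torsion_function.
(* By existence the chosen function is a solution and not merely the default value of [xget]. *)
have su := xgetPex (cst 0) ex.
have [g [_ _ _ h] ] := torsion_solutionP i0 p1 qE mOm bO su.
by have := h _ (powR_ge0 C q^-1) hC; rewrite powRVK// gt_eqF.
Qed.

Lemma torsion_test_ge {R : realType} {n : nat} (i0 : 'I_n) (p q : R) (Om : set 'rV[R]_n) phi :
  1 < p -> q = p / (p - 1) -> open Om -> bounded_set Om -> test_function Om phi ->
  0 <= torsional_rigidity p Om /\
  \int[lebesgue_rV n]_(x in Om) phi x <=
    torsional_rigidity p Om `^ q^-1 * energy p Om (grad phi) `^ p^-1.
Proof.
move=> p1 qE oO bO tphi.
have mOm := open_measurable_rV oO.
have ex := torsion_solution_exists i0 p1 qE mOm bO.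
rewrite /torsional_rigidity /torsion_function.
have su := xgetPex (cst 0) ex.
have [g [_ -> h _] ] := torsion_solutionP i0 p1 qE mOm bO su.
by split; [exact: energy_ge0|exact: h].
Qed.

Section ball_upper_bound.
Context {R : realType} {n : nat} (i0 : 'I_n).
Local Notation mu := (@lebesgue_rV R n).
Local Notation B := (@unit_ball R n).

Lemma unit_ballE : B = [set x | euclid_norm x < 1].
Proof. by apply/seteqP; split => x; rewrite /unit_ball /euclid_ball /= subr0. Qed.

Lemma open_unit_ball : open B.
Proof.
rewrite unit_ballE (_ : [set x | _] = (@euclid_norm R n) @^-1` [set s | s < 1])//.
by apply: open_comp => [x _|]; [exact: euclid_norm_continuous|exact: open_lt].
Qed.

Lemma bounded_unit_ball : bounded_set B.
Proof.
exists 1; split => // M M1 x; rewrite unit_ballE /= => x1.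
by apply: (le_trans (norm_le_euclid x)); apply: ltW; exact: lt_trans M1.
Qed.

Lemma euclid_normZ_gt0 (t : R) (y : 'rV[R]_n) : 0 < t ->
  euclid_norm (t *: y) = t * euclid_norm y.
Proof. by move=> t0; rewrite euclid_normZ gtr0_norm. Qed.

Lemma Rintegral_test_ball (p q : R) phi : 1 < p -> q = p / (p - 1) ->
  test_function B phi ->
  \int[mu]_(x in B) phi x <=
  n%:R^-1 * (n%:R / (n%:R + q) * volume B) `^ q^-1 * energy p B (grad phi) `^ p^-1.
Proof.
move=> p1 qE tphi.
have q1 := conj_gt1 p1 qE; have q0 : 0 < q by exact: lt_trans q1.
have mB := open_measurable_rV open_unit_ball.
have bB := bounded_unit_ball.
have n0 : (0 : R) < n%:R by rewrite ltr0n (leq_trans _ (ltn_ord i0)).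
have Vg := VLp_grad p1 mB tphi.
have mN : measurable_fun B (@euclid_norm R n).
  apply: measurable_funS (continuous_measurable_rV _) => //.
  exact: euclid_norm_continuous.
have mG := measurable_euclid Vg.
have iGp : mu.-integrable B (EFin \o (fun y => `|euclid_norm (grad phi y)| `^ p)).
  rewrite (_ : (fun y => `|euclid_norm (grad phi y)| `^ p) = (fun y => euclid_norm (grad phi y) `^ p)).
    exact: (integrable_energy i0 p1 qE mB Vg).
  by apply/funext => y; rewrite ger0_norm ?euclid_norm_ge0.
have iNq : mu.-integrable B (EFin \o (fun y => `|euclid_norm y| `^ q)).
  apply: (bounded_integrable (M := 1)) => //; first exact: measurable_powRn.
  move=> y; rewrite unit_ballE /= => y1; rewrite ger0_norm ?powR_ge0//.
  have : `|euclid_norm y| `^ q <= 1 `^ q.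
    by apply: le_powR; [exact: ltW|exact: normr_ge0|rewrite ger0_norm ?euclid_norm_ge0// ltW].
  by rewrite powR1.
have [iGN hH] := Lp_hoelder mB p1 qE mG mN iGp iNq.
have tc i : test_function B (fun x => x ord0 i * partial i phi x).
  by apply: testM; [exact: smooth_coord|exact: test_partial].
have ic i := integrableS measurableT mB (@subsetT _ B) (test_integrable (tc i)).
have iphi := integrableS measurableT mB (@subsetT _ B) (test_integrable tphi).
have E : \int[mu]_(x in B) (\sum_i x ord0 i * partial i phi x) = - (n%:R * \int[mu]_(x in B) phi x).
  rewrite (Rintegral_sumr mB ic).
  rewrite (eq_bigr (fun=> - \int[mu]_(x in B) phi x)); last first.
    move=> i _; rewrite (Rintegral_test_partialM i tphi (smooth_coord i)) partial_coord.
    by congr (- _); apply: eq_Rintegral => x _; rewrite eqxx mul1r.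
  by rewrite sumrN sumr_const card_ord [X in - X = _](esym (mulr_natl _ _)).
have h1 : n%:R * \int[mu]_(x in B) phi x <= \int[mu]_(x in B) `|euclid_norm (grad phi x) * euclid_norm x|.
  rewrite -[leLHS]opprK -E -mulN1r.
  have iS := integrable_sumr mB ic.
  rewrite -(RintegralZl _ mB iS).
  apply: (le_Rintegral mB (integrable_scaler mB _ iS) (integrable_norm iGN)) => x _.
  rewrite mulN1r /= ger0_norm ?mulr_ge0 ?euclid_norm_ge0//.
  apply: (le_trans (ler_norm _)); rewrite normrN mulrC.
  have := cauchy_schwarz_norm x (grad phi x); congr (`|_| <= _).
  by apply: eq_bigr => i _; rewrite !mxE.
have h2 := le_trans h1 hH.
have E1 : \int[mu]_(x in B) (`|euclid_norm (grad phi x)| `^ p) = energy p B (grad phi).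
  by apply: eq_Rintegral => y _; rewrite ger0_norm ?euclid_norm_ge0.
have E2 : \int[mu]_(x in B) (`|euclid_norm x| `^ q) = \int[mu]_(x in B) (euclid_norm x `^ q).
  by apply: eq_Rintegral => y _; rewrite ger0_norm ?euclid_norm_ge0.
rewrite {}E1 {}E2 in h2.
(* The Euclidean norm is the gauge of the unit ball, so the factor n/(n+q) is the same as in the
   lower bound; this is why the two bounds meet on the ball. *)
have h3 := @Rintegral_homogeneous_le R n (@euclid_norm R n) (continuous_measurable_rV euclid_norm_continuous)
  euclid_norm_ge0 euclid_normZ_gt0.
rewrite -unit_ballE in h3; have {}h3 := h3 bB q q1.
have I0 : 0 <= \int[mu]_(x in B) (euclid_norm x `^ q).
  by apply: Rintegral_ge0 => y _; exact: powR_ge0.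
rewrite -mulrA ler_pdivlMl; last exact: n0.
apply: (le_trans h2); rewrite mulrC; apply: ler_wpM2r; first exact: powR_ge0.
by apply: le_powR I0 h3; rewrite invr_ge0 ltW.
Qed.

Lemma torsion_unit_ball_le (p q : R) : 1 < p -> q = p / (p - 1) ->
  torsional_rigidity p B <= volume B / (n%:R `^ (q - 1) * (n%:R + q)).
Proof.
move=> p1 qE.
have q1 := conj_gt1 p1 qE; have q0 : 0 < q by exact: lt_trans q1.
have n0 : (0 : R) < n%:R by rewrite ltr0n (leq_trans _ (ltn_ord i0)).
have V0 : 0 <= volume B by exact: fine_ge0.
have s0 : 0 < n%:R + q by rewrite addr_gt0.
have nq : 0 < n%:R `^ (q - 1) by exact: powR_gt0.
apply: (torsion_test_le i0 p1 qE open_unit_ball bounded_unit_ball).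
  by rewrite divr_ge0// mulr_ge0// ltW.
move=> phi tphi; apply: (le_trans (Rintegral_test_ball p1 qE tphi)).
rewrite ler_wpM2r ?powR_ge0// le_eqVlt; apply/orP; left; apply/eqP.
have -> : n%:R^-1 = (n%:R^-1 `^ q) `^ q^-1 by rewrite powRK ?gt_eqF// invr_ge0 ltW.
have X0 : 0 <= n%:R / (n%:R + q) * volume B by rewrite mulr_ge0// divr_ge0// ltW.
rewrite -(powRM _ (powR_ge0 _ _) X0); congr (_ `^ _).
have -> : n%:R^-1 `^ q = (n%:R `^ (q - 1) * n%:R)^-1 :> R.
  rewrite [_ `^ (q - 1) * _]mulrC mulr_powRB1 ?(ltW n0)//.
  by rewrite -powR_inv1 ?(ltW n0)// -powRrM mulN1r powRN.
by field; rewrite !gt_eqF.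
Qed.
End ball_upper_bound.

(** * Mollifiers *)

Section flat_functions.
Context {R : realType}.
Implicit Types (P : {poly R}) (t s : R).

(** P(1/t) exp(-1/t), extended by 0. All polynomials P are taken together because differentiation
    maps P to X^2 (P - P') and so preserves the family. *)
Definition flat P t : R := if 0 < t then P.[t^-1] * expR (- t^-1) else 0.

Lemma flat_ge0 t : 0 <= flat 1 t.
Proof. by rewrite /flat; case: ifP => // _; rewrite hornerC mul1r expR_ge0. Qed.

Lemma horner_abs_le P : exists2 A : R, 0 <= A & forall s, 1 <= s -> `|P.[s]| <= A * s ^+ size P.
Proof.
exists (\sum_(i < size P) `|P`_i|); first by apply: sumr_ge0.
move=> s s1; rewrite horner_coef; apply: (le_trans (ler_norm_sum _ _ _)).
rewrite mulr_suml; apply: ler_sum => i _; rewrite normrM; apply: ler_wpM2l => //.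
rewrite ger0_norm ?exprn_ge0 ?(le_trans ler01)//.
by rewrite ler_weXn2l// ltnW.
Qed.

(** The exponential series at s = 1/t contains s^(d+2)/(d+2)!, with two powers more than P needs.
    The resulting factor t^2 gives derivative 0 at the origin. *)
Lemma flat_le P : exists2 A : R, 0 <= A & forall t, `|t| <= 1 -> `|flat P t| <= A * t ^+ 2.
Proof.
have [A A0 hA] := horner_abs_le P.
pose d := size P.
exists (A * (d.+2)`!%:R); first by rewrite mulr_ge0.
move=> t t1; rewrite /flat; case: ifPn => [t0|_]; last first.
  by rewrite normr0 mulr_ge0 ?sqr_ge0// mulr_ge0.
rewrite gtr0_norm// in t1.
have s1 : 1 <= t^-1 by rewrite invf_ge1.
have s0 : 0 < t^-1 by rewrite invr_gt0.
rewrite normrM (ger0_norm (expR_ge0 _)) expRN.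
have e0 := expR_gt0 t^-1.
rewrite ler_pdivrMr//; apply: (le_trans (hA _ s1)).
rewrite -!mulrA ler_wpM2l//.
have := expR_ge1Dxn d.+1 (ltW s0) => he.
have he2 : t^-1 ^+ d.+2 / (d.+2)`!%:R <= expR t^-1 by apply: le_trans he; rewrite lerDr.
rewrite ler_pdivrMr ?ltr0n ?fact_gt0// in he2.
have -> : t^-1 ^+ size P = t^-1 ^+ d.+2 * t ^+ 2.
  by rewrite -addn2 exprD -mulrA -exprMn mulVf ?gt_eqF// expr1n mulr1.
have := ler_wpM2r (sqr_ge0 t) he2; congr (_ <= _); ring.
Qed.

Lemma is_derive_flat P t : is_derive t 1 (flat P) (flat ('X^2 * (P - P^`())) t).
Proof.
have [t0|t0|<-] := ltgtP 0 t.
- have d1 : is_derive t (1 : R) (fun s : R => s^-1) (- t ^- 2 *: 1).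
    exact: (@is_deriveV R id t 1 1 (lt0r_neq0 t0)).
  have d2 := @is_derive1_comp R (horner P) (fun s => s^-1) t _ _ (is_derive_poly P t^-1) d1.
  have d3 : is_derive t (1 : R) (fun s : R => - s^-1) (- (- t ^- 2 *: 1)) by exact: is_deriveN.
  have d4 := @is_derive1_comp R expR (fun s => - s^-1) t _ _ (is_derive_expR (- t^-1)) d3.
  have d5 := is_deriveM d2 d4.
  apply: (@near_eq_is_derive _ _ _ ((horner P \o (fun s => s^-1)) * (expR \o (fun s => - s^-1)))).
    near=> s; rewrite /flat ifT//; near: s; exact: lt_nbhsr.
  apply: (is_derive_eq d5).
  rewrite /flat t0 /= !hornerE /GRing.scale/= -exprVn; ring.
- have E : \forall s \near t, (cst 0 : R -> R) s = flat P s.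
    near=> s; rewrite /flat ifF//=; apply/negbTE; rewrite -leNgt ltW//.
    by near: s; exact: lt_nbhsl.
  apply: (near_eq_is_derive E).
  rewrite /flat ltNge (ltW t0)/=; exact: is_derive_cst.
- have [A A0 hA] := flat_le P.
  have f0 : flat P 0 = 0 by rewrite /flat ltxx.
  have E : (fun h : R => h^-1 *: ((flat P \o shift 0) (h *: 1) - flat P 0)) @ 0^' --> (0 : R).
    apply/cvgrPdist_le => e e0; near=> h.
    have h0 : h != 0 by near: h; exact: nbhs_dnbhs_neq.
    rewrite sub0r normrN f0 subr0 /= addr0 [h *: 1]mulr1.
    have h1 : `|h| <= 1.
      by near: h; apply: dnbhs0_le.
    have h2 : `|h| <= e / (A + 1).
      by near: h; apply: dnbhs0_le; rewrite divr_gt0// ltr_wpDl.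
    rewrite [_ *: _]/GRing.scale/= normrM normfV ler_pdivrMl ?normr_gt0//.
    apply: (le_trans (hA h h1)).
    rewrite -[h ^+ 2]real_normK ?num_real// expr2 mulrCA ler_wpM2l//.
    rewrite (@le_trans _ _ ((A + 1) * `|h|))//; first by rewrite ler_wpM2r// lerDl.
    by rewrite mulrC -ler_pdivlMr// ltr_wpDl.
  have -> : flat ('X^2 * (P - P^`())) 0 = 0 by rewrite /flat ltxx.
  by split; [apply/cvg_ex; eexists; exact: E|exact: cvg_lim E].
Unshelve. all: by end_near. Qed.

End flat_functions.

Section smooth_composition.
Context {R : realType} {n : nat}.
Implicit Types (phi psi u : 'rV[R]_n -> R).
Local Notation e_ i := (@delta_mx R 1 n ord0 i).

Lemma is_derive_comp_rV (F : R -> R) (dF : R) u x i : smooth u ->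
  is_derive (u x) 1 F dF -> is_derive x (e_ i) (F \o u) (dF * partial i u x).
Proof.
move=> su HF; pose g (t : R) := u (x + t *: e_ i).
have g0 : g 0 = u x by rewrite /g scale0r addr0.
have gd : is_derive (0 : R) (1 : R) g (partial i u x).
  have E : (fun h : R => h^-1 *: ((g \o shift 0) (h *: 1) - g 0)) =
      (fun h => h^-1 *: ((u \o shift x) (h *: e_ i) - u x)).
    apply/funext => h; rewrite g0; congr (_ *: (_ - _)); rewrite /= /g addr0 [h *: 1]mulr1.
    by congr u; exact: addrC.
  split; first by rewrite /derivable E; exact: smooth_derivable.
  by rewrite /derive E.
have HF' : is_derive (g 0) 1 F dF by rewrite g0.
have [d1 d2] := is_derive1_comp HF' gd.
have E : (fun h : R => h^-1 *: (((F \o g) \o shift 0) (h *: 1) - (F \o g) 0)) =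
    (fun h => h^-1 *: (((F \o u) \o shift x) (h *: e_ i) - (F \o u) x)).
  apply/funext => h; rewrite /= g0; congr (_ *: (F _ - _)); rewrite /g addr0 [h *: 1]mulr1.
  by congr u; exact: addrC.
split; first by move: d1; rewrite /derivable E.
by move: d2; rewrite /derive E.
Qed.

(** A class stable under the chain rule, for use with [smooth_closed]: the derivative of [F \o u] is
    some [G \o u] times a derivative of [u]. *)
Inductive comp_algebra (S : (R -> R) -> Prop) u : ('rV[R]_n -> R) -> Prop :=
| Comp_smooth phi of smooth phi : comp_algebra S u phi
| Comp_comp F of S F : comp_algebra S u (F \o u)
| Comp_mul phi psi of comp_algebra S u phi & comp_algebra S u psi :
    comp_algebra S u (fun x => phi x * psi x)
| Comp_add phi psi of comp_algebra S u phi & comp_algebra S u psi :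
    comp_algebra S u (fun x => phi x + psi x).

Lemma smooth_comp (S : (R -> R) -> Prop) u : smooth u ->
  (forall F, S F -> exists2 G, S G & forall t : R, is_derive t 1 F (G t)) ->
  forall F, S F -> smooth (F \o u).
Proof.
move=> su HS F SF.
apply: (@smooth_closed _ _ (comp_algebra S u)); last exact: Comp_comp.
move=> {F SF} phi; elim => {phi} [phi sphi|F SF|phi psi af [cf df pf] ag [cg dg pg]|phi psi af [cf df pf] ag [cg dg pg]].
- split; [exact: smooth_continuous|by move=> i x; exact: smooth_derivable|].
  by move=> i; apply: Comp_smooth; exact: smooth_partial.
- have [G SG FG] := HS F SF; split.
  + move=> x; apply: continuous_comp; first exact: smooth_continuous.
    by apply/differentiable_continuous/derivable1_diffP; exact: (@ex_derive _ _ _ _ _ _ _ (FG _)).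
  + by move=> i x; exact: (@ex_derive _ _ _ _ _ _ _ (is_derive_comp_rV i su (FG (u x)))).
  + move=> i; rewrite (_ : partial i (F \o u) = (fun x => (G \o u) x * partial i u x)).
      by apply: Comp_mul; [exact: Comp_comp|apply: Comp_smooth; exact: smooth_partial].
    apply/funext => x; exact: (@derive_val _ _ _ _ _ _ _ (is_derive_comp_rV i su (FG (u x)))).
- split.
  + by move=> x; apply: (@continuousM _ _ phi psi); [exact: cf|exact: cg].
  + by move=> i x; apply: derivableM.
  + by move=> i; rewrite partialM//; apply: Comp_add; apply: Comp_mul.
- split.
  + by move=> x; apply: (@continuousD _ _ _ phi psi); [exact: cf|exact: cg].
  + by move=> i x; apply: derivableD.
  + by move=> i; rewrite partialD//; apply: Comp_add.
Qed.

Lemma smooth_sum (I : Type) (s : seq I) (F : I -> 'rV[R]_n -> R) :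
  (forall i, smooth (F i)) -> smooth (fun x => \sum_(i <- s) F i x).
Proof.
move=> sF; elim: s => [|i s ih].
  by rewrite (_ : (fun x => _) = cst 0); [exact: smooth_cst|apply/funext => x; rewrite big_nil].
rewrite (_ : (fun x => _) = (fun x => F i x + \sum_(j <- s) F j x)).
  exact: smoothD.
by apply/funext => x; rewrite big_cons.
Qed.

Lemma smooth_sqr_norm : smooth (fun x : 'rV[R]_n => dotrV x x).
Proof.
rewrite /dotrV; apply: smooth_sum => i.
by apply: smoothM; exact: smooth_coord.
Qed.

(** The classical exp(-1/(d^2 - |x|^2)). The squared norm is a polynomial, so there is no
    singularity at the origin. *)
Definition bump (d : R) (x : 'rV[R]_n) : R := flat 1 (d ^+ 2 - dotrV x x).

Lemma bump_supp (d : R) x : 0 < d -> bump d x != 0 -> euclid_norm x < d.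
Proof.
move=> d0; rewrite /bump /flat; case: ifPn => [|_]; last by rewrite eqxx.
by rewrite subr_gt0 -sqr_euclid_norm ltr_pXn2r ?nnegrE ?euclid_norm_ge0 ?(ltW d0).
Qed.

Lemma bump_ge0 (d : R) x : 0 <= bump d x.
Proof. exact: flat_ge0. Qed.

Lemma test_bump (d : R) : 0 < d -> test_function setT (bump d).
Proof.
move=> d0; split => //.
- have su : smooth (fun x : 'rV[R]_n => d ^+ 2 - dotrV x x).
    rewrite (_ : (fun x => _) = (fun x => d ^+ 2 + (-1) * dotrV x x)).
      apply: smoothD; first exact: smooth_cst.
      by apply: smoothZ; exact: smooth_sqr_norm.
    by apply/funext => x; rewrite mulN1r.
  apply: (smooth_comp (S := [set F | exists P, F = flat P]) su _ (F := flat 1)); last by exists 1.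
  move=> _ [P ->]; exists (flat ('X^2 * (P - P^`()))); first by eexists.
  by move=> t; exact: is_derive_flat.
- have K : closed [set x : 'rV[R]_n | euclid_norm x <= d].
    rewrite (_ : [set x | _] = (@euclid_norm R n) @^-1` [set s | s <= d])//.
    by apply: closed_comp => [x _|]; [exact: euclid_norm_continuous|exact: closed_le].
  apply: bounded_closed_compact; last exact: closed_closure.
  exists d; split; first exact: num_real.
  move=> M dM x cx; apply: (le_trans (norm_le_euclid x)); apply: le_trans (ltW dM).
  have /closure_subset : [set x | bump d x != 0] `<=` [set x : 'rV[R]_n | euclid_norm x <= d].
    by move=> y /= /(bump_supp d0)/ltW.
  by move=> /(_ x cx); rewrite -(closure_id _).1.
Qed.

End smooth_composition.

Section positive_volume.
Context {R : realType} {n : nat}.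
Local Notation mu := (@lebesgue_rV R n).

Lemma open_volume_gt0 (Om : set 'rV[R]_n) : open Om -> bounded_set Om -> Om !=set0 ->
  0 < volume Om.
Proof.
move=> oO bO [x Ox].
have mO := open_measurable_rV oO.
have /nbhs_ballP[e /= e0 he] : nbhs x Om by exact: open_nbhs_nbhs.
pose I (i : 'I_n) : set (measurableTypeR R) := `]x ord0 i - e / 2, x ord0 i + e / 2[%classic.
have BO : [set y : 'rV[R]_n | forall i, I i (y ord0 i)] `<=` Om.
  move=> y /= hy; apply: he; rewrite -ball_normE /ball_/=.
  apply: (@le_lt_trans _ _ (e / 2)); last by rewrite ltr_pdivrMr// ltr_pMr// ltr1n.
  apply: norm_le_coord; first by rewrite divr_ge0// ltW.
  move=> i k; rewrite (ord1 i) !mxE; have := hy k; rewrite /I/= in_itv/= => /andP[h1 h2].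
  by rewrite ler_norml; apply/andP; split; lra.
have mI i : measurable (I i) by exact: measurable_itv.
have muB : mu [set y : 'rV[R]_n | forall i, I i (y ord0 i)] = (e ^+ n)%:E.
  rewrite (lebesgue_rV_box mI) (eq_bigr (fun=> e%:E)); last first.
    move=> i _; rewrite /I lebesgue_measure_itv/= lte_fin ifT; last by lra.
    by rewrite -EFinB; congr (_%:E); lra.
  rewrite prodEFin; congr (_%:E); rewrite prodr_const card_ord//.
have fin := bounded_lebesgue_rV_lty mO bO.
rewrite /volume -lte_fin fineK; last by rewrite ge0_fin_numE.
apply: (@lt_le_trans _ _ (e ^+ n)%:E); first by rewrite lte_fin exprn_gt0.
rewrite -muB; apply: le_measure; rewrite ?inE//.
exact: (measurable_box mI).
Qed.

End positive_volume.

(** * Smoothing by an integral kernel *)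

Section convolution.
Context {R : realType} {n : nat}.
Local Notation mu := (@lebesgue_rV R n).
Local Notation e_ i := (@delta_mx R 1 n ord0 i).
Variables (w : 'rV[R]_n -> R).
Hypothesis iw : mu.-integrable setT (EFin \o w).
Implicit Types (psi : 'rV[R]_n -> R) (x y : 'rV[R]_n).

Let mw : measurable_fun setT w. Proof. exact: integrable_measurable iw. Qed.
Let iw' : mu.-integrable setT (EFin \o (fun y => `|w y|)). Proof. exact: (integrable_norm iw). Qed.

(** A correlation: the kernel is taken at [y - x], which after a shift becomes an average of
    [w (z + x)]. This accounts for the minus sign in the derivative. *)
Definition convol psi x : R := \int[mu]_y (psi (y - x) * w y).

Lemma convol_integrable psi x : test_function setT psi ->
  mu.-integrable setT (EFin \o (fun y => psi (y - x) * w y)).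
Proof.
move=> tpsi; have [M M0 bM] := test_bounded tpsi.
apply: (integrable_dominated measurableT _ (integrable_scaler measurableT M iw')).
  apply: measurable_funM => //.
  exact: (measurableT_comp (test_measurable tpsi) (measurable_shift (- x))).
by move=> y _; rewrite normrM ler_wpM2r.
Qed.

Lemma convolE psi x : test_function setT psi ->
  mu.-integrable setT (EFin \o (fun z => psi z * w (z + x))) /\
  convol psi x = \int[mu]_z (psi z * w (z + x)).
Proof.
move=> tpsi; have ic := convol_integrable x tpsi.
have E : (fun z => psi z * w (z + x)) = (fun z => psi (z + x - x) * w (z + x)).
  by apply/funext => z; rewrite addrK.
split; first by rewrite E; exact: (integrable_shift x ic).
rewrite /convol -(Rintegral_shift x (f := fun y => psi (y - x) * w y)).
  by apply: eq_Rintegral => z _; rewrite addrK.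
exact: integrable_measurable ic.
Qed.

Lemma convol_continuous psi : test_function setT psi -> continuous (convol psi).
Proof.
move=> tpsi; have [L L0 hL] := test_lipschitz tpsi.
apply: (lipschitz_continuous (L := L * \int[mu]_y `|w y|)) => x y.
have i1 := convol_integrable x tpsi; have i2 := convol_integrable y tpsi.
rewrite /convol -(RintegralB measurableT i1 i2).
have i3 := integrable_subr measurableT i1 i2.
apply: (le_trans (le_normr_Rintegral measurableT i3)).
rewrite mulrAC -(RintegralZl _ measurableT iw').
apply: (le_Rintegral measurableT (integrable_norm i3) (integrable_scaler measurableT _ iw')) => z _ /=.
rewrite -mulrBl normrM ler_wpM2r//.
have := hL (z - y) (y - x); rewrite subrKA distrC [in X in _ -> _ <= X]distrC.
by rewrite distrC.
Qed.

(** The partial derivatives of the kernel are Lipschitz, so its first-order remainder is at most L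
    h^2 uniformly. Integrated against [|w|] this still is O(h^2), for any integrable [w]. *)
Lemma is_derive_convol psi x i : test_function setT psi ->
  is_derive x (e_ i) (convol psi) (- convol (partial i psi) x).
Proof.
move=> tpsi; have ti := test_partial i tpsi.
have [L L0 hL] := test_lipschitz ti.
pose I := \int[mu]_y `|w y|.
have I0 : 0 <= I by exact: Rintegral_ge0.
have spsi : smooth psi by case: tpsi.
have est z (h : R) : `|psi (z - h *: e_ i) - psi z + h * partial i psi z| <= L * h ^+ 2.
  have [c ch /= E] := mean_value_coord z (- h) (fun y => (spsi [::]).2 i y).
  have -> : psi (z - h *: e_ i) - psi z + h * partial i psi z =
      h * (partial i psi z - partial i psi (z + c *: e_ i)).
    by rewrite -scaleNr E; ring.
  rewrite normrM distrC.
  rewrite -[h ^+ 2]real_normK ?num_real// expr2 mulrCA ler_wpM2l//.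
  apply: (le_trans (hL z (c *: e_ i))); rewrite ler_wpM2l// normrZ.
  rewrite normrN in ch; rewrite -[leRHS]mulr1 ler_pM//.
  apply: norm_le_coord => // a b; rewrite mxE.
  by case: (_ && _); rewrite ?normr1 ?normr0.
have key (h : R) : `|convol psi (x + h *: e_ i) - convol psi x - h * (- convol (partial i psi) x)| <= L * h ^+ 2 * I.
  have i1 := convol_integrable (x + h *: e_ i) tpsi; have i2 := convol_integrable x tpsi.
  have i3 := convol_integrable x ti.
  have i12 := integrable_subr measurableT i1 i2.
  have i3h := integrable_scaler measurableT h i3.
  have ia := integrable_addr measurableT i12 i3h.
  rewrite mulrN opprK /convol -(RintegralB measurableT i1 i2) -(RintegralZl h measurableT i3).
  rewrite -(RintegralD measurableT i12 i3h).
  apply: (le_trans (le_normr_Rintegral measurableT ia)).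
  rewrite /I -(RintegralZl _ measurableT iw').
  apply: (le_Rintegral measurableT (integrable_norm ia) (integrable_scaler measurableT _ iw')) => z _ /=.
  rewrite mulrA -mulrBl -mulrDl normrM ler_wpM2r//.
  by rewrite opprD addrA; exact: est.
have E : (fun h : R => h^-1 *: ((convol psi \o shift x) (h *: e_ i) - convol psi x)) @ 0^' -->
    - convol (partial i psi) x.
  apply/cvgrPdist_le => e e0; near=> h.
  have h0 : h != 0 by near: h; exact: nbhs_dnbhs_neq.
  have h2 : `|h| <= e / (L * I + 1).
    by near: h; apply: dnbhs0_le; rewrite divr_gt0// ltr_wpDl// mulr_ge0.
  have -> : (convol psi \o shift x) (h *: e_ i) = convol psi (x + h *: e_ i).
    by rewrite /= addrC.
  rewrite [_ *: _]/GRing.scale/= distrC.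
  rewrite -[X in _ - X](mulKf h0) -mulrBr normrM normfV ler_pdivrMl ?normr_gt0//.
  apply: (le_trans (key h)).
  rewrite -[h ^+ 2]real_normK ?num_real// expr2.
  rewrite mulrAC mulrA [_ * `|h|]mulrC ler_wpM2l//.
  rewrite (@le_trans _ _ ((L * I + 1) * `|h|))//; first by rewrite ler_wpM2r// lerDl.
  by rewrite mulrC -ler_pdivlMr// ltr_wpDl// mulr_ge0.
by split; [apply/cvg_ex; eexists; exact: E|exact: cvg_lim E].
Unshelve. all: by end_near. Qed.

Lemma smooth_convol psi : test_function setT psi -> smooth (convol psi).
Proof.
move=> tpsi; apply: (@smooth_closed _ _ [set f | exists psi, test_function setT psi /\ f = convol psi]); last by exists psi.
move=> _ [{tpsi}psi [tpsi ->] ]; split; first exact: convol_continuous.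
- by move=> i x; exact: (@ex_derive _ _ _ _ _ _ _ (is_derive_convol x i tpsi)).
- move=> i; have ti := test_partial i tpsi; exists (fun y => (-1) * partial i psi y).
  split; first exact: testZ.
  apply/funext => x; rewrite [LHS](@derive_val _ _ _ _ _ _ _ (is_derive_convol x i tpsi)).
  rewrite -[LHS]mulN1r /convol -(RintegralZl _ measurableT (convol_integrable x ti)).
  by apply: eq_Rintegral => y _; rewrite mulrA.
Qed.

End convolution.

Lemma powR_cvg_ge0 {R : realType} (a : nat -> R) (l r : R) : 0 < r -> 0 <= l ->
  (forall k, 0 <= a k) -> a @ \oo --> l -> (fun k => a k `^ r) @ \oo --> l `^ r.
Proof.
move=> r0 l0 a0 al; have [l00|ln0] := eqVneq l 0.
  by rewrite l00 powR0 ?gt_eqF//; rewrite l00 in al; exact: powR_cvg0.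
by apply: powR_cvg_gt0 => //; rewrite lt_neqAle eq_sym ln0.
Qed.

Section mollifier.
Context {R : realType} {n : nat}.
Local Notation mu := (@lebesgue_rV R n).

Lemma mollifier_exists (d : R) : 0 < d -> exists rho : 'rV[R]_n -> R,
  [/\ test_function setT rho, forall x, 0 <= rho x,
    forall x, rho x != 0 -> euclid_norm x < d & \int[mu]_x rho x = 1].
Proof.
move=> d0; have tb := @test_bump R n d d0; have ib := test_integrable tb.
have cb := test_continuous tb.
have b0 : 0 < bump d (0 : 'rV[R]_n).
  rewrite /bump /flat dotrV0l subr0 exprn_gt0// hornerC mul1r; exact: expR_gt0.
pose b : R := bump d (0 : 'rV[R]_n) / 2.
have bp : 0 < b by rewrite divr_gt0.
pose W := [set x : 'rV[R]_n | b < bump d x].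
have oW : open W.
  rewrite (_ : W = (@bump R n d) @^-1` [set s | b < s])//.
  by apply: open_comp => [x _|]; [exact: cb|exact: open_gt].
have mW := open_measurable_rV oW.
have bW : bounded_set W.
  exists d; split; first exact: num_real.
  move=> M dM x /= Wx; apply: (le_trans (norm_le_euclid x)); apply: le_trans (ltW dM).
  by apply: ltW; apply: (bump_supp d0); rewrite gt_eqF// (lt_trans bp).
have vW : 0 < volume W.
  apply: open_volume_gt0 => //; exists 0; rewrite /W/= /b.
  by rewrite ltr_pdivrMr// ltr_pMr// ltr1n.
have I0 : 0 < \int[mu]_x bump d x.
  apply: (@lt_le_trans _ _ (b * volume W)); first exact: mulr_gt0.
  have iW : mu.-integrable W (EFin \o (fun=> b)).
    by apply: (bounded_integrable (M := b)) => // x _; rewrite gtr0_norm.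
  rewrite -(Rintegral_cst _ mW) Rintegral_mkcond.
  apply: le_Rintegral => //.
    by rewrite -restrict_EFin; apply/(integrable_mkcond _ mW).
  move=> x _; rewrite /patch; case: ifPn => [|_]; last exact: bump_ge0.
  by rewrite inE => /ltW.
pose I : R := \int[mu]_x bump d x.
exists (fun x => I^-1 * bump d x); split.
- exact: testZ.
- by move=> x; rewrite mulr_ge0 ?bump_ge0// invr_ge0 ltW.
- by move=> x; rewrite mulf_eq0 negb_or => /andP[_]; exact: bump_supp.
- by rewrite (RintegralZl _ measurableT ib) mulVf// gt_eqF.
Qed.

Section mollify.
Variables (d : R) (rho w : 'rV[R]_n -> R).
Hypotheses (trho : test_function setT rho) (rho0 : forall x, 0 <= rho x)
  (srho : forall x, rho x != 0 -> euclid_norm x < d) (rho1 : \int[mu]_x rho x = 1)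
  (iw : mu.-integrable setT (EFin \o w)).

Let irho := test_integrable trho.
Let rhoE (a : R) : a = \int[mu]_x (a * rho x).
Proof. by rewrite (RintegralZl _ measurableT irho) rho1 mulr1. Qed.

Lemma mollify_ge x (a : R) : (forall z, euclid_norm z < d -> a <= w (z + x)) ->
  a <= convol w rho x.
Proof.
move=> wa; have [ic ->] := convolE iw x trho; rewrite {1}(rhoE a).
apply: (le_Rintegral measurableT (integrable_scaler measurableT a irho) ic) => z _.
have [->|rz] := eqVneq (rho z) 0; first by rewrite mulr0 mul0r.
by rewrite mulrC ler_wpM2l// wa// srho.
Qed.

Lemma mollify_dist x y (a : R) : (forall z, euclid_norm z < d -> w (z + y) - w (z + x) <= a) ->
  convol w rho y - convol w rho x <= a.
Proof.
move=> wa; have [icx ->] := convolE iw x trho; have [icy ->] := convolE iw y trho.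
rewrite (rhoE a) -(RintegralB measurableT icy icx).
apply: (le_Rintegral measurableT (integrable_subr measurableT icy icx) (integrable_scaler measurableT a irho)) => z _.
rewrite -mulrBr.
have [->|rz] := eqVneq (rho z) 0; first by rewrite mulr0 mul0r.
by rewrite [leRHS]mulrC ler_wpM2l// wa// srho.
Qed.

Lemma mollify_eq0 x : (forall z, euclid_norm z < d -> w (z + x) = 0) -> convol w rho x = 0.
Proof.
move=> w0; have [_ ->] := convolE iw x trho.
rewrite (_ : (fun z => _) = cst 0); first by rewrite Rintegral_cst// mul0r.
apply/funext => z; have [->|rz] := eqVneq (rho z) 0; first by rewrite mul0r.
by rewrite w0 ?mulr0// srho.
Qed.

End mollify.
End mollifier.

(** * Lower bound by the inradius *)

Section profile.
Context {R : realType}.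
Variables (q eta lam : R).
Hypotheses (q1 : 1 < q) (eta0 : 0 < eta) (lam0 : 0 < lam).
Let q0 : 0 < q. Proof. exact: lt_trans q1. Qed.

(** lam^q - t^q, made flat up to [eta] and cut off at 0. Mollification at scale [eta * r] changes
    the gauge by at most [eta], and the flattening compensates exactly: value and slope after
    mollification are bounded through j(x) itself. *)
Definition profile (t : R) : R := Num.max 0 (lam `^ q - (Num.max 0 (t - eta)) `^ q).

Lemma profile_ge0 t : 0 <= profile t.
Proof. by rewrite le_max lexx. Qed.

Lemma profile_le t : profile t <= lam `^ q.
Proof. by rewrite ge_max powR_ge0 gerBl powR_ge0. Qed.

Lemma profile_ge t s : 0 <= s -> t <= s + eta -> lam `^ q - s `^ q <= profile t.
Proof.
move=> s0 ts; rewrite le_max; apply/orP; right; rewrite lerD2l lerN2.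
by apply: le_powR; rewrite ?(ltW q0) ?le_max ?lexx// ge_max s0 lerBlDr.
Qed.

Lemma profile_eq0 t : lam + eta <= t -> profile t = 0.
Proof.
move=> ht; rewrite /profile max_l// subr_le0 le_powR ?(ltW q0) ?(ltW lam0)//.
by rewrite le_max lerBrDr ht orbT.
Qed.

(** After the flattening, arguments up to [M + eta] count as at most [M], where t^q has slope at
    most q M^(q-1). Taking positive parts does not increase differences. *)
Lemma profile_diff t s (M : R) : 0 <= M -> t <= M + eta ->
  s <= M + eta -> profile t - profile s <= q * M `^ (q - 1) * `|t - s|.
Proof.
move=> M0 tM sM.
set a := Num.max 0 (s - eta); set b := Num.max 0 (t - eta).
have a0 : 0 <= a by rewrite le_max lexx.
have b0 : 0 <= b by rewrite le_max lexx.
have aM : a <= M by rewrite ge_max M0 lerBlDr.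
have ab : a - b <= `|t - s|.
  rewrite lerBlDr ge_max addr_ge0//=.
  have : t - eta <= b by rewrite le_max lexx orbT.
  have : s - t <= `|t - s| by rewrite distrC ler_norm.
  lra.
have rhs0 : 0 <= q * M `^ (q - 1) * `|t - s| by rewrite !mulr_ge0 ?powR_ge0// ltW.
have h : lam `^ q - b `^ q - (lam `^ q - a `^ q) <= q * M `^ (q - 1) * `|t - s|.
  rewrite opprB addrC addrA subrK addrC.
  have [ba|/ltW ab'] := leP b a.
    rewrite addrC; apply: (le_trans (powR_tangent q1 erefl b0 a0)).
    apply: ler_pM => //; rewrite ?subr_ge0// ?mulr_ge0 ?powR_ge0 ?(ltW q0)//.
    by rewrite ler_pM2l// le_powR// subr_ge0 ltW.
  by apply: le_trans rhs0; rewrite addrC subr_le0 le_powR// ltW.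
rewrite /profile -/a -/b; set A := lam `^ q - a `^ q in h *; set B := lam `^ q - b `^ q in h *.
rewrite lerBlDr ge_max; apply/andP; split.
  by rewrite addr_ge0// le_max lexx.
have : A <= Num.max 0 A by rewrite le_max lexx orbT.
lra.
Qed.

End profile.

(** Solves for T the Hoelder inequality of the test function, raised to the power [q]. *)
Lemma lower_bound_arith (R : realType) (N q r V T : R) : 0 < N -> 1 < q -> 0 < r -> 0 < V -> 0 <= T ->
  (q / (N + q) * V) `^ q <= T * ((q / r) `^ q * (N / (N + q) * V) `^ (q - 1)) ->
  V * r `^ q / (N `^ (q - 1) * (N + q)) <= T.
Proof.
move=> N0 Q1 R0 V0 T0 h.
have Q0 : 0 < q by exact: lt_trans Q1.
have s0 : 0 < N + q by rewrite addr_gt0.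
have K0 : 0 < (q / r) `^ q * (N / (N + q) * V) `^ (q - 1).
  by rewrite mulr_gt0// powR_gt0// !mulr_gt0// invr_gt0.
rewrite -(ler_pM2r K0); apply: le_trans h; rewrite le_eqVlt; apply/orP; left; apply/eqP.
have E (x : R) : 0 < x -> x `^ q = x * x `^ (q - 1) by move=> x0; rewrite mulr_powRB1// ltW.
have iv (x y : R) : 0 < x -> (x^-1) `^ y = (x `^ y)^-1.
  by move=> x0; rewrite -powR_inv1 ?(ltW x0)// -powRrM mulN1r powRN.
have M (x y z : R) : 0 < x -> 0 < y -> (x * y) `^ z = x `^ z * y `^ z.
  by move=> x0 y0; rewrite powRM// ltW.
have ir : 0 < r^-1 by rewrite invr_gt0.
have is0 : 0 < (N + q)^-1 by rewrite invr_gt0.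
have Ns : 0 < N / (N + q) by rewrite divr_gt0.
have qs : 0 < q / (N + q) by rewrite divr_gt0.
rewrite (M _ _ _ Q0 ir) (M _ _ _ Ns V0) (M _ _ _ N0 is0) (M _ _ _ qs V0) (M _ _ _ Q0 is0) !iv//.
rewrite (E V V0) (E _ s0) (E q Q0).
have P (x y : R) : 0 < x -> x `^ y != 0 by move=> x0; rewrite gt_eqF// powR_gt0.
by field; rewrite !P// ?gt_eqF.
Qed.

Section torsion_lower_bound.
Context {R : realType} {n : nat} (i0 : 'I_n).
Local Notation mu := (@lebesgue_rV R n).
Variables (p q : R) (Om : set 'rV[R]_n) (x0 : 'rV[R]_n) (r : R).
Hypotheses (p1 : 1 < p) (qE : q = p / (p - 1))
  (oO : open Om) (bO : bounded_set Om) (cO : convex_set Om) (r0 : 0 < r)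
  (ballO : euclid_ball x0 r `<=` Om).
Local Notation j x := (gauge Om x0 (x - x0)).

Let p0 : 0 < p. Proof. exact: lt_trans p1. Qed.
Let q1 : 1 < q. Proof. exact: conj_gt1 p1 qE. Qed.
Let q0 : 0 < q. Proof. exact: lt_trans q1. Qed.
Let mO : measurable Om. Proof. exact: open_measurable_rV. Qed.
Let j0 x : 0 <= j x. Proof. exact: gauge_ge0 r0 ballO _. Qed.
Let jO x : Om x <-> j x < 1. Proof. exact: gauge_lt1 oO cO r0 ballO x. Qed.
Let cj : continuous (fun x : 'rV[R]_n => j x). Proof. exact: gauge_continuous cO r0 ballO. Qed.
Let mj : measurable_fun setT (fun x : 'rV[R]_n => j x). Proof. exact: continuous_measurable_rV. Qed.

Lemma measurable_gauge : measurable_fun setT (gauge Om x0).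
Proof.
rewrite (_ : gauge Om x0 = (fun x => j x) \o (fun x => x + x0)).
  exact: (measurableT_comp mj (measurable_shift x0)).
by apply/funext => x; rewrite /= addrK.
Qed.

Lemma gauge_powR_integrable : mu.-integrable Om (EFin \o (fun x => j x `^ q)).
Proof.
apply: (bounded_integrable (M := 1)) => //.
  apply: measurable_funS (measurableT_comp (measurable_powR q) mj) => //.
move=> x /jO jx; rewrite ger0_norm ?powR_ge0//.
have : j x `^ q <= 1 `^ q by apply: le_powR; [exact: ltW|exact: j0|exact: ltW].
by rewrite powR1.
Qed.

Lemma Rintegral_gauge_le :
  \int[mu]_(x in Om) (j x `^ q) <= n%:R / (n%:R + q) * volume Om.
Proof.
pose W := [set y | gauge Om x0 y < 1].
have OW : (fun x => x + x0) @^-1` Om = W.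
  apply/seteqP; split => x /=.
    by move=> /jO; rewrite addrK.
  by move=> Wx; apply/jO; rewrite addrK.
have bW : bounded_set W.
  have [M [Mr OM] ] := bO.
  exists (`|M| + 1 + `|x0|); split; first exact: num_real.
  move=> N hN y Wy; apply: (le_trans _ (ltW hN)).
  rewrite -[y](addrK x0); apply: (le_trans (ler_normB _ _)); rewrite lerD2r.
  apply: (OM (`|M| + 1)); first by rewrite (le_lt_trans (ler_norm M))// ltrDl.
  by have : ((fun x => x + x0) @^-1` Om) y by rewrite OW.
have h := Rintegral_homogeneous_le measurable_gauge (gauge_ge0 r0 ballO)
  (fun t y t0 => gaugeZ r0 ballO y t0) bW q1.
have VW : volume W = volume Om by rewrite /volume -OW lebesgue_rV_shift.
rewrite -/W VW in h; apply: le_trans h; rewrite le_eqVlt; apply/orP; left; apply/eqP.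
rewrite [LHS]Rintegral_mkcond [RHS]Rintegral_mkcond.
rewrite -[LHS](Rintegral_shift x0); last first.
  apply/(measurable_restrictT _ mO).
  by apply: measurable_funS (measurableT_comp (measurable_powR q) mj).
apply: eq_Rintegral => y _; rewrite /patch addrK.
congr (if _ then _ else _); apply/idP/idP; rewrite !inE.
  by move=> Oy; rewrite -OW.
by rewrite -OW.
Qed.

Lemma lower_test_function (eta : R) : 0 < eta -> eta < 3^-1 ->
  exists phi, [/\ test_function Om phi,
    forall x, (1 - 3 * eta) `^ q - j x `^ q <= phi x &
    forall x, euclid_norm (grad phi x) <= q / r * j x `^ (q - 1)].
Proof.
(* Three margins: the profile vanishes from [lam + eta] on, the mollification spreads its support by
   another [eta], and the last [eta] keeps it compact in [Om]. *)
move=> e0 e3; pose lam : R := 1 - 3 * eta.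
have lam0 : 0 < lam by rewrite /lam; lra.
have d0 : 0 < eta * r by rewrite mulr_gt0.
have [rho [trho rho0 srho rho1] ] := @mollifier_exists R n _ d0.
pose w x : R := profile q eta lam (j x).
have mw : measurable_fun setT w.
  rewrite /w /profile; apply: measurable_maxr; first exact: measurable_cst.
  apply: measurable_funB; first exact: measurable_cst.
  apply: (measurableT_comp (measurable_powR q)).
  apply: measurable_maxr; first exact: measurable_cst.
  by apply: measurable_funB => //; exact: measurable_cst.
have [N hN] : exists N, forall x, w x != 0 -> `|x| <= N.
  have [M [Mr OM] ] := gauge_level_bounded bO cO r0 ballO (lam + eta).
  exists (`|M| + 1) => x wx; apply: OM; first by rewrite (le_lt_trans (ler_norm M))// ltrDl.
  rewrite /= leNgt; apply: contra wx => /ltW h; apply/eqP.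
  exact: profile_eq0.
have iw : mu.-integrable setT (EFin \o w).
  apply: (bounded_supp_integrable (M := lam `^ q) mw _ hN) => x.
  by rewrite ger0_norm ?profile_ge0// profile_le.
have jz x z : euclid_norm z < eta * r -> j (z + x) <= j x + eta /\ j x <= j (z + x) + eta.
  move=> zd; have := gauge_lipschitz cO r0 ballO (z + x - x0) (x - x0).
  have -> : z + x - x0 - (x - x0) = z by apply/rowP => i; rewrite !mxE; ring.
  move=> h; have {}h : `|j (z + x) - j x| <= eta.
    by apply: (le_trans h); rewrite ler_pdivrMr// ltW.
  by move: h; rewrite ler_norml => /andP[h1 h2]; split; lra.
exists (convol w rho); split.
- have sub : [set x | convol w rho x != 0] `<=` [set x | j x <= 1 - eta].
    move=> x /=; apply: contraNT; rewrite -ltNge => hx; apply/eqP.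
    apply: (mollify_eq0 trho srho iw) => z zd; have [h1 h2] := jz x z zd.
    by apply: profile_eq0 => //; rewrite /lam; lra.
  have cl := gauge_level_compact bO cO r0 ballO (t := 1 - eta).
  have cs : closure [set x | convol w rho x != 0] `<=` [set x | j x <= 1 - eta].
    move=> x cx; have := closure_subset sub cx.
    rewrite -(closure_id _).1//; apply: compact_closed cl.
    exact: norm_hausdorff.
  split; first exact: smooth_convol.
    by apply: subclosed_compact cl cs; exact: closed_closure.
  by move=> x /cs /= hx; apply/jO; lra.
- move=> x; apply: (mollify_ge trho rho0 srho rho1 iw) => z zd.
  by have [h1 _] := jz x z zd; apply: profile_ge.
- have sc := smooth_convol iw trho.
  (* The bound is proved for difference quotients. Up to [eta], the number [a k] bounds the gauge at
     both points of the averaged increment, and it tends to j(x), so no constant is lost. *)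
  have dir x v : dotrV v (grad (convol w rho) x) <= q / r * j x `^ (q - 1) * euclid_norm v.
    have c1 := smooth_quotient_cvg (x := x) (v := v) sc.
    pose a (k : nat) : R := j x + k.+1%:R^-1 * (euclid_norm v / r).
    have vr0 : 0 <= euclid_norm v / r by rewrite divr_ge0 ?euclid_norm_ge0// ltW.
    have a0 k : 0 <= a k by rewrite addr_ge0// mulr_ge0.
    have ac : a @ \oo --> j x.
      have h : (fun k : nat => k.+1%:R^-1 * (euclid_norm v / r)) @ \oo --> (0 : R).
        by have := cvgMr_tmp (b := euclid_norm v / r) (@cvg_harmonic R); rewrite mul0r; exact.
      by have := cvgD (cvg_cst (j x)) h; rewrite addr0; exact.
    have aqc := powR_cvg_ge0 (r := q - 1) _ (j0 x) a0 ac.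
    have q10 : 0 < q - 1 by rewrite subr_gt0.
    have c2 : (fun k => q / r * a k `^ (q - 1) * euclid_norm v) @ \oo -->
        q / r * j x `^ (q - 1) * euclid_norm v.
      by apply: cvgMr_tmp; apply: cvgMl_tmp; exact: aqc.
    apply: (ler_cvg_to c1 c2); apply: nearW => k.
    have k0 : (0 : R) < k.+1%:R^-1 by rewrite invr_gt0.
    rewrite -ler_pdivlMl ?ltr0n//.
    apply: (mollify_dist trho rho0 srho rho1 iw) => z zd.
    have [h1 _] := jz x z zd.
    have gl := gauge_lipschitz cO r0 ballO (z + (x + k.+1%:R^-1 *: v) - x0) (z + x - x0).
    have E : z + (x + k.+1%:R^-1 *: v) - x0 - (z + x - x0) = k.+1%:R^-1 *: v.
      by apply/rowP => i; rewrite !mxE; ring.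
    rewrite E euclid_normZ (gtr0_norm k0) -mulrA in gl.
    have h2 : j (z + (x + k.+1%:R^-1 *: v)) <= a k + eta.
      have h := le_trans (ler_norm _) gl; rewrite lerBlDr in h; apply: (le_trans h).
      by apply: (le_trans (lerD (lexx _) h1)); rewrite addrCA addrA lexx.
    have h3 : j (z + x) <= a k + eta by apply: (le_trans h1); rewrite lerD2r lerDl mulr_ge0// ltW.
    apply: (le_trans (profile_diff lam q1 (a0 k) h2 h3)).
    have aq0 : 0 <= q * a k `^ (q - 1) by rewrite mulr_ge0 ?powR_ge0// ltW.
    apply: (le_trans (ler_wpM2l aq0 gl)).
    by rewrite le_eqVlt; apply/orP; left; apply/eqP; field; rewrite !gt_eqF.
  (* With the gradient itself as direction, the directional bound becomes a bound on its norm. *)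
  move=> x; have := dir x (grad (convol w rho) x).
  have [->|g0] := eqVneq (grad (convol w rho) x) 0.
    by rewrite euclid_norm0 => _; rewrite mulr_ge0 ?powR_ge0// divr_ge0// ltW.
  have gp : 0 < euclid_norm (grad (convol w rho) x).
    by rewrite lt_neqAle eq_sym euclid_norm_eq0 g0 euclid_norm_ge0.
  by rewrite -sqr_euclid_norm expr2 ler_pM2r.
Qed.

(** Hoelder's inequality for a test function above lam^q - j^q. Since (q-1) p = q, the p-th power of
    the gradient bound is a multiple of j^q, so both sides involve only the integral of j^q. *)
Lemma lower_bound_step (lam : R) : lam < 1 -> 0 < lam ->
  (lam `^ q - n%:R / (n%:R + q)) * volume Om <=
  torsional_rigidity p Om `^ q^-1 *
    ((q / r) `^ p * (n%:R / (n%:R + q) * volume Om)) `^ p^-1.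
Proof.
move=> l1 l0; pose eta : R := (1 - lam) / 3.
have e0 : 0 < eta by rewrite divr_gt0// subr_gt0.
have e3 : eta < 3^-1 by rewrite /eta -[X in _ < X]mul1r ltr_pM2r ?invr_gt0// gtrBl.
have [phi [tphi phij gphi] ] := lower_test_function e0 e3.
have lamE : 1 - 3 * eta = lam by rewrite /eta; field.
rewrite lamE in phij.
have [T0 hT] := torsion_test_ge i0 p1 qE oO bO tphi.
have ij := gauge_powR_integrable.
have V0 : 0 <= volume Om by exact: fine_ge0.
have il : mu.-integrable Om (EFin \o (fun=> lam `^ q)).
  apply: (bounded_integrable (M := lam `^ q) mO bO (measurable_cst _)) => x _.
  by rewrite ger0_norm ?powR_ge0.
have iphi := integrableS measurableT mO (@subsetT _ Om) (test_integrable tphi).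
have h1 : (lam `^ q - n%:R / (n%:R + q)) * volume Om <= \int[mu]_(x in Om) phi x.
  apply: le_trans (le_Rintegral mO (integrable_subr mO il ij) iphi (fun x _ => phij x)).
  rewrite (RintegralB mO il ij) Rintegral_cst// mulrBl lerD2l lerN2.
  exact: Rintegral_gauge_le.
apply: (le_trans h1); apply: (le_trans hT); apply: ler_wpM2l; first exact: powR_ge0.
apply: le_powR; rewrite ?invr_ge0 ?(ltW p0)//; first exact: energy_ge0.
have Vg := VLp_grad p1 mO tphi.
have qr0 : 0 <= q / r by rewrite divr_ge0// ltW.
apply: (@le_trans _ _ (\int[mu]_(x in Om) ((q / r) `^ p * j x `^ q))).
  apply: (le_Rintegral mO (integrable_energy i0 p1 qE mO Vg) (integrable_scaler mO _ ij)) => x _.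
  have -> : (q / r) `^ p * j x `^ q = (q / r * j x `^ (q - 1)) `^ p.
    by rewrite [RHS]powRM ?powR_ge0// -powRrM (conj_expV p1 qE).
  apply: le_powR; [exact: ltW|exact: euclid_norm_ge0|exact: gphi].
rewrite (RintegralZl _ mO ij); apply: ler_wpM2l; first exact: powR_ge0.
exact: Rintegral_gauge_le.
Qed.

Lemma torsion_ge_ball : volume Om * r `^ q / (n%:R `^ (q - 1) * (n%:R + q)) <=
  torsional_rigidity p Om.
Proof.
have N0 : (0 : R) < n%:R by rewrite ltr0n (leq_trans _ (ltn_ord i0)).
have Ox0 := gauge_center r0 ballO.
have V0 : 0 < volume Om by apply: open_volume_gt0 => //; exists x0.
have T0 : 0 <= torsional_rigidity p Om.
  by have [] := torsion_test_ge i0 p1 qE oO bO (test0 Om).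
apply: lower_bound_arith => //.
set K := (n%:R / (n%:R + q) * volume Om).
have s0 : 0 < n%:R + q by rewrite addr_gt0.
have K0 : 0 <= K by rewrite /K mulr_ge0 ?divr_ge0// ltW.
have qr0 : 0 <= q / r by rewrite divr_ge0// ltW.
have h : (1 - n%:R / (n%:R + q)) * volume Om <=
    torsional_rigidity p Om `^ q^-1 * ((q / r) `^ p * K) `^ p^-1.
  have lc := @cvg_one_sub_harmonic R.
  have lqc : (fun k : nat => (1 - k.+2%:R^-1 : R) `^ q) @ \oo --> (1 : R).
    by have := powR_cvg_gt0 (r := q) ltr01 lc; rewrite powR1; exact.
  have c : (fun k : nat => ((1 - k.+2%:R^-1 : R) `^ q - n%:R / (n%:R + q)) * volume Om) @ \oo -->
      (1 - n%:R / (n%:R + q)) * volume Om.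
    by apply: cvgMr_tmp; apply: cvgB; [exact: lqc|exact: cvg_cst].
  apply: (cvgr_to_le c); apply: nearW => k; apply: lower_bound_step.
    by rewrite ltrBlDr ltrDl invr_gt0.
  by rewrite subr_gt0 invf_lt1// ltr1n.
have sE : 1 - n%:R / (n%:R + q) = q / (n%:R + q) by field; rewrite gt_eqF.
rewrite {}sE in h.
have X0 : 0 <= q / (n%:R + q) * volume Om by rewrite mulr_ge0 ?divr_ge0// ltW.
have := le_powR (ltW q0) X0 h.
rewrite [X in _ <= X -> _]powRM ?powR_ge0// powRVK ?gt_eqF//.
move=> /le_trans; apply; rewrite ler_wpM2l//.
have pq : p^-1 * q = q - 1 by rewrite -{1}(conj_expV p1 qE) mulrC mulfK// gt_eqF.
rewrite -powRrM pq [X in X <= _]powRM ?powR_ge0// -powRrM.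
by rewrite [p * _]mulrC (conj_expV p1 qE).
Qed.
End torsion_lower_bound.

(** * Comparison *)

Section inradius.
Context {R : realType} {n : nat} (i0 : 'I_n).
Variable Om : set 'rV[R]_n.
Hypothesis cOm : convex_domain Om.
Local Notation radii := [set r | 0 < r /\ exists x, euclid_ball x r `<=` Om].

Lemma inradius_has_sup : has_sup radii.
Proof.
have [[x Ox] oO [M [Mr OM] ] _] := cOm.
split; first by have [e e0 he] := euclid_ball_sub oO Ox; exists e; split => //; exists x.
pose K : R := `|M| + 1.
have OK y : Om y -> `|y| <= K.
  by apply: OM; rewrite (le_lt_trans (ler_norm M))// ltrDl.
exists (2 * (K + K)) => r [r0 [y hy] ].
pose e : 'rV[R]_n := delta_mx ord0 i0.
have e1 : euclid_norm e = 1.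
  have h : dotrV e e = 1 by rewrite dotrV_delta mxE !eqxx.
  by rewrite /euclid_norm h sqrtr1.
have r2 : 0 <= r / 2 by rewrite divr_ge0// ltW.
have Oy : Om y by apply: hy; rewrite /euclid_ball/= subrr euclid_norm0.
have Oz : Om (y + (r / 2) *: e).
  apply: hy; rewrite /euclid_ball/= addrAC subrr add0r euclid_normZ e1 mulr1 ger0_norm//.
  by rewrite ltr_pdivrMr// ltr_pMr// ltr1n.
have h1 : `|(y + (r / 2) *: e) - y| <= K + K.
  by apply: (le_trans (ler_normB _ _)); apply: lerD; exact: OK.
have h2 : r / 2 <= `|(y + (r / 2) *: e) - y|.
  rewrite addrAC subrr add0r; have := coord_le_norm ((r / 2) *: e) ord0 i0.
  by rewrite !mxE !eqxx mulr1 ger0_norm.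
by rewrite -ler_pdivrMl// mulrC; exact: le_trans h2 h1.
Qed.

Lemma le_inradius x (t : R) : 0 < t -> euclid_ball x t `<=` Om -> t <= inradius Om.
Proof.
by move=> t0 ht; apply: (sup_upper_bound inradius_has_sup); split => //; exists x.
Qed.

Lemma lt_inradius (t : R) : t < inradius Om -> exists x, euclid_ball x t `<=` Om.
Proof.
move=> tr; have e0 : 0 < inradius Om - t by rewrite subr_gt0.
have [s [s0 [x hx] ] ] := sup_adherent e0 inradius_has_sup.
rewrite -/(inradius Om) subKr => ts; exists x.
by move=> y yt; apply: hx; exact: lt_trans ts.
Qed.

Lemma torsion_le_inradius (p q : R) : 1 < p -> q = p / (p - 1) ->
  torsional_rigidity p Om <= inradius Om `^ q / (q + 1) * volume Om.
Proof.
move=> p1 qE; have q0 : 0 < q by exact: lt_trans (conj_gt1 p1 qE).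
have [_ oO bO _] := cOm.
have r0 : 0 <= inradius Om.
  have [[r [r0 [x hx] ] ] _] := inradius_has_sup.
  by apply: le_trans (le_inradius r0 hx); exact: ltW.
apply: (torsion_test_le i0 p1 qE oO bO).
  rewrite mulr_ge0//; last exact: fine_ge0.
  by rewrite divr_ge0 ?powR_ge0// addr_ge0// ltW.
move=> phi tphi; exact: (Rintegral_test_inradius i0 p1 qE cOm r0 le_inradius tphi).
Qed.

(** The supremum defining the inradius need not be shown to be attained: the bound for a centre of
    some inscribed ball is applied to radii r (1 - 1/(k+2)), with centres depending on k, and passes
    to the limit. *)
Lemma torsion_ge_inradius (p q : R) : 1 < p -> q = p / (p - 1) ->
  volume Om * inradius Om `^ q / (n%:R `^ (q - 1) * (n%:R + q)) <= torsional_rigidity p Om.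
Proof.
move=> p1 qE; have q0 : 0 < q by exact: lt_trans (conj_gt1 p1 qE).
have [_ oO bO cO] := cOm.
set r := inradius Om.
have r0 : 0 < r.
  have [[s [s0 [x hx] ] ] _] := inradius_has_sup.
  by apply: lt_le_trans (le_inradius s0 hx).
have lc : (fun k : nat => r * (1 - k.+2%:R^-1)) @ \oo --> r.
  have h := @cvg_one_sub_harmonic R.
  by have := cvgMl_tmp (a := r) h; rewrite mulr1; exact.
have c : (fun k : nat => volume Om * (r * (1 - k.+2%:R^-1)) `^ q / (n%:R `^ (q - 1) * (n%:R + q))) @ \oo -->
    volume Om * r `^ q / (n%:R `^ (q - 1) * (n%:R + q)).
  by apply: cvgMr_tmp; apply: cvgMl_tmp; exact: powR_cvg_gt0.
apply: (cvgr_to_le c); apply: nearW => k.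
have k1 : (k.+2%:R^-1 : R) < 1 by rewrite invf_lt1// ltr1n.
have rk : r * (1 - k.+2%:R^-1) < r by rewrite gtr_pMr// gtrBl invr_gt0.
have [x hx] := lt_inradius rk.
apply: (torsion_ge_ball i0 p1 qE oO bO cO _ hx).
by rewrite mulr_gt0// subr_gt0.
Qed.

End inradius.

Section unit_ball_ratio.
Context {R : realType}.
Variables (p q : R).
Hypotheses (p1 : 1 < p) (qE : q = p / (p - 1)).
Let p0 : 0 < p. Proof. exact: lt_trans p1. Qed.
Let q1 : 1 < q. Proof. exact: conj_gt1 p1 qE. Qed.
Let q0 : 0 < q. Proof. exact: lt_trans q1. Qed.

Lemma convex_unit_ball n : convex_set (@unit_ball R n).
Proof.
move=> x y t; rewrite unit_ballE !inE /= => x1 y1.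
have t0 : 0 <= t%:num by [].
have t1 : 0 <= 1 - t%:num by rewrite subr_ge0.
have -> : conv t x y = t%:num *: (x : 'rV[R]_n) + (1 - t%:num) *: (y : 'rV[R]_n) by [].
apply: (le_lt_trans (euclid_normD _ _)); rewrite !euclid_normZ !ger0_norm//.
have [tt0|tn0] := eqVneq t%:num 0; first by rewrite tt0 mul0r add0r subr0 mul1r.
have tp : 0 < t%:num by rewrite lt_neqAle eq_sym tn0.
have : t%:num * euclid_norm (x : 'rV[R]_n) < t%:num * 1 by rewrite ltr_pM2l.
have : (1 - t%:num) * euclid_norm (y : 'rV[R]_n) <= (1 - t%:num) * 1 by rewrite ler_wpM2l// ltW.
lra.
Qed.

Lemma unit_ball_volume_gt0 n : 0 < volume (@unit_ball R n).
Proof.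
apply: open_volume_gt0; [exact: open_unit_ball|exact: bounded_unit_ball|].
by exists 0; rewrite unit_ballE /= euclid_norm0 ltr01.
Qed.

Lemma torsion_unit_ball_ge n (i0 : 'I_n) :
  volume (@unit_ball R n) / (n%:R `^ (q - 1) * (n%:R + q)) <=
  torsional_rigidity p (@unit_ball R n).
Proof.
have := torsion_ge_ball i0 p1 qE (@open_unit_ball R n) (@bounded_unit_ball R n)
  (@convex_unit_ball n) ltr01 (fun x h => h).
by rewrite powR1 mulr1; exact.
Qed.

Lemma torsion_unit_ball_gt0 n (i0 : 'I_n) : 0 < torsional_rigidity p (@unit_ball R n).
Proof.
apply: lt_le_trans (torsion_unit_ball_ge i0).
have n0 : (0 : R) < n%:R by rewrite ltr0n (leq_trans _ (ltn_ord i0)).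
by rewrite divr_gt0 ?unit_ball_volume_gt0// mulr_gt0 ?powR_gt0// addr_gt0.
Qed.

(** The normalized rigidity is (T/|B|)^(1-p), and (1-p)(-1/p) = 1/q. *)
Lemma gammaE n (i0 : 'I_n) :
  gamma n p = ((torsional_rigidity p (@unit_ball R n) / volume (@unit_ball R n)) /
    (torsional_rigidity p (@unit_ball R 1) / volume (@unit_ball R 1))) `^ q^-1.
Proof.
have N m (j0 : 'I_m) : normalized_rigidity p (@unit_ball R m) =
    (torsional_rigidity p (@unit_ball R m) / volume (@unit_ball R m)) `^ (1 - p).
  have V0 := unit_ball_volume_gt0 m; have T0 := torsion_unit_ball_gt0 j0.
  rewrite /normalized_rigidity powRM ?invr_ge0 ?(ltW V0) ?(ltW T0)// mulrC; congr (_ * _).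
  rewrite -powR_inv1 ?(ltW V0)// -powRrM; congr (_ `^ _); ring.
rewrite /gamma (N n i0) (N 1%N ord0).
set X := torsional_rigidity p (unit_ball n) / _; set Y := torsional_rigidity p (unit_ball 1) / _.
have X0 : 0 < X by rewrite divr_gt0 ?torsion_unit_ball_gt0 ?unit_ball_volume_gt0.
have Y0 : 0 < Y.
  exact: (divr_gt0 (@torsion_unit_ball_gt0 1 ord0) (unit_ball_volume_gt0 1)).
have -> : X `^ (1 - p) / Y `^ (1 - p) = (X / Y) `^ (1 - p).
  rewrite powRM ?invr_ge0 ?ltW//; congr (_ * _).
  by rewrite -[in RHS]powR_inv1 ?(ltW Y0)// -powRrM mulN1r powRN.
rewrite -powRrM; congr (_ `^ _); rewrite qE; field.
by rewrite subr_eq0 !gt_eqF.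
Qed.

(** The n-ball stands in the numerator and needs the upper bound; the interval stands in the
    denominator and needs the lower bound, in which n = 1 leaves q + 1. *)
Lemma gamma_powR_le n (i0 : 'I_n) :
  gamma n p `^ q <= (q + 1) / (n%:R `^ (q - 1) * (n%:R + q)).
Proof.
have Vn := unit_ball_volume_gt0 n; have V1 := unit_ball_volume_gt0 1.
have T1 := @torsion_unit_ball_gt0 1 ord0; have Tn := torsion_unit_ball_gt0 i0.
have n0 : (0 : R) < n%:R by rewrite ltr0n (leq_trans _ (ltn_ord i0)).
rewrite (gammaE i0) powRVK ?gt_eqF//; last first.
  by rewrite divr_ge0// divr_ge0// ltW.
rewrite ler_pdivrMr ?divr_gt0// ler_pdivrMr//.
have h1 := @torsion_unit_ball_ge 1 ord0.
have h2 := torsion_unit_ball_le i0 p1 qE.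
rewrite powR1 mul1r in h1.
have h3 : 1 <= (q + 1) * (torsional_rigidity p (@unit_ball R 1) / volume (@unit_ball R 1)).
  rewrite mulrA ler_pdivlMr// mul1r mulrC -ler_pdivrMr ?addr_gt0// [q + 1]addrC.
  exact: h1.
apply: (le_trans h2); rewrite -[leLHS]mulr1.
have d0 : 0 <= volume (unit_ball n) / (n%:R `^ (q - 1) * (n%:R + q)) :> R.
  by rewrite divr_ge0 ?(ltW Vn)// mulr_ge0 ?powR_ge0// addr_ge0 ?ltW.
apply: (le_trans (ler_wpM2l d0 h3)).
rewrite le_eqVlt; apply/orP; left; apply/eqP; ring.
Qed.

End unit_ball_ratio.

Theorem proposition5 (R : realType) (D : nat) (p c a b : R) :
  (2 <= D)%N -> 1 < p -> 0 < c -> 0 < a -> a < b ->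
  b < (c / volume (unit_ball D)) `^ (D%:R^-1) ->
  a <= gamma D p * b ->
  (forall Oa Ob : set 'rV[R]_D,
    (domains_of_volume c `&` domains_of_inradius a) Oa ->
    (domains_of_volume c `&` domains_of_inradius b) Ob ->
    torsional_rigidity p Oa <= torsional_rigidity p Ob) /\
  (a < gamma D p * b ->
   forall Oa Ob : set 'rV[R]_D,
    (domains_of_volume c `&` domains_of_inradius a) Oa ->
    (domains_of_volume c `&` domains_of_inradius b) Ob ->
    torsional_rigidity p Oa < torsional_rigidity p Ob).
Proof.
move=> D2 p1 c0 a0 ab _ agb.
pose q : R := p / (p - 1); have qE : q = p / (p - 1) by [].
have q0 : 0 < q by exact: lt_trans (conj_gt1 p1 qE).
have i0 : 'I_D := Ordinal (ltnW D2).
have b0 : 0 < b by exact: lt_trans ab.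
have g0 : 0 <= gamma D p * b by rewrite mulr_ge0 ?powR_ge0// ltW.
have q1 : 0 < q + 1 by rewrite addr_gt0.
have upper (Oa : set 'rV[R]_D) : (domains_of_volume c `&` domains_of_inradius a) Oa ->
    torsional_rigidity p Oa <= a `^ q / (q + 1) * c.
  move=> [[_ cE] [cOa aE] ].
  by have := torsion_le_inradius i0 cOa p1 qE; rewrite aE /volume cE.
(* Rewritten with [gamma], the lower bound has the shape of the upper one, with [gamma D p * b] in
   place of [a]. What remains is monotonicity of t^q. *)
have lower (Ob : set 'rV[R]_D) : (domains_of_volume c `&` domains_of_inradius b) Ob ->
    (gamma D p * b) `^ q / (q + 1) * c <= torsional_rigidity p Ob.
  move=> [[_ cE] [cOb bE] ].
  have := torsion_ge_inradius i0 cOb p1 qE; rewrite bE /volume cE /=; apply: le_trans.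
  rewrite powRM ?powR_ge0 ?(ltW b0)//.
  have := gamma_powR_le p1 qE i0.
  set G := gamma D p `^ q; set N := _ `^ (q - 1) * _; set B := b `^ q => GN.
  have -> : G * B / (q + 1) * c = (c * B) * (G / (q + 1)) by ring.
  apply: ler_wpM2l; first by rewrite mulr_ge0 ?powR_ge0// ltW.
  by rewrite ler_pdivrMr// mulrC.
split=> [Oa Ob HOa HOb|agb' Oa Ob HOa HOb].
- apply: (le_trans (upper Oa HOa)); apply: le_trans (lower Ob HOb).
  by rewrite ler_pM2r// ler_pM2r ?invr_gt0// le_powR// ltW.
- apply: (le_lt_trans (upper Oa HOa)); apply: lt_le_trans (lower Ob HOb).
  by rewrite ltr_pM2r// ltr_pM2r ?invr_gt0// lt_powR// ltW.
Qed.
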